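(* Let $\alpha\in(1/2,1)$ and $n\ge 1$. Let $L\in C(\mathbb{R},\mathbb{R}^{n\times n})$ and $W:\mathbb{R}\times\mathbb{R}^n\to\mathbb{R}$ satisfy: (L) $L(t)$ is a positive definite symmetric matrix for all $t\in\mathbb{R}$, and there exists $l\in C(\mathbb{R},(0,\infty))$ with $l(t)\to+\infty$ as $|t|\to\infty$ such that $(L(t)x,x)\ge l(t)|x|^2$ for all $t\in\mathbb{R}$, $x\in\mathbb{R}^n$; (W1) $W\in C^1(\mathbb{R}\times\mathbb{R}^n,\mathbb{R})$ and there is a constant $\mu>2$ such that $0<\mu W(t,x)\le (x,\nabla W(t,x))$ for all $t\in\mathbb{R}$ and $x\in\mathbb{R}^n\setminus\{0\}$; (W2) $|\nabla W(t,x)|=o(|x|)$ as $x\to 0$, uniformly with respect to $t\in\mathbb{R}$; (W3) there exists $\overline{W}\in C(\mathbb{R}^n,\mathbb{R})$ such that $|W(t,x)|+|\nabla W(t,x)|\le|\overline{W}(x)|$ for all $x\in\mathbb{R}^n$, $t\in\mathbb{R}$. Then the fractional Hamiltonian system $$ {}_{t}D_{\infty}^{\alpha}\big({}_{-\infty}D_{t}^{\alpha}u(t)\big)+L(t)u(t)=\nabla W(t,u(t)),\qquad t\in\mathbb{R},$$ possesses at least one nontrivial (weak) solution, i.e. there exists $u\in X^\alpha$, $u\neq 0$, which is a critical point of the functional $$I(u)=\frac12\int_{\mathbb{R}}\big[|{}_{-\infty}D_t^{\alpha}u(t)|^2+(L(t)u(t),u(t))\big]\,dt-\int_{\mathbb{R}}W(t,u(t))\,dt$$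 on $X^\alpha$; equivalently $\int_{\mathbb{R}}[({}_{-\infty}D_t^\alpha u,{}_{-\infty}D_t^\alpha v)+(L(t)u,v)]\,dt=\int_{\mathbb{R}}(\nabla W(t,u),v)\,dt$ for all $v\in X^\alpha$.
   Context: $\widehat{u}(w)=\int_{\mathbb{R}}e^{-ixw}u(x)\,dx$ denotes the Fourier transform (componentwise for $\mathbb{R}^n$-valued functions). The Liouville–Weyl derivatives are ${}_{-\infty}D_x^\alpha u=\frac{d}{dx}\,{}_{-\infty}I_x^{1-\alpha}u$ and ${}_xD_\infty^\alpha u=-\frac{d}{dx}\,{}_xI_\infty^{1-\alpha}u$, where ${}_{-\infty}I_x^{\beta}u(x)=\frac1{\Gamma(\beta)}\int_{-\infty}^x(x-\xi)^{\beta-1}u(\xi)d\xi$ and ${}_xI_\infty^{\beta}u(x)=\frac1{\Gamma(\beta)}\int_x^{\infty}(\xi-x)^{\beta-1}u(\xi)d\xi$; in Fourier terms $\widehat{{}_{-\infty}D_x^\alpha u}(w)=(iw)^\alpha\widehat u(w)$. $H^\alpha(\mathbb{R},\mathbb{R}^n)$ is the closure of $C_0^\infty(\mathbb{R},\mathbb{R}^n)$ under the norm $\|u\|_\alpha=(\|u\|_{L^2}^2+\||w|^\alpha\widehat u\|_{L^2}^2)^{1/2}$, equivalently under $(\|u\|_{L^2}^2+\|{}_{-\infty}D_t^\alpha u\|_{L^2}^2)^{1/2}$. $X^\alpha=\{u\in H^\alpha(\mathbb{R},\mathbb{R}^n):\int_{\mathbb{R}}|{}_{-\infty}D_t^\alpha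 u|^2+(L(t)u(t),u(t))\,dt<\infty\}$ with inner product $\langle u,v\rangle_{X^\alpha}=\int_{\mathbb{R}}({}_{-\infty}D_t^\alpha u,{}_{-\infty}D_t^\alpha v)+(L(t)u,v)\,dt$ and norm $\|u\|_{X^\alpha}=\langle u,u\rangle^{1/2}$. *)

(* Defs.v *)
From HB Require Import structures.
From mathcomp Require Import all_boot all_order all_algebra.
From mathcomp Require Import all_classical all_reals all_analysis.
Set Implicit Arguments. Unset Strict Implicit. Unset Printing Implicit Defensive.
Import Order.TTheory GRing.Theory Num.Theory.
Import numFieldNormedType.Exports.
Local Open Scope classical_set_scope.
Local Open Scope ring_scope.

Section Defs.
Variable R : realType.
Variable n : nat.
Local Notation mu := (@lebesgue_measure R).

Definition dotv (x y : 'rV[R]_n) : R := \sum_(i < n) x ord0 i * y ord0 i.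
Definition sqnorm (x : 'rV[R]_n) : R := dotv x x.
Definition enorm (x : 'rV[R]_n) : R := Num.sqrt (sqnorm x).
Definition qform (A : 'M[R]_n) (x y : 'rV[R]_n) : R :=
  \sum_(i < n) \sum_(j < n) A i j * x ord0 j * y ord0 i.

Definition Gamma (b : R) : R :=
  Rintegral mu `]0%R, +oo[%classic (fun s => s `^ (b - 1) * expR (- s)).

Definition LWint (b : R) (f : R -> R) (x : R) : R :=
  Rintegral mu `]-oo, x[%classic (fun xi => (x - xi) `^ (b - 1) * f xi) / Gamma b.

Definition LWder (a : R) (f : R -> R) (x : R) : R :=
  derive1 (LWint (1 - a) f) x.

Definition LWderv (a : R) (u : R -> 'rV[R]_n) (x : R) : 'rV[R]_n :=
  \row_i LWder a (fun t => u t ord0 i) x.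

Definition smooth_compact (u : R -> 'rV[R]_n) : Prop :=
  (forall i (k : nat) x,
      derivable (derive1n k (fun t => u t ord0 i)) x 1) /\
  exists M : R, forall x, M < `|x| -> u x = 0.

Definition L2fun (u : R -> 'rV[R]_n) : Prop :=
  (forall i, measurable_fun setT (fun t => u t ord0 i)) /\
  (\int[mu]_x (sqnorm (u x))%:E < +oo)%E.

(* u belongs to H^alpha (closure of C_0^oo for the norm
   (|u|_L2^2 + |D^alpha u|_L2^2)^(1/2)), and g is the (extended)
   fractional derivative -oo D_t^alpha u, i.e. the L2 limit of
   LWderv a phi_k for C_0^oo functions phi_k -> u in L2. *)
Definition Halpha_der (a : R) (u g : R -> 'rV[R]_n) : Prop :=
  L2fun u /\ L2fun g /\
  exists phi : nat -> R -> 'rV[R]_n,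
    (forall k, smooth_compact (phi k)) /\
    (((\int[mu]_x (sqnorm (phi k x - u x))%:E) @[k --> \oo] --> 0)%E) /\
    (((\int[mu]_x (sqnorm (LWderv a (phi k) x - g x))%:E) @[k --> \oo] --> 0)%E).

Definition Xalpha_der (a : R) (L : R -> 'M[R]_n) (u g : R -> 'rV[R]_n) : Prop :=
  Halpha_der a u g /\
  (\int[mu]_t ((sqnorm (g t) + qform (L t) (u t) (u t))%:E) < +oo)%E.

Definition gradW (W : R -> 'rV[R]_n -> R) (t : R) (x : 'rV[R]_n) : 'rV[R]_n :=
  \row_i ('D_(delta_mx ord0 i) (W t) x).

Definition C1W (W : R -> 'rV[R]_n -> R) : Prop :=
  continuous (fun p : R * 'rV[R]_n => W p.1 p.2) /\
  (forall t x, derivable (fun s => W s x) t 1) /\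
  (forall t x i, derivable (W t) x (delta_mx ord0 i)) /\
  continuous (fun p : R * 'rV[R]_n => derive1 (fun s => W s p.2) p.1) /\
  (forall i, continuous (fun p : R * 'rV[R]_n => gradW W p.1 p.2 ord0 i)).

End Defs.

(* Main.v *)
Require Import Defs.
From HB Require Import structures.
From mathcomp Require Import all_boot all_order all_algebra.
From mathcomp Require Import all_classical all_reals all_analysis.
From mathcomp Require Import measurable_realfun lebesgue_integral_under.
From mathcomp Require Import ring lra.
Import Order.TTheory GRing.Theory Num.Theory.
Import numFieldNormedType.Exports.
Local Open Scope classical_set_scope.
Local Open Scope ring_scope.
Set Implicit Arguments. Unset Strict Implicit. Unset Printing Implicit Defensive.

(* Mountain pass. For C_0^oo functions phi with g = D^a phi one has phi = const * (s_+^(a-1) convolved with g), and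
   since 2a - 1 > 0 Cauchy-Schwarz gives the Hoelder bound |phi(x+h) - phi(x)|^2 <= C h^(2a-1) |g|_2^2 without any Fourier
   analysis. Hence every element of X^a has a continuous representative, bounded by its norm, and a bounded sequence has
   a subsequence converging locally uniformly; as l(t) -> oo the tails of |u|^2 are uniformly small, so it converges in L^2.
   The functional satisfies I >= rho^2/4 on a sphere by (W2), and is bounded above along a ray by superquadraticity, while
   (W1) gives I'(u)u <= mu I(u) - (mu/2 - 1)|u|^2, so that on large spheres in {I <= M} the radial derivative is negative.
   Paths are replaced by finite chains of small steps and the deformation flow by one explicit step along an almost
   gradient; this yields a bounded Palais-Smale sequence at a positive level without completeness or differential
   equations. Compactness in L^2 upgrades it to a convergent one, and its limit is a critical point; it is nonzero because
   the level is positive. *)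

(** (W3) allows any growth of W in x, so all estimates are made on balls of X^a: there the sup bound
    confines the values of u to one ball of R^n, and the superposition operator u -> grad W(t, u) is
    uniformly continuous. Uniform continuity of I' on balls is exactly what a discrete deformation
    needs, because a moved chain must again have small steps. Boundedness of the almost critical
    points is built in: chains stop as soon as they leave a ball, and the negative radial derivative
    makes the deformation push exit points outwards, so the search never leaves a slightly larger
    ball. The second obstacle is that H^a is given by L^2 limits while W(t, u(t)) has to be
    estimated at each t. The argument therefore works with pairs (u, D^a u) in which u is the
    everywhere limit of its test functions; arbitrary members of the space return only at the end,
    through almost everywhere equality. *)

Notation integ f := ((@lebesgue_measure _).-integrable setT (EFin \o f)).
Notation Ig f := (Rintegral (@lebesgue_measure _) setT f).

(** * Integrals over the real line *)

Section Integrals.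
Variable R : realType.
Local Notation mu := (@lebesgue_measure R).
Implicit Types f g h : R -> R.

Lemma integ_msr f : integ f -> measurable_fun setT f.
Proof. by move/integrableP => [/measurable_EFinP]. Qed.

Lemma integ_le g f : measurable_fun setT f -> integ g ->
  (forall x, `|f x| <= g x) -> integ f.
Proof.
move=> mf ig fg; apply: le_integrable ig => //; first exact/measurable_EFinP.
move=> x _ /=; rewrite lee_fin; apply: le_trans (fg x) _; exact: ler_norm.
Qed.

Lemma integ_lty f : measurable_fun setT f -> (forall x, 0 <= f x) ->
  ((\int[mu]_x (f x)%:E < +oo)%E) -> integ f.
Proof.
move=> mf f0 fi; apply/integrableP; split; first exact/measurable_EFinP.
rewrite (_ : (\int[mu]_x _)%E = (\int[mu]_x (f x)%:E)%E) //.
by apply: eq_integral => x _ /=; rewrite ger0_norm.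
Qed.

Lemma integ_fin f : integ f -> (\int[mu]_x (f x)%:E)%E = (Ig f)%:E.
Proof. by move=> fi; rewrite /Rintegral fineK //; exact: integrable_fin_num. Qed.

Lemma integD f g : integ f -> integ g -> integ (fun x => f x + g x).
Proof. by move=> fi gi; rewrite (_ : _ \o _ = (EFin \o f) \+ (EFin \o g))%E //; exact: integrableD. Qed.

Lemma integZ k f : integ f -> integ (fun x => k * f x).
Proof.
move=> fi; rewrite (_ : _ \o _ = fun x => (k%:E * (EFin \o f) x)%E) //.
exact: integrableZl.
Qed.

Lemma integB f g : integ f -> integ g -> integ (fun x => f x - g x).
Proof.
move=> fi gi; rewrite (_ : (fun x => _) = fun x => f x + (- 1) * g x); last first.
  by apply/funext => x; rewrite mulN1r.
by apply: integD => //; exact: integZ.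
Qed.

Lemma IgD f g : integ f -> integ g -> Ig (fun x => f x + g x) = Ig f + Ig g.
Proof. by move=> fi gi; rewrite RintegralD. Qed.

Lemma IgB f g : integ f -> integ g -> Ig (fun x => f x - g x) = Ig f - Ig g.
Proof. by move=> fi gi; rewrite RintegralB. Qed.

Lemma IgZ k f : integ f -> Ig (fun x => k * f x) = k * Ig f.
Proof. by move=> fi; rewrite RintegralZl. Qed.

Lemma Ig_le f g : integ f -> integ g -> (forall x, f x <= g x) -> Ig f <= Ig g.
Proof. by move=> fi gi fg; apply: le_Rintegral. Qed.

Lemma Ig_ge0 f : (forall x, 0 <= f x) -> 0 <= Ig f.
Proof. by move=> f0; apply: Rintegral_ge0. Qed.

Lemma eq_Ig f g : f =1 g -> Ig f = Ig g.
Proof. by move=> fg; congr (Rintegral _ _ _); exact/funext. Qed.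

Lemma Ig_norm f : integ f -> `|Ig f| <= Ig (fun x => `|f x|).
Proof. by move=> fi; apply: le_normr_Rintegral. Qed.

Lemma integ_norm f : integ f -> integ (fun x => `|f x|).
Proof. by move=> fi; exact: integrable_norm. Qed.

Lemma Ig_normle g f : measurable_fun setT f -> integ g ->
  (forall x, `|f x| <= g x) -> `|Ig f| <= Ig g.
Proof.
move=> mf ig fg; have fi := integ_le mf ig fg.
by apply: le_trans (Ig_norm fi) _; apply: Ig_le => //; exact: integ_norm.
Qed.

Lemma Ig_ae g f : measurable_fun setT f -> integ g -> {ae mu, forall x, f x = g x} ->
  integ f /\ Ig f = Ig g.
Proof.
move=> mf gi fg.
have ae : ae_eq mu setT (EFin \o f) (EFin \o g).
  by apply: (@filterS _ _ (ae_filter_ringOfSetsType mu) _ _ _ fg) => x /= -> _.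
have ae1 : ae_eq mu setT (fun x => `|(f x)%:E|%E) (fun x => `|(g x)%:E|%E).
  by apply: (@filterS _ _ (ae_filter_ringOfSetsType mu) _ _ _ fg) => x /= -> _.
have mfE : measurable_fun setT (EFin \o f) by exact/measurable_EFinP.
have mgE : measurable_fun setT (EFin \o g) := measurable_int mu gi.
split.
  apply/integrableP; split => //.
  have /integrableP[_] := gi.
  rewrite (@ae_eq_integral _ (measurableTypeR R) R mu setT _ _ measurableT _ _ ae1) //; exact: measurableT_comp.
by congr fine; apply: (@ae_eq_integral _ (measurableTypeR R) R mu setT _ _ measurableT mfE mgE ae).
Qed.

(** Lebesgue measure is determined by its values on half-open intervals, so the rescaled image
    measure need only be computed there. *)
Lemma lebesgue_measure_affine (a b : R) (A : set R) : 0 < a ->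
  measurable A ->
  (a%:E * pushforward mu (fun x => (a * x + b)%R : measurableTypeR R) A)%E = mu A.
Proof.
move=> a0 mA.
have mphi : measurable_fun setT (fun x : measurableTypeR R => a * x + b : measurableTypeR R).
  by apply: measurable_funD => //; exact: measurable_funM.
pose phi : {mfun measurableTypeR R >-> measurableTypeR R} :=
  HB.pack (fun x : measurableTypeR R => a * x + b : measurableTypeR R) (isMeasurableFun.Build _ _ _ _ _ mphi).
have := @lebesgue_measure_unique R
  (mscale (NngNum (ltW a0)) (pushforward mu phi)) _ A mA.
move=> ->//.
move=> _ [[x y] _ <-] /=; rewrite /mscale/= /pushforward /=.
rewrite (_ : _ @^-1` _ = `](x - b) / a, (y - b) / a]%classic); last first.
  apply/seteqP; split => z /=; rewrite !in_itv/=.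
    by move=> /andP[xz zy]; rewrite ltr_pdivrMr // ler_pdivlMr //; apply/andP; split; lra.
  by rewrite ltr_pdivrMr // ler_pdivlMr // => /andP[xz zy]; apply/andP; split; lra.
rewrite !lebesgue_measure_itv /= !lte_fin ltr_pM2r ?invr_gt0// ltrD2r.
case: ifP => _; last by rewrite mule0.
transitivity ((a * ((y - b) / a - (x - b) / a))%:E) => //.
transitivity ((y - x)%:E) => //; congr (_%:E).
by rewrite -mulrBl mulrCA mulfV ?gt_eqF// mulr1; lra.
Qed.

Lemma Ig_pushforward (c : R) (phi : measurableTypeR R -> measurableTypeR R) f : 0 < c ->
  measurable_fun setT phi ->
  (forall A, measurable A -> (c%:E * pushforward mu phi A)%E = mu A) ->
  integ f -> integ (fun x => f (phi x)) /\ Ig f = c * Ig (fun x => f (phi x)).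
Proof.
move=> c0 mphi cphi fi.
pose phi_ : {mfun measurableTypeR R >-> measurableTypeR R} :=
  HB.pack phi (isMeasurableFun.Build _ _ _ _ _ mphi).
have mf := integ_msr fi.
have H : forall h : measurableTypeR R -> \bar R, measurable_fun setT h ->
  (forall x, (0 <= h x)%E) ->
  (\int[mu]_x h x = c%:E * \int[mu]_x h (phi x : measurableTypeR R))%E.
  move=> h mh h0.
  rewrite (eq_measure_integral (mscale (NngNum (ltW c0)) (pushforward mu phi_))); last first.
    by move=> A mA _; exact: (esym (cphi A mA)).
  rewrite ge0_integral_mscale //=; congr (_ * _)%E.
  by rewrite (@ge0_integral_pushforward _ _ _ _ _ _ mphi).
have K h : integ h -> integ (fun x => h (phi x)).
  move=> hi; have mh := integ_msr hi.
  apply/integrableP; split.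
    by apply/measurable_EFinP; exact: (measurableT_comp mh).
  have /integrableP[_] := hi.
  rewrite (H (fun x => `|(h x)%:E|%E)) //; last first.
    by apply: measurableT_comp => //; exact/measurable_EFinP.
  move=> h1; rewrite ltey; apply/eqP => h2; move: h1.
  by rewrite /= in h2; rewrite h2 gt0_muley.
have L h : integ h -> (forall x, 0 <= h x) -> Ig h = c * Ig (fun x => h (phi x)).
  move=> hi h0; apply: EFin_inj.
  rewrite EFinM -!integ_fin //; last exact: K.
  rewrite (H (fun x => (h x)%:E)) //; last by apply/measurable_EFinP; exact: integ_msr.
split; first exact: K.
have fa := integ_norm fi.
have fp := integD fi fa.
(* The nonnegative case [L] extends to signed [f] through f = (f + |f|) - |f|. *)
rewrite (@eq_Ig f (fun x => (f x + `|f x|) - `|f x|)); last by move=> x; rewrite addrK.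
rewrite IgB // L // ?(L _ fa) //; last by move=> x; rewrite -lerBlDr sub0r lerNnormlW.
rewrite -mulrBr -IgB //; last 2 first.
- exact: (K _ fp).
- exact: (K _ fa).
by congr (_ * _); apply: eq_Ig => x; rewrite addrK.
Qed.

Lemma Ig_affine a b f : 0 < a -> integ f ->
  integ (fun x => f (a * x + b)) /\ Ig f = a * Ig (fun x => f (a * x + b)).
Proof.
move=> a0; apply: (@Ig_pushforward a (fun x => a * x + b)) => //.
- by apply: measurable_funD => //; exact: measurable_funM.
- by move=> A mA; exact: lebesgue_measure_affine.
Qed.

Lemma Ig_refl a f : integ f ->
  integ (fun x => f (a - x)) /\ Ig f = Ig (fun x => f (a - x)).
Proof.
move=> fi; have [fi1 e1] := @Ig_affine 1 a f ltr01 fi.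
have [|A mA|fi2 e2] := @Ig_pushforward 1 (fun x => - x) _ ltr01 _ _ fi1.
- exact: oppr_measurable.
- by rewrite mul1e lebesgue_measureN.
have E : (fun x => f (1 * - x + a)) = (fun x => f (a - x)).
  by apply/funext => x; rewrite mul1r addrC.
rewrite -E; split=> //.
by rewrite e1 e2 !mul1r.
Qed.

Lemma Ig_scale a f : 0 < a -> integ f ->
  integ (fun x => f (a * x)) /\ Ig f = a * Ig (fun x => f (a * x)).
Proof.
move=> a0 fi; have := Ig_affine 0 a0 fi.
by under eq_fun do rewrite addr0.
Qed.

Lemma Ig_shift b f : integ f ->
  integ (fun x => f (x + b)) /\ Ig f = Ig (fun x => f (x + b)).
Proof.
move=> fi; have := @Ig_affine 1 b f ltr01 fi.
by rewrite mul1r; under eq_fun do rewrite mul1r.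
Qed.

(* The kernel s_+^p: Liouville-Weyl integrals are convolutions with it. *)
Definition kp (p s : R) : R := if 0 < s then s `^ p else 0.

Lemma kp_ge0 p s : 0 <= kp p s.
Proof. by rewrite /kp; case: ifP => // _; exact: powR_ge0. Qed.

Lemma kp_gt0E p s : 0 < s -> kp p s = s `^ p.
Proof. by rewrite /kp => ->. Qed.

Lemma kp_le0E p s : s <= 0 -> kp p s = 0.
Proof. by rewrite /kp leNgt => /negbTE ->. Qed.

Lemma measurable_itvif (i : interval R) f : measurable_fun setT f ->
  measurable_fun setT (fun x => if x \in i then f x else 0).
Proof.
move=> mf; rewrite (_ : (fun _ => _) = f \_ [set` i]).
  by apply/measurable_restrict => //; exact: measurable_funTS.
by apply/funext => x; rewrite patchE mem_setE.
Qed.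

Lemma measurable_kp p : measurable_fun setT (kp p).
Proof.
rewrite (_ : kp p = fun x => if x \in `]0, +oo[ then x `^ p else 0).
  by apply: measurable_itvif; exact: measurable_powR.
by apply/funext => x; rewrite /kp in_itv /= andbT.
Qed.

Lemma integ_itv (i : interval R) f : measurable_fun setT f ->
  mu.-integrable [set` i] (EFin \o f) ->
  integ (fun x => if x \in i then f x else 0).
Proof.
move=> mf fi; rewrite (_ : (fun x => _) = f \_ [set` i]).
  rewrite -restrict_EFin; apply/integrable_restrict => //.
  by rewrite setTI.
by apply/funext => x; rewrite patchE mem_setE.
Qed.

Lemma Ig_itv (i : interval R) f :
  Rintegral mu [set` i] f = Ig (fun x => if x \in i then f x else 0).
Proof.
rewrite Rintegral_mkcond; apply: eq_Ig => x.
by rewrite patchE mem_setE.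
Qed.

Lemma derive_powR p (x : R) : 0 < x ->
  is_derive x 1 (fun a : R => a `^ p) (p * x `^ (p - 1)).
Proof.
move=> x0; have xi : x \in `]0, +oo[ by rewrite in_itv/= andbT.
apply: DeriveDef; first exact: derivable_powR.
by rewrite -derive1E powR_derive1.
Qed.

Lemma derive_powR_prim p (x : R) : 0 < x -> p + 1 != 0 ->
  is_derive x 1 (fun a : R => a `^ (p + 1) / (p + 1)) (x `^ p).
Proof.
move=> x0 p10; have D := derive_powR (p + 1) x0.
have D2 := is_derive_cst ((p + 1)^-1 : R) x 1.
have := is_deriveM D D2; rewrite addrK scaler0 add0r.
by rewrite /GRing.scale /= mulrA mulVf // mul1r.
Qed.

Lemma continuous_powR_gt0 p (x : R) : 0 < x -> {for x, continuous (fun a : R => a `^ p)}.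
Proof.
move=> x0; apply: differentiable_continuous.
by apply/derivable1_diffP; have [] := derive_powR p x0.
Qed.

Lemma powR_cvgy_neg (p : R) : p < 0 -> (x `^ p @[x --> +oo%R] --> (0 : R)).
Proof.
move=> p0; apply/cvgrPdist_le => e e0.
near=> x.
have x0 : 0 < x by near: x; exact: nbhs_pinfty_gt.
rewrite sub0r normrN ger0_norm ?powR_ge0//.
have : e `^ p^-1 <= x by near: x; apply: nbhs_pinfty_ge; exact: num_real.
have e1 : 0 < e `^ p^-1 by exact: powR_gt0.
move=> ex.
have : (e `^ p^-1) `^ (- p) <= x `^ (- p).
  by apply: ge0_ler_powR => //; rewrite ?nnegrE ?oppr_ge0 ltW.
rewrite -powRrM mulrN mulVf ?lt_eqF// !powRN powRr1 ?(ltW e0)//.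
by rewrite lef_pV2 ?posrE ?powR_gt0.
Unshelve. all: by end_near. Qed.

Lemma integ_pow_tail p (S : R) : p < -1 -> 0 < S ->
  let f := fun x => if x \in `[S, +oo[ then x `^ p else 0 in
  integ f /\ Ig f = S `^ (p + 1) / (- (p + 1)).
Proof.
move=> p1 S0 f.
have p10 : p + 1 < 0 by lra.
have p10n : p + 1 != 0 by rewrite lt_eqF.
have mf : measurable_fun setT f by apply: measurable_itvif; exact: measurable_powR.
have E : (\int[mu]_(x in `[S, +oo[) (x `^ p)%:E = (S `^ (p + 1) / (- (p + 1)))%:E)%E.
  rewrite (@ge0_continuous_FTC2y R _ (fun x => x `^ (p + 1) / (p + 1)) S 0).
  - rewrite -EFinB sub0r invrN mulrN //.
  - by move=> x _; exact: powR_ge0.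
  - apply: continuous_in_subspaceT => x; rewrite inE/= in_itv/= andbT => Sx.
    by apply: continuous_powR_gt0; exact: lt_le_trans Sx.
  - rewrite -[X in _ --> X](mul0r (p + 1)^-1); apply: cvgM; last exact: cvg_cst.
    exact: powR_cvgy_neg.
  - move=> x Sx; have x0 := lt_trans S0 Sx.
    by have [] := derive_powR_prim x0 p10n.
  - apply: cvg_at_right_filter; apply: cvgM; last exact: cvg_cst.
    exact: continuous_powR_gt0.
  - move=> x; rewrite in_itv/= andbT => Sx; have x0 := lt_trans S0 Sx.
    by rewrite derive1E; have [_ ->] := derive_powR_prim x0 p10n.
have f0 x : 0 <= f x by rewrite /f; case: ifP => // _; exact: powR_ge0.
have E2 : (\int[mu]_x (f x)%:E = (S `^ (p + 1) / (- (p + 1)))%:E)%E.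
  rewrite -E [RHS]integral_mkcond; apply: eq_integral => x _.
  by rewrite patchE mem_setE /f; case: ifP.
split; first by apply: integ_lty => //; rewrite E2 ltry.
by rewrite /Rintegral E2.
Qed.

(** The integrand may be singular at 0, so the fundamental theorem is applied on [c, S] and monotone
    convergence lets c tend to 0. *)
Lemma integ_pow_head p (S : R) : -1 < p -> 0 < S ->
  let f := fun x => if x \in `]0, S] then x `^ p else 0 in
  integ f /\ Ig f <= S `^ (p + 1) / (p + 1).
Proof.
move=> p1 S0 f.
have p10 : 0 < p + 1 by lra.
have p10n : p + 1 != 0 by rewrite gt_eqF.
have mf : measurable_fun setT f by apply: measurable_itvif; exact: measurable_powR.
have f0 x : 0 <= f x by rewrite /f; case: ifP => // _; exact: powR_ge0.
have c0 (c : R) : 0 < c -> c < S ->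
    ((\int[mu]_(x in `[c, S]) (x `^ p)%:E) <= (S `^ (p + 1) / (p + 1))%:E)%E.
  move=> c0 cS; rewrite (@continuous_FTC2 R _ (fun x => x `^ (p + 1) / (p + 1)) c S) //.
  - rewrite -EFinB lee_fin lerBlDr lerDl.
    by apply: mulr_ge0; [exact: powR_ge0 | rewrite invr_ge0 ltW].
  - apply: continuous_in_subspaceT => x; rewrite inE/= in_itv/= => /andP[cx _].
    by apply: continuous_powR_gt0; exact: lt_le_trans cx.
  - split.
    + move=> x; rewrite in_itv/= => /andP[cx _]; have x0 := lt_trans c0 cx.
      by have [] := derive_powR_prim x0 p10n.
    + apply: cvg_at_right_filter; apply: cvgM; last exact: cvg_cst.
      exact: continuous_powR_gt0.
    + apply: cvg_at_left_filter; apply: cvgM; last exact: cvg_cst.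
      exact: continuous_powR_gt0.
  - move=> x; rewrite in_itv/= => /andP[Sx _]; have x0 := lt_trans c0 Sx.
    by rewrite derive1E; have [_ ->] := derive_powR_prim x0 p10n.
(* The shift by 2 keeps the left end strictly below S already for i = 0, as [c0] requires. *)
pose F (i : nat) : set (measurableTypeR R) := `[S / i.+2%:R, S]%classic.
have FE : \bigcup_i F i = `]0, S]%classic.
  apply/seteqP; split => x.
    move=> [i _]; rewrite /F /= !in_itv/= => /andP[x1 ->]; rewrite andbT.
    by apply: lt_le_trans x1; rewrite divr_gt0.
  rewrite /= in_itv/= => /andP[x0 xS].
  have [k _ Hk0] : \forall k \near \oo, S / x <= k%:R by exact: nbhs_infty_ger.
  have Hk := Hk0 k (leqnn k).
  exists k => //; rewrite /F /= in_itv/= xS andbT ler_pdivrMr // mulrC -ler_pdivrMr//.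
  by apply: (le_trans Hk); rewrite ler_nat -addn2 leq_addr.
have H : (\int[mu]_(x in F i) (x `^ p)%:E @[i --> \oo] --> \int[mu]_(x in \bigcup_i F i) (x `^ p)%:E)%E.
  apply: (@ge0_nondecreasing_set_cvg_integral _ (measurableTypeR R) R F (fun x => (x `^ p)%:E) mu).
  - move=> i j ij; rewrite /F; apply/subsetPset; apply: subset_itvr.
    by rewrite bnd_simp ler_pM2l // lef_pV2 ?posrE // ler_nat.
  - by move=> i; exact: measurable_itv.
  - move=> i; apply/measurable_EFinP; apply: measurable_funTS; exact: measurable_powR.
  - by move=> i x _; rewrite lee_fin powR_ge0.
have E2 : (\int[mu]_x (f x)%:E <= (S `^ (p + 1) / (p + 1))%:E)%E.
  rewrite (_ : (\int[mu]_x (f x)%:E) = \int[mu]_(x in `]0%R, S]) (x `^ p)%:E)%E; last first.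
    rewrite [RHS]integral_mkcond; apply: eq_integral => x _.
    by rewrite patchE mem_setE /f; case: ifP.
  rewrite -FE; apply: (cvge_to_le H); apply: nearW => i; rewrite /F; apply: c0; first by rewrite divr_gt0.
  by rewrite ltr_pdivrMr // ltr_pMr // ltr1n.
have fi : integ f by apply: integ_lty => //; apply: le_lt_trans E2 _; rewrite ltry.
by split=> //; rewrite -lee_fin -integ_fin.
Qed.

End Integrals.

(** * Fractional derivatives of compactly supported C^1 functions *)

Section FracA.
Variable R : realType.
Local Notation mu := (@lebesgue_measure R).
Implicit Types f g h : R -> R.

Lemma Ig_box (a b c : R) : a <= b ->
  let f := fun x => if x \in `[a, b] then c else 0 in
  integ f /\ Ig f = c * (b - a).
Proof.
move=> ab f.
have E : mu `[a, b]%classic = (b - a)%:E.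
  rewrite lebesgue_measure_itv /= lte_fin; case: ltP => // ba.
  by rewrite (@le_anti _ _ a b) ?ab ?ba// subrr.
split.
  apply: integ_itv; first exact: measurable_cst.
  apply: continuous_compact_integrable; first exact: segment_compact.
  by apply: continuous_subspaceT => x; exact: cvg_cst.
rewrite -[Ig f](@Ig_itv R `[a, b] (fun=> c)) Rintegral_cst //= E //.
Qed.

Definition C1c f := [/\ forall x, derivable f x 1, continuous (derive1 f) &
  exists2 M, 0 < M & forall x, M < `|x| -> f x = 0].

Lemma continuous_bounded_seg f (A B : R) : continuous f ->
  exists2 K, 0 <= K & forall x, A <= x -> x <= B -> `|f x| <= K.
Proof.
move=> cf; have [AB|BA] := leP A B; last first.
  by exists 0 => // x Ax xB; have := lt_le_trans BA (le_trans Ax xB); rewrite ltxx.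
have cn : {within `[A, B], continuous (fun x => `|f x|)}.
  apply: continuous_subspaceT => x; apply: continuous_comp; first exact: cf.
  exact: norm_continuous.
have [c _ Hc] := EVT_max AB cn.
by exists `|f c| => // x Ax xB; apply: Hc; rewrite in_itv/= Ax xB.
Qed.

Lemma C1c_cont f : C1c f -> continuous f.
Proof.
move=> [df _ _] x; apply: differentiable_continuous.
exact/derivable1_diffP.
Qed.

Lemma C1c_bounds f : C1c f -> exists K : R, exists M : R, [/\ 0 <= K, 0 < M,
  forall x, `|f x| <= K /\ `|(derive1 f) x| <= K &
  forall x, M < `|x| -> f x = 0 /\ (derive1 f) x = 0].
Proof.
move=> cf; have fc := C1c_cont cf; case: cf => df cdf [M M0 fM].
have dM x : M < `|x| -> f x = 0 /\ (derive1 f) x = 0.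
  move=> Mx; split; first exact: fM.
  rewrite derive1E (@near_eq_derive _ _ _ f (cst 0)) ?derive_cst //.
  have : \forall y \near x, M < `|y|.
    have := @norm_continuous R R x => /cvgr_gt; exact.
  by apply: filterS => y; exact: fM.
have [K1 K10 H1] := continuous_bounded_seg (- M) M fc.
have [K2 K20 H2] := continuous_bounded_seg (- M) M cdf.
exists (K1 + K2), M; split => //; first by rewrite addr_ge0.
move=> x; have [|Mx] := leP `|x| M.
  rewrite ler_norml => /andP[a b]; split.
    by apply: le_trans (H1 _ a b) _; rewrite lerDl.
  by apply: le_trans (H2 _ a b) _; rewrite lerDr.
by have [-> ->] := dM x Mx; rewrite normr0 addr_ge0.
Qed.

(* An integrable majorant of s |-> kp p s * h (x - s), uniform for x <= S - M when h vanishes left of -M. *)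
Definition kbd p (K S : R) := fun s : R => K * (if s \in `]0, S] then s `^ p else 0).

Lemma kbd_integ p K S : -1 < p -> 0 < S -> integ (kbd p K S).
Proof. by move=> p1 S0; apply: integZ; have [] := integ_pow_head p1 S0. Qed.

Lemma kbd_ge0 p K S s : 0 <= K -> 0 <= kbd p K S s.
Proof. by move=> K0; rewrite /kbd mulr_ge0//; case: ifP => // _; exact: powR_ge0. Qed.

Lemma kp_bd p K M S h (x s : R) : 0 <= K -> (forall y, `|h y| <= K) ->
  (forall y, y < - M -> h y = 0) -> x + M <= S ->
  `|kp p s * h (x - s)| <= kbd p K S s.
Proof.
move=> K0 hK hM xS; rewrite normrM (ger0_norm (kp_ge0 _ _)) /kbd /kp in_itv/=.
have [s0|s0] := ltP 0 s; last by rewrite mul0r mulr_ge0.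
have [sS|Ss] := leP s S; first by rewrite mulrC ler_wpM2r ?powR_ge0.
by rewrite hM ?normr0 ?mulr0//; lra.
Qed.

Lemma measurable_refl h (x : R) : measurable_fun setT h -> measurable_fun setT (fun s : R => h (x - s)).
Proof.
move=> mh; apply: (measurableT_comp mh).
by apply: measurable_funB => //; exact: measurable_cst.
Qed.

(** The kernel restricts to s > 0, the vanishing of [h] to s <= x + M. A support bounded on the left
    alone is enough, which lets the lemma serve both f' and [fracG a f]. *)
Lemma integ_kp p K M h (x : R) : -1 < p -> 0 <= K -> 0 < M -> measurable_fun setT h ->
  (forall y, `|h y| <= K) -> (forall y, y < - M -> h y = 0) ->
  integ (fun s : R => kp p s * h (x - s)).
Proof.
move=> p1 K0 M0 mh hK hM.
apply: (@integ_le R (kbd p K (`|x| + M))).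
- by apply: measurable_funM; [exact: measurable_kp | exact: measurable_refl].
- by apply: kbd_integ => //; rewrite ltr_wpDl.
- by move=> s; apply: (@kp_bd _ _ M) => //; rewrite lerD2r ler_norm.
Qed.

Lemma cont_kp p K M h : -1 < p -> 0 <= K -> 0 < M -> continuous h ->
  (forall y, `|h y| <= K) -> (forall y, y < - M -> h y = 0) ->
  continuous (fun x => Ig (fun s : R => kp p s * h (x - s))).
Proof.
move=> p1 K0 M0 ch hK hM x.
have mh := continuous_measurable_fun ch.
have xi : x \in `](x - 1), (x + 1)[%classic.
  by rewrite inE/= in_itv/=; apply/andP; split; lra.
pose S := `|x| + 1 + M.
apply: (@continuity_under_integral R _ _ mu (fun x s => kp p s * h (x - s)) setT measurableT
  (x - 1) (x + 1) _ _ (kbd p K S)) xi.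
- by move=> y _; exact: (integ_kp _ p1 K0 M0).
- apply: aeW => s _ y _; apply: cvgM; first exact: cvg_cst.
  apply: (@cvg_comp _ _ _ (fun y => y - s) h); last exact: ch.
  by apply: cvgB; [exact: cvg_id | exact: cvg_cst].
- by apply: kbd_integ => //; rewrite /S ltr_wpDl// addr_ge0.
- move=> y; rewrite /= in_itv/= => /andP[_ yx]; apply: aeW => s _.
  apply: (@kp_bd _ _ M) => //; rewrite /S lerD2r.
  by apply: le_trans (ltW yx) _; rewrite lerD2r ler_norm.
Qed.

(** The shift sits in [f] and not in the singular kernel, so differentiation under the integral
    touches only [f]; [kbd] dominates the derivative uniformly for |y - x| < 1. *)
Lemma deriv_kp p f : -1 < p -> C1c f ->
  forall x : R, is_derive x 1 (fun x : R => Ig (fun s : R => kp p s * f (x - s)))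
    (Ig (fun s : R => kp p s * (derive1 f) (x - s))).
Proof.
move=> p1 cf x; have fc := C1c_cont cf.
have [K [M [K0 M0 fK fM]]] := C1c_bounds cf.
have [df cdf _] := cf.
have mf := continuous_measurable_fun fc.
have xi : `](x - 1), (x + 1)[%classic x.
  by rewrite /= in_itv/=; apply/andP; split; lra.
have fM1 y : y < - M -> f y = 0.
  by move=> yM; have [] := fM y; first by rewrite ltr_normr; apply/orP; right; lra.
have fM2 y : y < - M -> (derive1 f) y = 0.
  by move=> yM; have [] := fM y; first by rewrite ltr_normr; apply/orP; right; lra.
pose S := `|x| + 1 + M.
pose F (x s : R) := kp p s * f (x - s).
have D (y s : R) : is_derive y 1 (F ^~ s) (kp p s * (derive1 f) (y - s)).
  have D1 : is_derive y 1 (fun y => f (y - s)) ((derive1 f) (y - s)).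
    have D2 : is_derive (y - s) 1 f ((derive1 f) (y - s)).
      by rewrite derive1E; apply: derivableP.
    have D3 := is_derive_shift y 1 (- s).
    have := @is_derive1_comp R f (shift (- s)) y _ _ D2 D3.
    by rewrite mulr1.
  have := is_deriveZ (kp p s) D1.
  by [].
have P1 y s : partial1of2 F y s = kp p s * (derive1 f) (y - s).
  by rewrite partial1of2E; have [_ ->] := D y s.
have A1 y : `](x - 1), (x + 1)[%classic y -> integ (F y).
  by move=> _; apply: (integ_kp _ p1 K0 M0) => //; move=> z; have [] := fK z.
have A2 y s : `](x - 1), (x + 1)[%classic y -> setT s -> derivable (F ^~ s) y 1.
  by move=> _ _; have [] := D y s.
have A3 y s : `](x - 1), (x + 1)[%classic y -> setT s -> `|partial1of2 F y s| <= kbd p K S s.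
  rewrite /= in_itv/= => /andP[_ yx] _; rewrite P1.
  apply: (@kp_bd _ _ M) => //; first by move=> z; have [] := fK z.
  rewrite /S lerD2r.
  by apply: le_trans (ltW yx) _; rewrite lerD2r ler_norm.
have A4 : integ (kbd p K S) by apply: kbd_integ => //; rewrite /S ltr_wpDl// addr_ge0.
have A5 s : 0 <= kbd p K S s by exact: kbd_ge0.
apply: DeriveDef.
  exact: (@derivable_under_integral R _ _ mu F setT measurableT x (x - 1) (x + 1) xi A1 A2 _ A5 A4 A3).
rewrite -derive1E.
rewrite (@differentiation_under_integral R _ _ mu F setT measurableT x (x - 1) (x + 1) xi A1 A2 _ A5 A4 A3).
by apply: eq_Ig => s; exact: P1.
Qed.

End FracA.

(** * The Liouville-Weyl derivative in convolution form, and its decay *)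

Section FracB.
Variable R : realType.
Local Notation mu := (@lebesgue_measure R).
Implicit Types f g h : R -> R.

Lemma LWintE (b : R) f : 0 < b -> C1c f ->
  forall x : R, LWint b f x = Ig (fun s : R => kp (b - 1) s * f (x - s)) / Gamma b.
Proof.
move=> b0 cf x; have fc := C1c_cont cf.
have [K [M [K0 M0 fK fM]]] := C1c_bounds cf.
have mf := continuous_measurable_fun fc.
rewrite /LWint; congr (_ / _).
have fi : integ (fun s : R => kp (b - 1) s * f (x - s)).
  apply: (@integ_kp _ _ K M) => //; first by lra.
    by move=> y; have [] := fK y.
  by move=> y yM; have [] := fM y; first by rewrite ltr_normr; apply/orP; right; lra.
have [_ ->] := Ig_refl x fi.
rewrite Ig_itv; apply: eq_Ig => xi.
rewrite /kp in_itv/= subr_gt0; case: ifP => _; last by rewrite mul0r.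
by congr (_ * f _); lra.
Qed.

(** Gamma (1 - a) times the fractional derivative in Caputo form, that is with the derivative inside
    the integral; on [C1c] functions it agrees with the Liouville-Weyl form. *)
Definition fracG (a : R) f (x : R) := Ig (fun s : R => kp (- a) s * (derive1 f) (x - s)).

Lemma LWderE (a : R) f : a < 1 -> C1c f ->
  forall x : R, LWder a f x = fracG a f x / Gamma (1 - a).
Proof.
move=> a1 cf x; rewrite /LWder.
have -> : LWint (1 - a) f = fun x : R => Ig (fun s : R => kp (- a) s * f (x - s)) / Gamma (1 - a).
  apply/funext => y; rewrite LWintE; [|by rewrite subr_gt0|exact: cf].
  by rewrite (_ : 1 - a - 1 = - a) //; lra.
have D1 := @deriv_kp R (- a) f ltac:(lra) cf x.
have D2 := is_derive_cst ((Gamma (1 - a))^-1 : R) x 1.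
rewrite derive1E; have [_ ->] := is_deriveM D1 D2.
by rewrite scaler0 add0r /GRing.scale/= mulrC.
Qed.

Lemma fracG_cont a f : a < 1 -> C1c f -> continuous (fracG a f).
Proof.
move=> a1 cf.
have [K [M [K0 M0 fK fM]]] := C1c_bounds cf.
have [_ cdf _] := cf.
apply: (@cont_kp _ (- a) K M) => //; first by rewrite ltrN2.
  by move=> y; have [] := fK y.
by move=> y yM; have [] := fM y; first by rewrite ltr_normr; apply/orP; right; lra.
Qed.

(** Let f vanish outside [-M, M]. For x >= 2 M only s in [x - M, x + M] contributes, where s >= x /
    2 and the kernel is at most 2 x^(-a). On [-M, 2 M] continuity gives a bound, and left of -M the
    integral is zero. The decay x^(-a) is square integrable because a > 1/2. *)
Lemma fracG_bounds a f : 1 / 2 < a -> a < 1 -> C1c f -> exists C : R, exists M : R, [/\ 0 <= C, 0 < M,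
  forall x, x < - M -> fracG a f x = 0,
  forall x, `|fracG a f x| <= C &
  forall x, M <= x -> `|fracG a f x| <= C * x `^ (- a)].
Proof.
move=> a0 a1 cf.
have [K [M [K0 M0 fK fM]]] := C1c_bounds cf.
have [_ cdf _] := cf.
have mdf := continuous_measurable_fun cdf.
have Z (x : R) : x < - M -> fracG a f x = 0.
  move=> xM; rewrite /fracG (@eq_Ig _ _ (fun=> 0)) ?/Rintegral ?integral0 // => s.
  rewrite /kp; case: ifP => s0; last by rewrite mul0r.
  have [] := fM (x - s); last by move=> _ ->; rewrite mulr0.
  by rewrite ltr_normr; apply/orP; right; lra.
have B (x : R) : 2 * M <= x -> `|fracG a f x| <= (K * (2 * M) * 2) * x `^ (- a).
  move=> Mx.
  have x0 : 0 < x by apply: lt_le_trans Mx; lra.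
  pose c := K * (2 * x `^ (- a)).
  have c0 : 0 <= c by rewrite !mulr_ge0// powR_ge0.
  have le1 : x - M <= x + M by lra.
  have [bi bE] := Ig_box c le1.
  apply: le_trans (Ig_normle _ bi _) _.
  - by apply: measurable_funM; [exact: measurable_kp | exact: measurable_refl].
  - move=> s /=; have [s0|s0] := leP s 0.
      by rewrite kp_le0E// mul0r normr0; case: ifP.
    rewrite kp_gt0E// in_itv/=; case: ifPn => [/andP[s1 s2]|ns]; last first.
      have [] := fM (x - s); last by move=> _ ->; rewrite mulr0 normr0.
      move: ns; rewrite negb_and -!ltNge ltr_normr => /orP[|] ?; apply/orP; [left|right]; lra.
    rewrite normrM ger0_norm ?powR_ge0// mulrC /c ler_pM ?powR_ge0//.
      by have [] := fK (x - s).
    have h2 : x / 2 <= s by lra.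
    have : s `^ (- a) <= (x / 2) `^ (- a).
      rewrite !powRN lef_pV2 ?posrE ?powR_gt0 ?divr_gt0//.
      by apply: ge0_ler_powR; rewrite ?nnegrE ?divr_ge0 ?(ltW s0) ?(ltW x0)//; lra.
    move/le_trans; apply.
    rewrite powRM ?invr_ge0 ?(ltW x0)// mulrC ler_wpM2r ?powR_ge0//.
    rewrite -powR_inv1 // -powRrM mulN1r opprK.
    rewrite -[leRHS]powRr1 //; apply: ler_powR; [by rewrite ler1n | by lra].
  - by rewrite bE /c; lra.
have cG := fracG_cont a1 cf.
have [K2 K20 HK2] := continuous_bounded_seg (- M) (2 * M) cG.
pose C0 := (K * (2 * M) * 2).
have C00 : 0 <= C0 by rewrite !mulr_ge0// ltW.
have P1 : 0 <= (2 * M) `^ (- a) by exact: powR_ge0.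
exists (C0 + C0 * (2 * M) `^ (- a) + K2), (2 * M); split.
- by rewrite !addr_ge0// mulr_ge0.
- by lra.
- by move=> x xM; apply: Z; lra.
- move=> x; have [xM|Mx] := leP (2 * M) x.
    apply: le_trans (B x xM) _.
    rewrite -/C0; apply: (@le_trans _ _ (C0 * (2 * M) `^ (- a))); last by lra.
    rewrite ler_wpM2l // !powRN lef_pV2 ?posrE ?powR_gt0//; [|by lra|by lra].
    by apply: ge0_ler_powR; rewrite ?nnegrE; lra.
  have [xM2|Mx2] := ltP x (- M).
    by rewrite Z // normr0 !addr_ge0// mulr_ge0.
  apply: le_trans (HK2 x Mx2 (ltW Mx)) _.
  by rewrite lerDr addr_ge0// mulr_ge0.
- move=> x xM; apply: le_trans (B x xM) _; rewrite -/C0 ler_wpM2r ?powR_ge0//.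
  by rewrite -addrA lerDl addr_ge0// mulr_ge0.
Qed.

Lemma fracG_L2 a f : 1 / 2 < a -> a < 1 -> C1c f -> integ (fun x => fracG a f x ^+ 2).
Proof.
move=> a0 a1 cf.
have [C [M [C0 M0 Z B1 B2]]] := fracG_bounds a0 a1 cf.
have [i1 _] := @integ_pow_tail R (- a * 2) M ltac:(lra) M0.
have [i2 _] := @Ig_box R (- M) M (C ^+ 2) ltac:(lra).
have mG := continuous_measurable_fun (fracG_cont a1 cf).
have i3 := integD i2 (integZ (C ^+ 2) i1).
apply: integ_le i3 _.
  by rewrite (_ : (fun _ => _) = fracG a f \* fracG a f)//; exact: measurable_funM.
move=> x; rewrite ger0_norm ?sqr_ge0// !in_itv /= andbT.
have Csq : 0 <= C ^+ 2 by exact: sqr_ge0.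
have [Mx|xM] := leP M x.
  rewrite -[leLHS]add0r lerD//; first by case: ifP.
  rewrite -[leLHS]real_normK ?num_real// powRrM.
  rewrite (_ : 2 = 2%:R :> R) // powR_mulrn ?powR_ge0// -exprMn.
  rewrite ler_sqr ?nnegrE ?normr_ge0 ?mulr_ge0 ?powR_ge0//.
  exact: B2.
rewrite mulr0 addr0.
have [Mx2|xM2] := leP (- M) x => /=.
  rewrite (ltW xM) -[leLHS]real_normK ?num_real//.
  by rewrite ler_sqr ?nnegrE ?normr_ge0//.
by rewrite Z // expr0n.
Qed.

End FracB.

(** * Gamma and Beta values, and the fundamental theorem in convolution form *)

Section FracC.
Variable R : realType.
Local Notation mu := (@lebesgue_measure R).
Implicit Types f g h : R -> R.

Lemma expR_inv_bound (s : R) : 1 <= s -> expR (- s) <= 4 * s `^ (- 2).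
Proof.
move=> s1; have s0 : 0 < s by lra.
have h : s / 2 <= expR (s / 2).
  by apply: le_trans (expR_ge1Dx _); lra.
have h2 : (s / 2) ^+ 2 <= expR s.
  have -> : expR s = expR (s / 2) ^+ 2 by rewrite expr2 -expRD; congr expR; lra.
  by rewrite ler_sqr ?nnegrE ?expR_ge0// divr_ge0// (ltW s0).
rewrite expRN powRN (_ : (2 : R) = 2%:R) // powR_mulrn ?(ltW s0)//.
have -> : 4 * (s ^+ 2)^-1 = ((s / 2) ^+ 2)^-1.
  rewrite expr_div_n invf_div expr2; congr (_ / _); lra.
by rewrite lef_pV2 ?posrE ?expR_gt0// exprn_gt0// divr_gt0.
Qed.

(** Integrability comes first, since [Rintegral] returns 0 for an infinite integral. A box of height
    exp(-1) under the integrand on [1/2, 1] then gives positivity. *)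
Lemma Gamma_gt0 (b : R) : 0 < b -> b < 1 -> 0 < Gamma b.
Proof.
move=> b0 b1.
rewrite /Gamma Ig_itv.
pose F (x : R) := if x \in `]0, +oo[ then x `^ (b - 1) * expR (- x) else 0.
have mF : measurable_fun setT F.
  apply: measurable_itvif; apply: measurable_funM; first exact: measurable_powR.
  by apply: measurableT_comp => //; exact: measurable_expR.
have [i1 _] := @integ_pow_head R (b - 1) 1 ltac:(lra) ltr01.
have [i2 _] := @integ_pow_tail R (- 2) 1 ltac:(lra) ltr01.
have iF : integ F.
  apply: integ_le mF (integD i1 (integZ 4 i2)) _ => x.
  rewrite /F !in_itv/= !andbT; case: ltP => x0 /=; last first.
    by rewrite normr0 addr_ge0 // mulr_ge0//; case: ifP => // _; exact: powR_ge0.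
  rewrite ger0_norm ?mulr_ge0 ?powR_ge0 ?expR_ge0//.
  have [x1|x1] := leP x 1.
    rewrite -[leLHS]addr0 lerD//; last by rewrite mulr_ge0//; case: ifP => // _; exact: powR_ge0.
    by rewrite ler_piMr ?powR_ge0// -expR0 ler_expR; lra.
  rewrite (ltW x1) add0r; apply: le_trans (expR_inv_bound (ltW x1)).
  by rewrite ler_piMl ?expR_ge0// -[leRHS](powRr0 x) ler_powR//; lra.
pose c : R := expR (-1).
have [i3 e3] := @Ig_box R (1 / 2) 1 c ltac:(lra).
apply: (@lt_le_trans _ _ (c * (1 - 1 / 2))).
  by rewrite mulr_gt0 ?expR_gt0//; lra.
rewrite -e3; apply: Ig_le => // x.
rewrite -/(F x) /F !in_itv/= andbT; case: ifPn => [/andP[x1 x2]|_]; last first.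
  by case: ifP => // _; rewrite mulr_ge0 ?powR_ge0 ?expR_ge0.
have x0 : 0 < x by lra.
rewrite x0 -[leLHS]mul1r ler_pM ?expR_ge0//; last by rewrite ler_expR; lra.
rewrite -[leLHS](powRr0 x); apply: ger_powR; first by rewrite x0.
lra.
Qed.

(* The Beta value B(a, 1 - a); only its positivity matters. *)
Definition betaK (a : R) := Ig (fun r : R => kp (a - 1) r * kp (- a) (1 - r)).

(** Each factor is singular at one end only, so the integrand is split at 1/2: on either side the
    regular factor is at most 2. The lower bound is a box of height 1 on [1/4, 1/2]. *)
Lemma beta_integ (a : R) : 1 / 2 < a -> a < 1 ->
  integ (fun r : R => kp (a - 1) r * kp (- a) (1 - r)) /\ 0 < betaK a.
Proof.
move=> a0 a1.
have mB : measurable_fun setT (fun r : R => kp (a - 1) r * kp (- a) (1 - r)).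
  by apply: measurable_funM; [exact: measurable_kp | apply: measurable_refl; exact: measurable_kp].
have [i1 _] := @integ_pow_head R (a - 1) 1 ltac:(lra) ltr01.
have [i2 _] := @integ_pow_head R (- a) 1 ltac:(lra) ltr01.
have [i2' _] := Ig_refl 1 i2.
have B0 (p x : R) : 0 <= (if x \in `]0, 1] then x `^ p else 0) by case: ifP => // _; exact: powR_ge0.
have half (p : R) : -1 <= p -> p <= 0 -> forall y : R, 1 / 2 <= y -> y `^ p <= 2.
  move=> p1 p0 y y1; have y0 : 0 < y by lra.
  rewrite -[p]opprK powRN -[leRHS]invrK lef_pV2 ?posrE ?powR_gt0//.
  have [ly|ly] := leP y 1.
    apply: le_trans (_ : y <= _); first by rewrite -div1r.
    by rewrite -[leLHS](powRr1 (ltW y0)); apply: ger_powR; [rewrite y0 | lra].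
  apply: (@le_trans _ _ 1); first by rewrite invf_le1// ler1n.
  by rewrite -[leLHS](powRr0 y); apply: ler_powR; [exact: ltW | lra].
have i : integ (fun r : R => kp (a - 1) r * kp (- a) (1 - r)).
  apply: integ_le mB (integD (integZ 2 i1) (integZ 2 i2')) _ => x.
  rewrite ger0_norm ?mulr_ge0 ?kp_ge0//.
  have [x0|x0] := leP x 0; first by rewrite kp_le0E// mul0r addr_ge0 // mulr_ge0.
  have [x1|x1] := leP 1 x.
    by rewrite (@kp_le0E _ _ (1 - x)) ?subr_le0// mulr0 addr_ge0 // mulr_ge0.
  rewrite !kp_gt0E ?subr_gt0// !in_itv/= x0 (ltW x1) subr_gt0 x1 /=.
  have -> : 1 - x <= 1 by lra.
  have [xh|xh] := leP x (1 / 2).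
    rewrite -[leLHS]addr0 lerD ?mulr_ge0 ?powR_ge0// mulrC ler_wpM2r ?powR_ge0//.
    by apply: half; lra.
  rewrite -[leLHS]add0r lerD ?mulr_ge0 ?powR_ge0// ler_wpM2r ?powR_ge0//.
  by apply: half; lra.
split => //.
have [i3 e3] := @Ig_box R (1 / 4) (1 / 2) 1 ltac:(lra).
apply: (@lt_le_trans _ _ (1 * (1 / 2 - 1 / 4))); first by lra.
rewrite -e3; apply: Ig_le => // x.
rewrite in_itv/=; case: ifPn => [/andP[x1 x2]|_]; last by rewrite mulr_ge0 ?kp_ge0.
have H (p y : R) : 0 < y -> y <= 1 -> p <= 0 -> 1 <= y `^ p.
  by move=> y0 y1 p0; rewrite -[leLHS](powRr0 y); apply: ger_powR; rewrite ?y0.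
rewrite !kp_gt0E; [|by lra|by lra].
by rewrite -[leLHS]mul1r ler_pM//; apply: H; lra.
Qed.

(** The exponents a - 1 and - a add up to -1, which cancels the Jacobian of the dilation by t: the
    two kernels convolve to a constant on t > 0. *)
Lemma beta_scale (a t : R) : 1 / 2 < a -> a < 1 -> 0 < t ->
  integ (fun r : R => kp (a - 1) r * kp (- a) (t - r)) /\
  Ig (fun r : R => kp (a - 1) r * kp (- a) (t - r)) = betaK a.
Proof.
move=> a0 a1 t0; have [i _] := beta_integ a0 a1.
have ti : 0 < t^-1 by rewrite invr_gt0.
have [i' e] := Ig_scale ti i.
have E : (fun r : R => kp (a - 1) r * kp (- a) (t - r)) =
  (fun r => t^-1 * (kp (a - 1) (t^-1 * r) * kp (- a) (1 - t^-1 * r))).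
  apply/funext => r.
  have -> : 1 - t^-1 * r = t^-1 * (t - r) by rewrite mulrBr mulVf ?gt_eqF.
  rewrite /kp !pmulr_rgt0 //.
  case: ifP => r0; last by rewrite !mul0r mulr0.
  case: ifP => tr; last by rewrite !mulr0.
  rewrite !powRM ?(ltW ti) ?(ltW r0) ?(ltW tr)//.
  move: (r `^ _) ((t - r) `^ _) => A B.
  transitivity ((t^-1 * (t^-1 `^ (a - 1) * t^-1 `^ (- a))) * (A * B)); last first.
    by move: (t^-1 `^ (a - 1)) (t^-1 `^ (- a)) => ? ?; ring.
  rewrite -powRD; last by rewrite (gt_eqF ti) implybT.
  have -> : a - 1 + - a = -1 by ring.
  by rewrite powR_inv1 ?(ltW ti)// mulfV ?mul1r// gt_eqF.
rewrite E; split; first exact: integZ.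
by rewrite IgZ // -e.
Qed.

Lemma C1c_FTC f : C1c f -> forall x : R,
  integ (fun t : R => if 0 < t then derive1 f (x - t) else 0) /\
  Ig (fun t : R => if 0 < t then derive1 f (x - t) else 0) = f x.
Proof.
move=> cf x; set F := fun t : R => _.
have FE t : F t = if 0 < t then derive1 f (x - t) else 0 by [].
clearbody F.
have fc := C1c_cont cf.
have [K [M [K0 M0 fK fM]]] := C1c_bounds cf.
have [df cdf _] := cf.
have [A Ax AM] : exists2 A, A < x & A < - M.
  exists (Num.min x (- M) - 1); rewrite ltrBlDr gt_min; apply/orP; [left|right]; lra.
have fA : f A = 0 by have [] := fM A; first by rewrite ltr_normr; apply/orP; right; rewrite ltrNr.
(* At t = 0 the two sides differ in general, as [A, x] contains x while [F] tests 0 < t; that point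
   is discarded below as a null set. *)
have E : forall t : R, t != 0 -> F t = (if x - t \in `[A, x] then derive1 f (x - t) else 0).
  move=> t t0; rewrite FE in_itv/= gerBl.
  have -> : (0 <= t) = (0 < t) by rewrite le_eqVlt eq_sym (negbTE t0).
  case: ifP => ht; last by rewrite andbF.
  rewrite andbT; case: leP => // xA.
  have xtM : M < `|x - t|.
    by rewrite ltr_normr; apply/orP; right; apply: (@lt_trans _ _ (- A)); rewrite ?ltrN2// ltrNr.
  by have [] := fM _ xtM.
have i0 : mu.-integrable `[A, x] (EFin \o derive1 f).
  apply: continuous_compact_integrable; first exact: segment_compact.
  exact: continuous_subspaceT.
have i1 := integ_itv (continuous_measurable_fun cdf) i0.
have e1 : Ig (fun y : R => if y \in `[A, x] then derive1 f y else 0) = f x.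
  rewrite -Ig_itv /Rintegral (@continuous_FTC2 R (derive1 f) f A x).
  - by rewrite fA sube0.
  - exact: Ax.
  - exact: continuous_subspaceT.
  - split; first by move=> y _; exact: df.
      by apply: cvg_at_right_filter; exact: fc.
    by apply: cvg_at_left_filter; exact: fc.
  - by [].
have [i2 e2] := Ig_refl x i1.
rewrite -e1 e2.
have mF : measurable_fun setT F.
  rewrite (_ : F = fun t => if t \in `]0, +oo[ then derive1 f (x - t) else 0).
    by apply: measurable_itvif; apply: measurable_refl; exact: continuous_measurable_fun.
  by apply/funext => t; rewrite FE in_itv/= andbT.
clear e1 e2; apply: (Ig_ae mF i2).
exists [set 0]; split; [exact: measurable_set1 | exact: lebesgue_measure_set1 |].
by move=> t /= nt; apply: contrapT => t0; apply: nt; apply: E; apply/eqP.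
Qed.

End FracC.

(** * Reproducing formula, Hoelder bound and sup bound *)

Section FracD.
Variable R : realType.
Local Notation mu := (@lebesgue_measure R).
Implicit Types f g h : R -> R.

(* I^a D^a f = f: by Fubini the two kernels combine into the constant of beta_scale, which leaves the integral of f'. *)
Lemma frac_repro (a : R) f : 1 / 2 < a -> a < 1 -> C1c f -> forall x : R,
  Ig (fun r : R => kp (a - 1) r * fracG a f (x - r)) = betaK a * f x.
Proof.
move=> a0 a1 cf x; have [_ cdf _] := cf.
have mdf := continuous_measurable_fun cdf.
have [K [M [K0 M0 fK fM]]] := C1c_bounds cf.
pose F (z : measurableTypeR R * measurableTypeR R) : R :=
  kp (a - 1) z.1 * (kp (- a) (z.2 - z.1) * derive1 f (x - z.2)).
have mF : measurable_fun setT F.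
  apply: measurable_funM.
    by apply: (measurableT_comp (@measurable_kp R (a - 1))); exact: measurable_fst.
  apply: measurable_funM.
    apply: (measurableT_comp (@measurable_kp R (- a))).
    by apply: measurable_funB; [exact: measurable_snd | exact: measurable_fst].
  by apply: (measurableT_comp (measurable_refl x mdf)); exact: measurable_snd.
have [FT1 FT2] := C1c_FTC cf x.
have K1 (t : R) : integ (fun r : R => F (r, t)) /\
   Ig (fun r : R => F (r, t)) = betaK a * (if 0 < t then derive1 f (x - t) else 0).
  have E : (fun r : R => F (r, t)) = (fun r => derive1 f (x - t) * (kp (a - 1) r * kp (- a) (t - r))).
    by apply/funext => r; rewrite /F /=; ring.
  case: ltP => t0.
    have [i1 e1] := beta_scale a0 a1 t0.
    by rewrite E; split; [exact: integZ | rewrite (IgZ _ i1) e1 mulrC].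
  have -> : (fun r : R => F (r, t)) = (fun=> 0).
    apply/funext => r; rewrite /F /=; have [r0|r0] := leP r 0.
      by rewrite kp_le0E // mul0r.
    by rewrite (@kp_le0E _ _ (t - r)) ?mul0r ?mulr0 //; lra.
  split; last by rewrite mulr0 /Rintegral integral0.
  exact: integrable0.
(* The kernels are nonnegative, so the absolute value falls on f' alone, and the same computation
   gives the absolute integrability that Fubini requires. *)
have K2 (t : R) : integ (fun r : R => `|F (r, t)|) /\
   Ig (fun r : R => `|F (r, t)|) = betaK a * `|if 0 < t then derive1 f (x - t) else 0|.
  have E : (fun r : R => `|F (r, t)|) = (fun r => `|derive1 f (x - t)| * (kp (a - 1) r * kp (- a) (t - r))).
    apply/funext => r; rewrite /F /= !normrM !(ger0_norm (kp_ge0 _ _)); ring.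
  have [i1 e1] := K1 t; split; first exact: integ_norm.
  move: e1; case: ltP => t0 e1.
    have [i2 e2] := beta_scale a0 a1 t0.
    by rewrite E (IgZ _ i2) e2 mulrC.
  have -> : (fun r : R => `|F (r, t)|) = (fun=> 0).
    apply/funext => r; rewrite /F /=; have [r0|r0] := leP r 0.
      by rewrite kp_le0E // mul0r normr0.
    by rewrite (@kp_le0E _ _ (t - r)) ?mul0r ?mulr0 ?normr0 //; lra.
  by rewrite normr0 mulr0 /Rintegral integral0.
have iF : (mu \x mu)%E.-integrable setT (EFin \o F).
  apply/(@integrable21ltyP _ _ _ _ R mu mu); first exact/measurable_EFinP.
  rewrite (_ : (\int[mu]_y _)%E = (\int[mu]_t (betaK a * `|if 0 < t then derive1 f (x - t) else 0|)%:E)%E); last first.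
    apply: eq_integral => t _; have [i2 <-] := K2 t.
    by rewrite -(integ_fin i2).
  have i3 := integZ (betaK a) (integ_norm FT1).
  by rewrite (integ_fin i3) ltry.
have H1 : (\int[mu]_t \int[mu]_r (F (r, t))%:E)%E = (betaK a * f x)%:E.
  transitivity ((\int[mu]_t (betaK a * (if 0 < t then derive1 f (x - t) else 0))%:E)%E).
    by apply: eq_integral => t _; have [i1 <-] := K1 t; rewrite -(integ_fin i1).
  by rewrite (integ_fin (integZ (betaK a) FT1)) (IgZ _ FT1) FT2.
apply: EFin_inj; apply: etrans (etrans (@Fubini _ _ _ _ R mu mu _ iF) H1).
clear H1 K1 K2 FT1 FT2.
have iG (y : R) : integ (fun s : R => kp (- a) s * (derive1 f) (y - s)).
  apply: (@integ_kp _ (- a) K M) => //; first by rewrite ltrN2.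
    by move=> z; have [] := fK z.
  by move=> z zM; have [] := fM z; first by rewrite ltr_normr; apply/orP; right; lra.
(* For fixed r the shift t = r + s turns the inner integral into fracG a f (x - r). *)
have E3 (r : R) : integ (fun t : R => F (r, t)) /\ Ig (fun t : R => F (r, t)) = kp (a - 1) r * fracG a f (x - r).
  have [i1 e1] := Ig_shift (- r) (iG (x - r)).
  have E : (fun t : R => F (r, t)) = (fun t => kp (a - 1) r * (kp (- a) (t - r) * derive1 f (x - r - (t - r)))).
    by apply/funext => t; rewrite /F /=; congr (_ * (_ * derive1 f _)); ring.
  by rewrite E; split; [exact: integZ | rewrite (IgZ _ i1) /fracG e1].
have iFF := @integrable_fubini_F _ _ _ _ R mu mu _ iF.
have E4 : (fun r : R => kp (a - 1) r * fracG a f (x - r)) = (fun r : R => Ig (fun t : R => F (r, t))).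
  by apply/funext => r; have [_ ->] := E3 r.
rewrite /Rintegral fineK.
  by apply: eq_integral => r _; have [i1 <-] := E3 r; rewrite -(integ_fin i1).
apply: integrable_fin_num => //.
rewrite (_ : (fun _ => _) = fubini_F mu (EFin \o F)) //.
apply/funext => r; rewrite /fubini_F; have [i1 <-] := E3 r.
by rewrite -(integ_fin i1).
Qed.

(** The case C = 0 is included because the lemma also has to serve forms that are only
    semidefinite. *)
Lemma quad_disc (A B C : R) : 0 <= C -> (forall t, 0 <= A - 2 * t * B + t ^+ 2 * C) ->
  B ^+ 2 <= A * C.
Proof.
move=> C0 H; move: C0; rewrite le_eqVlt => /predU1P[C0|C0].
  have A0 : 0 <= A by have := H 0; lra.
  suff -> : B = 0 by rewrite expr0n -C0 mulr0.
  apply/eqP/negPn/negP => B0.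
  (* For this t the expression, affine in t when C = 0, equals -1. *)
  have := H ((A + 1) / (2 * B)); rewrite -C0 mulr0 addr0.
  have -> : 2 * ((A + 1) / (2 * B)) * B = A + 1 by field.
  lra.
have := H (B / C).
have -> : A - 2 * (B / C) * B + (B / C) ^+ 2 * C = (A * C - B ^+ 2) / C.
  by field; rewrite gt_eqF.
by rewrite pmulr_lge0 ?invr_gt0// subr_ge0.
Qed.

Lemma measurable_sqr f : measurable_fun setT f -> measurable_fun setT (fun x => f x ^+ 2).
Proof.
by move=> mf; rewrite (_ : (fun _ => _) = f \* f)//; exact: measurable_funM.
Qed.

Lemma Ig_CS f g : measurable_fun setT f -> measurable_fun setT g ->
  integ (fun x => f x ^+ 2) -> integ (fun x => g x ^+ 2) ->
  integ (fun x => f x * g x) /\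
  Ig (fun x => f x * g x) ^+ 2 <= Ig (fun x => f x ^+ 2) * Ig (fun x => g x ^+ 2).
Proof.
move=> mf mg fi gi.
have mfg : measurable_fun setT (fun x => f x * g x) by exact: measurable_funM.
have fgi : integ (fun x => f x * g x).
  apply: integ_le mfg (integD fi gi) _ => x.
  rewrite normrM -[f x ^+ 2]real_normK ?num_real// -[g x ^+ 2]real_normK ?num_real//.
  have := sqr_ge0 (`|f x| - `|g x|); have := normr_ge0 (f x); have := normr_ge0 (g x); nra.
split => //; apply: quad_disc; first by apply: Ig_ge0 => x; exact: sqr_ge0.
move=> t.
have -> : Ig (fun x => f x ^+ 2) - 2 * t * Ig (fun x => f x * g x) + t ^+ 2 * Ig (fun x => g x ^+ 2)
  = Ig (fun x => (f x ^+ 2 - 2 * t * (f x * g x)) + t ^+ 2 * g x ^+ 2).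
  rewrite IgD ?IgB ?IgZ //; [exact: integZ | apply: integB => //; exact: integZ | exact: integZ].
apply: Ig_ge0 => x.
have -> : f x ^+ 2 - 2 * t * (f x * g x) + t ^+ 2 * g x ^+ 2 = (f x - t * g x) ^+ 2 by ring.
exact: sqr_ge0.
Qed.

(** The coefficient of h^(2a-1) in the integrals of the three terms of [kp_diff_bd]: s^(2a-2) over
    ]0, 2h] and over ]0, h], and h^2 s^(2a-4) over [h, +oo[. *)
Definition holderK (a : R) : R := (2 `^ (2 * a - 1) + 1) / (2 * a - 1) + 1 / (3 - 2 * a).

Lemma kp_sqr (p s : R) : kp p s ^+ 2 = kp (p * 2) s.
Proof.
rewrite /kp; case: ifP => s0; last by rewrite expr0n.
by rewrite powRrM powR_mulrn ?powR_ge0.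
Qed.

(** For s <= h the square of a difference of nonnegative numbers is at most the sum of their
    squares. For s > h the increment of the kernel is at most h s^(a-2). *)
Lemma kp_diff_bd (a h s : R) : 1 / 2 < a -> a < 1 -> 0 < h ->
  (kp (a - 1) (s + h) - kp (a - 1) s) ^+ 2 <= (if s + h \in `]0, 2 * h] then (s + h) `^ ((a - 1) * 2) else 0) +
   (if s \in `]0, h] then s `^ ((a - 1) * 2) else 0) +
   h ^+ 2 * (if s \in `[h, +oo[ then s `^ ((a - 1) * 2 - 2) else 0).
Proof.
move=> a0 a1 h0.
set D := kp (a - 1) (s + h) - kp (a - 1) s.
  have q1 x : 0 <= (if s + h \in `]0, 2 * h] then x `^ ((a - 1) * 2) else 0) by case: ifP => // _; exact: powR_ge0.
  have q2 x : 0 <= (if s \in `]0, h] then x `^ ((a - 1) * 2) else 0) by case: ifP => // _; exact: powR_ge0.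
  have q3 x : 0 <= h ^+ 2 * (if s \in `[h, +oo[ then x `^ ((a - 1) * 2 - 2) else 0).
    by rewrite mulr_ge0 ?sqr_ge0//; case: ifP => // _; exact: powR_ge0.
  have Dle : D ^+ 2 <= kp ((a - 1) * 2) (s + h) + kp ((a - 1) * 2) s.
    rewrite -!kp_sqr /D; have := kp_ge0 (a - 1) s; have := kp_ge0 (a - 1) (s + h); nra.
  have [sh|hs] := leP s h.
    apply: (le_trans Dle); rewrite -[leLHS]addr0 lerD// lerD//.
      rewrite /kp in_itv/=; case: ifP => // sh0.
      by have -> : s + h <= 2 * h by lra.
    by rewrite /kp in_itv/= sh andbT.
  have s0 : 0 < s by lra.
  rewrite -[leLHS]add0r lerD ?addr_ge0//.
  rewrite in_itv/= (ltW hs) /= /D !kp_gt0E; [|by lra|by lra].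
  have -> : h ^+ 2 * s `^ ((a - 1) * 2 - 2) = (h * s `^ (a - 2)) ^+ 2.
    rewrite exprMn; congr (_ * _).
    rewrite -powR_mulrn ?powR_ge0// -powRrM; congr (_ `^ _); lra.
  have M1 : (s + h) `^ (a - 1) <= s `^ (a - 1).
    rewrite -[a - 1]opprK !(powRN _ (- (a - 1))) lef_pV2 ?posrE ?powR_gt0//; [|by lra].
    by apply: ge0_ler_powR; rewrite ?nnegrE; lra.
  rewrite -ler_sqrt ?sqr_ge0// !sqrtr_sqr distrC ger0_norm ?subr_ge0//.
  rewrite ger0_norm ?mulr_ge0 ?powR_ge0 ?(ltW h0)//.
  (* Since a - 1 >= -1 and (s + h) / s >= 1, the power ((s + h) / s)^(a-1) is at least s / (s + h),
     which [M3] bounds below by 1 - h / s. *)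
  have M2 : s `^ (a - 1) * (s / (s + h)) <= (s + h) `^ (a - 1).
    have -> : (s + h) `^ (a - 1) = s `^ (a - 1) * ((s + h) / s) `^ (a - 1).
      rewrite -powRM ?divr_ge0 ?(ltW s0)//; last by lra.
      by congr (_ `^ _); rewrite mulrCA mulfV ?mulr1// gt_eqF.
    rewrite ler_wpM2l ?powR_ge0//.
    have -> : s / (s + h) = ((s + h) / s) `^ (-1).
      by rewrite powR_inv1 ?divr_ge0 ?(ltW s0) ?invf_div//; lra.
    by apply: ler_powR; [rewrite ler_pdivlMr; lra | lra].
  have M3 : s `^ (a - 1) * (s / (s + h)) >= s `^ (a - 1) - h * s `^ (a - 2).
    have -> : s `^ (a - 1) = s * s `^ (a - 2).
      rewrite (_ : a - 1 = 1 + (a - 2)) ?powRD ?(gt_eqF s0) ?implybT ?powRr1 ?(ltW s0)//; lra.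
    have P := powR_gt0 (a - 2) s0; set y := s `^ (a - 2) in P *.
    have sh0 : 0 < s + h by lra.
    have -> : s * y * (s / (s + h)) = s * y * s / (s + h) by rewrite mulrA.
    rewrite ler_pdivlMr//.
    have := mulr_gt0 P (mulr_gt0 h0 h0); nra.
  lra.
Qed.

Lemma kp_diff (a h : R) : 1 / 2 < a -> a < 1 -> 0 < h ->
  let D := fun s => kp (a - 1) (s + h) - kp (a - 1) s in
  [/\ measurable_fun setT D, integ (fun s => D s ^+ 2) &
      Ig (fun s => D s ^+ 2) <= holderK a * h `^ (2 * a - 1)].
Proof.
move=> a0 a1 h0 D.
have mk : measurable_fun setT (fun s : R => kp (a - 1) (s + h)).
  apply: (measurableT_comp (@measurable_kp R (a - 1))).
  by apply: measurable_funD => //; exact: measurable_cst.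
have mD : measurable_fun setT D by apply: measurable_funB => //; exact: measurable_kp.
have p1 : -1 < (a - 1) * 2 by lra.
have p2 : (a - 1) * 2 - 2 < -1 by lra.
have [i1 e1] := integ_pow_head p1 (ltac:(lra) : 0 < 2 * h).
have [i2 e2] := integ_pow_head p1 h0.
have [i3 e3] := integ_pow_tail p2 h0.
have [i1' e1'] := Ig_shift h i1.
have i4 := integD (integD i1' i2) (integZ (h ^+ 2) i3).
have bd s := kp_diff_bd s a0 a1 h0.
have iD : integ (fun s => D s ^+ 2).
  apply: integ_le (measurable_sqr mD) i4 _ => s.
  by rewrite ger0_norm; [exact: bd | exact: sqr_ge0].
split; [exact: mD | exact: iD |].
apply: le_trans (Ig_le iD i4 bd) _.
rewrite (IgD (integD i1' i2) (integZ _ i3)) (IgD i1' i2) (IgZ _ i3) -e1' e3.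
clear e1' e3 bd i4.
have E2 : (a - 1) * 2 + 1 = 2 * a - 1 by ring.
have E3 : (a - 1) * 2 - 2 + 1 = 2 * a - 3 by ring.
move: e1 e2; rewrite E2 E3 => e1 e2.
have h2 : h ^+ 2 * (h `^ (2 * a - 3)) = h `^ (2 * a - 1).
  rewrite -powR_mulrn ?(ltW h0)// -powRD; last by rewrite (gt_eqF h0) implybT.
  congr (_ `^ _); ring.
move: e1; rewrite (@powRM _ 2 h) ?(ltW h0)// => e1.
rewrite /holderK mulrA h2.
apply: le_trans (lerD (lerD e1 e2) (lexx _)) _.
clear e1 e2; have -> : - (2 * a - 3) = 3 - 2 * a by ring.
have n1 : 2 * a - 1 != 0 by rewrite gt_eqF//; lra.
have n2 : 3 - 2 * a != 0 by rewrite gt_eqF//; lra.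
rewrite le_eqVlt; apply/orP; left; apply/eqP; field.
by rewrite n1 n2.
Qed.

(** [frac_repro] divides by [betaK a], and replacing [fracG] by [LWder] costs a factor Gamma (1 -
    a); both enter squared. *)
Definition fracC (a : R) : R := holderK a * (Gamma (1 - a) / betaK a) ^+ 2.

Lemma holderK_ge0 (a : R) : 1 / 2 < a -> a < 1 -> 0 <= holderK a.
Proof.
move=> a0 a1; apply: addr_ge0.
  by apply: divr_ge0; [rewrite addr_ge0 ?powR_ge0 | lra].
by apply: divr_ge0 => //; lra.
Qed.

Lemma fracC_ge0 (a : R) : 1 / 2 < a -> a < 1 -> 0 <= fracC a.
Proof. by move=> a0 a1; rewrite /fracC mulr_ge0 ?sqr_ge0// holderK_ge0. Qed.

Lemma LWder_cont (a : R) f : 1 / 2 < a -> a < 1 -> C1c f -> continuous (LWder a f).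
Proof.
move=> a0 a1 cf.
rewrite (_ : LWder a f = fun x => fracG a f x / Gamma (1 - a)); last first.
  by apply/funext => x; rewrite LWderE.
move=> x; apply: cvgM; last exact: cvg_cst.
exact: fracG_cont.
Qed.

Lemma LWder_L2 (a : R) f : 1 / 2 < a -> a < 1 -> C1c f -> integ (fun x => LWder a f x ^+ 2).
Proof.
move=> a0 a1 cf.
rewrite (_ : (fun x => _) = fun x => (Gamma (1 - a))^-1 ^+ 2 * fracG a f x ^+ 2).
  by apply: integZ; exact: fracG_L2.
by apply/funext => x; rewrite LWderE // exprMn mulrC.
Qed.

Lemma fracG_sqr (a : R) f : 1 / 2 < a -> a < 1 -> C1c f -> forall x : R,
  fracG a f x ^+ 2 = Gamma (1 - a) ^+ 2 * LWder a f x ^+ 2.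
Proof.
move=> a0 a1 cf x; have g0 : 0 < Gamma (1 - a) by apply: Gamma_gt0; lra.
by rewrite (LWderE a1 cf) -exprMn mulrCA mulfV ?mulr1// gt_eqF.
Qed.

Lemma LWder_holder (a : R) f : 1 / 2 < a -> a < 1 -> C1c f -> forall x h : R, 0 < h ->
  (f (x + h) - f x) ^+ 2 <= fracC a * h `^ (2 * a - 1) * Ig (fun x => LWder a f x ^+ 2).
Proof.
move=> a0 a1 cf x h h0.
have [C [M [C0 M0 Z B1 _]]] := fracG_bounds a0 a1 cf.
have cG := fracG_cont a1 cf; have mG := continuous_measurable_fun cG.
have [mD iD eD] := kp_diff a0 a1 h0.
have [_ b0] := beta_integ a0 a1.
have g0 : 0 < Gamma (1 - a) by apply: Gamma_gt0; lra.
have iK (y : R) : integ (fun r : R => kp (a - 1) r * fracG a f (y - r)).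
  by apply: (@integ_kp _ (a - 1) C M) => //; lra.
(* Shifting the integral for x + h by h gives both integrals the common factor fracG a f (x - r), so
   that their difference involves only the increment of the kernel. *)
have [i1 e1] := Ig_shift h (iK (x + h)).
have E1 : (fun r : R => kp (a - 1) (r + h) * fracG a f (x + h - (r + h))) =
          (fun r : R => kp (a - 1) (r + h) * fracG a f (x - r)).
  by apply/funext => r; congr (_ * fracG _ _ _); ring.
have i1' := eq_ind _ (fun F : R -> R => integ F) i1 _ E1.
have e1' := etrans e1 (congr1 (fun F : R -> R => Ig F) E1).
have E : betaK a * (f (x + h) - f x) =
    Ig (fun r : R => (kp (a - 1) (r + h) - kp (a - 1) r) * fracG a f (x - r)).
  apply: etrans (mulrBr _ _ _) _.
  apply: etrans (congr2 (fun u v => u - v) (esym (frac_repro a0 a1 cf (x + h)))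
    (esym (frac_repro a0 a1 cf x))) _.
  apply: etrans (congr2 (fun u v => u - v) e1' erefl) _.
  apply: etrans (esym (IgB i1' (iK x))) _.
  by apply: eq_Ig => r; rewrite mulrBl.
clear e1 i1 e1' i1' E1 iK.
have [iG2 eG2] := Ig_refl x (fracG_L2 a0 a1 cf).
have [_ CS] := Ig_CS mD (measurable_refl x mG) iD iG2.
rewrite -E -eG2 in CS.
have EL : Ig (fun x => fracG a f x ^+ 2) = Gamma (1 - a) ^+ 2 * Ig (fun x => LWder a f x ^+ 2).
  apply: etrans _ (IgZ _ (LWder_L2 a0 a1 cf)).
  by apply: eq_Ig => y; exact: fracG_sqr.
have L0 : 0 <= Ig (fun x => LWder a f x ^+ 2) by apply: Ig_ge0 => y; exact: sqr_ge0.
rewrite EL in CS.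
have D0 : Ig (fun s => (kp (a - 1) (s + h) - kp (a - 1) s) ^+ 2) <= holderK a * h `^ (2 * a - 1) := eD.
move: CS L0 D0; move: (Ig (fun s : R => _ ^+ 2)) (Ig (fun x : R => LWder a f x ^+ 2)) => X N CS N0 D0.
rewrite /fracC; clear - b0 CS N0 D0.
have -> : holderK a * (Gamma (1 - a) / betaK a) ^+ 2 * h `^ (2 * a - 1) * N =
  (holderK a * h `^ (2 * a - 1) * (Gamma (1 - a) ^+ 2 * N)) / betaK a ^+ 2.
  by field; rewrite gt_eqF.
rewrite ler_pdivlMr ?exprn_gt0// mulrC -exprMn.
apply: le_trans CS _; apply: ler_wpM2r => //.
by rewrite mulr_ge0 ?sqr_ge0.
Qed.

(** The value at x is compared with the values at y in [x, x + 1] and integrated over y: there (y -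
    x)^(2a-1) <= 1, so the Hoelder bound controls f y - f x. *)
Lemma C1c_sup_bound (a : R) f : 1 / 2 < a -> a < 1 -> C1c f -> forall x : R,
  f x ^+ 2 <= 2 * Ig (fun x => f x ^+ 2) + 2 * fracC a * Ig (fun x => LWder a f x ^+ 2).
Proof.
move=> a0 a1 cf x; have fc := C1c_cont cf.
have mf := continuous_measurable_fun fc.
have [K [M [K0 M0 fK fM]]] := C1c_bounds cf.
have if2 : integ (fun x => f x ^+ 2).
  have [ib _] := @Ig_box R (- M) M (K ^+ 2) ltac:(lra).
  apply: integ_le (measurable_sqr mf) ib _ => y; rewrite in_itv/= -ler_norml.
  have [h|h] := leP `|y| M; last by have [-> _] := fM _ h; rewrite expr0n normr0.
  rewrite ger0_norm ?sqr_ge0// -real_normK ?num_real// ler_sqr ?nnegrE//.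
  by have [] := fK y.
set N := Ig (fun x => LWder a f x ^+ 2).
have N0 : 0 <= N by apply: Ig_ge0 => y; exact: sqr_ge0.
have F0 := fracC_ge0 a0 a1.
have x1 : x <= x + 1 by lra.
have HH y : x < y -> (f y - f x) ^+ 2 <= fracC a * (y - x) `^ (2 * a - 1) * N.
  move=> xy; have := LWder_holder a0 a1 cf x (ltac:(rewrite subr_gt0; exact: xy) : 0 < y - x).
  by rewrite [x + _]addrC subrK.
clearbody N.
have bd y : (if y \in `[x, x + 1] then f x ^+ 2 else 0) <=
    2 * f y ^+ 2 + (if y \in `[x, x + 1] then 2 * fracC a * N else 0).
  rewrite in_itv/=; case: ifPn => [/andP[xy yx]|_]; last by rewrite addr0 mulr_ge0 ?sqr_ge0.
  move: xy; rewrite le_eqVlt => /predU1P[<-|xy].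
    have := sqr_ge0 (f x); have := mulr_ge0 F0 N0; lra.
  have hh : (y - x) `^ (2 * a - 1) <= 1.
    have yx0 : 0 < y - x by lra.
    rewrite -[leRHS](powRr0 (y - x)); apply: ger_powR; last by lra.
    by rewrite yx0; lra.
  have H2 : (f y - f x) ^+ 2 <= fracC a * N.
    apply: le_trans (HH y xy) _; rewrite mulrAC -[leRHS]mulr1.
    by apply: ler_wpM2l => //; exact: mulr_ge0.
  (* f(x)^2 = 2 f(y)^2 + 2 (f(y) - f(x))^2 - (2 f(y) - f(x))^2. *)
  have := sqr_ge0 (2 * f y - f x); nra.
have [i1 e1] := Ig_box (f x ^+ 2) x1.
have [i2 e2] := Ig_box (2 * fracC a * N) x1.
have e3 : x + 1 - x = 1 by ring.
have := Ig_le i1 (integD (integZ 2 if2) i2) bd.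
by rewrite (IgD (integZ 2 if2) i2) (IgZ _ if2) e1 e2 e3 !mulr1.
Qed.

End FracD.

(** * A smooth bump function *)

Section Bump.
Variable R : realType.

(* Up to polynomial factors this family is closed under differentiation, including at y = 0. *)
Definition flatE (m : nat) (y : R) : R := if 0 < y then y ^- m * expR (- y^-1) else 0.

Lemma flatE_ge0 m y : 0 <= flatE m y.
Proof.
rewrite /flatE; case: ifP => // y0.
by rewrite mulr_ge0 ?expR_ge0// invr_ge0 exprn_ge0// ltW.
Qed.

Lemma flatE_S m y : flatE m y = y * flatE m.+1 y.
Proof.
rewrite /flatE; case: ifP => y0; last by rewrite mulr0.
by rewrite mulrA exprS invfM mulrA mulfV ?mul1r// gt_eqF.
Qed.

(** With N = m + 2, exp(1/y) is the N-th power of exp(1/(N y)) >= 1/(N y). This absorbs y^(-m) and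
    leaves a factor y^2, which makes the derivative at 0 exist and vanish. *)
Lemma flatE_bound m : exists2 C : R, 0 <= C & forall y, flatE m y <= C * y ^+ 2.
Proof.
pose N : R := m.+2%:R.
have N0 : 0 < N by rewrite ltr0n.
exists (N ^+ m.+2); first by rewrite exprn_ge0// ltW.
move=> y; rewrite /flatE; case: ifP => y0; last by rewrite mulr_ge0 ?sqr_ge0// exprn_ge0// ltW.
have h : expR (- y^-1) <= (N * y) ^+ m.+2.
  rewrite expRN -[leRHS]invrK lef_pV2 ?posrE ?expR_gt0 ?invr_gt0 ?exprn_gt0 ?mulr_gt0//.
  have -> : expR y^-1 = expR ((N * y)^-1) ^+ m.+2.
    rewrite -expRM_natl; congr expR; rewrite invfM mulrA mulfV ?mul1r//.
  rewrite -exprVn ler_pXn2r ?nnegrE ?expR_ge0 ?invr_ge0 ?mulr_ge0 ?(ltW y0) ?(ltW N0)//.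
  by apply: le_trans (expR_ge1Dx _); rewrite lerDr.
apply: le_trans (ler_wpM2l _ h) _; first by rewrite invr_ge0 exprn_ge0// ltW.
rewrite exprMn mulrCA -[in leLHS](addn2 m) [y ^+ (m + 2)]exprD [y ^- m * _]mulrA mulVf ?mul1r ?addn2//.
by rewrite expf_neq0// gt_eqF.
Qed.

Lemma is_derive_flatE m (y : R) :
  is_derive y 1 (flatE m) (- m%:R * flatE m.+1 y + flatE m.+2 y).
Proof.
have [y0|y0|y0] := ltgtP y 0.
- have -> : - m%:R * flatE m.+1 y + flatE m.+2 y = 0.
    by rewrite /flatE ltNge (ltW y0) /= mulr0 addr0.
  apply: near_eq_is_derive (is_derive_cst (0 : R) y (1 : R)).
  near=> z; rewrite /flatE ltNge /= ltW //; near: z; exact: lt_nbhsl.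
- have -> : - m%:R * flatE m.+1 y + flatE m.+2 y =
     y ^- m * (expR (- y^-1) * (y ^- 2)) + expR (- y^-1) * (- m%:R * y ^- m.+1).
    rewrite /flatE y0 -(addn2 m) exprD invfM; ring.
  have yn : y != 0 by rewrite gt_eqF.
  have D1 : is_derive y 1 (fun z : R => z^-1) (- (y ^- 2)).
    have := @is_deriveV R id y 1 1 yn (is_derive_id _ _).
    by rewrite /GRing.scale /= mulr1.
  have D2 : is_derive y 1 (fun z : R => - z^-1) (y ^- 2).
    by have := is_deriveN D1; rewrite opprK.
  have D3 := @is_derive1_comp R expR (fun z : R => - z^-1) y _ _ (is_derive_expR _) D2.
  have D4 : is_derive y 1 (fun z : R => z ^- m) (- m%:R * y ^- m.+1).
    rewrite (_ : (fun z : R => z ^- m) = (fun z : R => z^-1) ^+ m); last first.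
      by apply/funext => z; rewrite exprfctE exprVn.
    apply: (is_derive_eq (is_deriveX m D1)); rewrite /GRing.scale /=.
    case: m => [|k] /=; first by rewrite oppr0 !mul0r.
    rewrite -!exprVn !exprS; move: (y^-1) (y^-1 ^+ k) => z w; ring.
  apply: near_eq_is_derive (is_deriveM D4 D3).
  by near=> z; rewrite /flatE; have -> // : 0 < z by near: z; exact: lt_nbhsr.
- subst y; have -> : - m%:R * flatE m.+1 0 + flatE m.+2 0 = 0.
    by rewrite /flatE ltxx mulr0 addr0.
  have [C C0 HC] := flatE_bound m.
  have E0 : flatE m 0 = 0 by rewrite /flatE ltxx.
  have L : h^-1 *: (flatE m (h *: (1 : R) + 0) - flatE m 0) @[h --> 0^'] --> (0 : R).
    apply/cvgrPdist_le => e e0; near=> h.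
    rewrite sub0r normrN E0 subr0 addr0 /GRing.scale /= mulr1 normrM normfV (ger0_norm (flatE_ge0 _ _)).
    have h0 : h != 0 by near: h; exact: nbhs_dnbhs_neq.
    have hp : 0 < `|h| by rewrite normr_gt0.
    rewrite mulrC ler_pdivrMr//; apply: le_trans (HC h) _.
    rewrite -real_normK ?num_real// expr2 mulrA ler_wpM2r//.
    apply: (@le_trans _ _ (C * (e / (C + 1)))).
      by rewrite ler_wpM2l//; near: h; apply: dnbhs0_le; rewrite divr_gt0// ltr_wpDl.
    by rewrite mulrCA ler_piMr ?(ltW e0)// ler_pdivrMr ?mul1r ?lerDl ?ltr_wpDl.
  by apply: DeriveDef; [apply/cvg_ex; exists 0 | exact/cvg_lim].
Unshelve. all: by end_near. Qed.

Definition bumpF (q : {poly R}) m (x : R) := q.[x] * flatE m (1 - x ^+ 2).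

(** The chain rule at y = 1 - x^2, once [flatE m] and [flatE m.+1] are rewritten as y^2 and y times
    [flatE m.+2]. *)
Definition bumpQ (q : {poly R}) (m : nat) : {poly R} :=
  q^`() * (1 - 'X^2) ^+ 2 + (2 * m%:R) *: ('X * q * (1 - 'X^2)) - 2 *: ('X * q).

Lemma is_derive_bumpF q m (x : R) :
  is_derive x 1 (bumpF q m) (bumpF (bumpQ q m) m.+2 x).
Proof.
have D1 := is_derive_poly q x.
have D2 : is_derive x 1 (fun z : R => 1 - z ^+ 2) (- (2 * x)).
  have Dx := is_deriveX 2 (is_derive_id x (1 : R)).
  by apply: (is_derive_eq (is_deriveB (is_derive_cst (1 : R) x 1) Dx)); rewrite sub0r /GRing.scale /= expr1 mulr1.
have D3 := @is_derive1_comp R (flatE m) (fun z : R => 1 - z ^+ 2) x _ _ (is_derive_flatE m _) D2.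
apply: (is_derive_eq (is_deriveM D1 D3)).
rewrite /bumpF /bumpQ /GRing.scale /= !(hornerD, hornerN, hornerZ, hornerM, hornerX, hornerXn, hornerC, horner_exp).
rewrite (flatE_S m) (flatE_S m.+1).
move: (flatE _ _) (q^`().[x]) (q.[x]) => u v w; ring.
Qed.

Lemma derive1n_bumpF q m k : exists q', exists m', derive1n k (bumpF q m) = bumpF q' m'.
Proof.
elim: k => [|k [q' [m' IH]]]; first by exists q, m.
exists (bumpQ q' m'), m'.+2; rewrite derive1nS IH; apply/funext => x.
by rewrite derive1E; have [_ ->] := is_derive_bumpF q' m' x.
Qed.

(** The standard bump exp(-1 / (1 - x^2)) on ]-1, 1[, extended by zero. *)
Definition bumpfun := bumpF 1 0.

Lemma bump_smooth k (x : R) : derivable (derive1n k bumpfun) x 1.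
Proof.
have [q' [m' ->]] := derive1n_bumpF 1 0 k.
by have [] := is_derive_bumpF q' m' x.
Qed.

Lemma bump_out (x : R) : 1 < `|x| -> bumpfun x = 0.
Proof.
move=> x1; rewrite /bumpfun /bumpF /flatE subr_gt0 ltNge.
by rewrite -real_normK ?num_real// exprn_ege1 ?(ltW x1)//= mulr0.
Qed.

Lemma bump_in (x : R) : `|x| < 1 -> 0 < bumpfun x.
Proof.
move=> x1; rewrite /bumpfun /bumpF /flatE hornerC mul1r.
by rewrite subr_gt0 -real_normK ?num_real// exprn_ilt1//= expr0 invr1 mul1r expR_gt0.
Qed.

End Bump.

(** * A mountain pass theorem in pre-Hilbert spaces *)

Section PreHilbert.
Variables (R : realType) (V : lmodType R) (S : set V) (ip : V -> V -> R).

(* The form is only semidefinite, since functions are not identified modulo null sets, and S need not be complete. *)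
Record prehilbert : Prop := PreHilbert {
  ph0 : S 0;
  phD : forall x y, S x -> S y -> S (x + y);
  phZ : forall c x, S x -> S (c *: x);
  ipC : forall x y, S x -> S y -> ip x y = ip y x;
  ipDl : forall x y z, S x -> S y -> S z -> ip (x + y) z = ip x z + ip y z;
  ipZl : forall c x y, S x -> S y -> ip (c *: x) y = c * ip x y;
  ip_ge0 : forall x, S x -> 0 <= ip x x }.

Definition nrm x := Num.sqrt (ip x x).

Hypothesis H : prehilbert.

Lemma phN x : S x -> S (- x).
Proof. by move=> Sx; rewrite -scaleN1r; exact: (phZ H). Qed.

Lemma phB x y : S x -> S y -> S (x - y).
Proof. by move=> Sx Sy; apply: (phD H) => //; exact: phN. Qed.

Lemma nrm_ge0 x : 0 <= nrm x. Proof. exact: sqrtr_ge0. Qed.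

Lemma nrm_sqr x : S x -> nrm x ^+ 2 = ip x x.
Proof. by move=> Sx; rewrite sqr_sqrtr // (ip_ge0 H). Qed.

Lemma ipDr x y z : S x -> S y -> S z -> ip z (x + y) = ip z x + ip z y.
Proof.
move=> Sx Sy Sz; rewrite (ipC H) ?(ipDl H) ?(ipC H Sx Sz) ?(ipC H Sy Sz) //.
exact: (phD H).
Qed.

Lemma ipZr c x y : S x -> S y -> ip y (c *: x) = c * ip y x.
Proof.
by move=> Sx Sy; rewrite (ipC H) ?(ipZl H) ?(ipC H Sx Sy)//; exact: (phZ H).
Qed.

Lemma ip_sqrD c x y : S x -> S y ->
  ip (x + c *: y) (x + c *: y) = ip x x + 2 * c * ip x y + c ^+ 2 * ip y y.
Proof.
move=> Sx Sy; have Sc : S (c *: y) by exact: (phZ H).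
have Sxy : S (x + c *: y) by exact: (phD H).
rewrite (ipDl H) // !ipDr // !(ipZl H) // !ipZr // (ipC H Sy Sx); ring.
Qed.

Lemma ip_CS x y : S x -> S y -> `|ip x y| <= nrm x * nrm y.
Proof.
move=> Sx Sy.
rewrite -sqrtr_sqr -sqrtrM ?(ip_ge0 H)//.
rewrite ler_sqrt ?mulr_ge0 ?(ip_ge0 H)//.
apply: quad_disc; first exact: (ip_ge0 H).
move=> t; have := ip_ge0 H (phD H Sx (phZ H (- t) Sy)).
rewrite ip_sqrD //; lra.
Qed.

Lemma nrmZ c x : S x -> nrm (c *: x) = `|c| * nrm x.
Proof.
move=> Sx; rewrite /nrm (ipZl H) ?ipZr //; last exact: (phZ H).
by rewrite mulrA -expr2 sqrtrM ?sqr_ge0// sqrtr_sqr.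
Qed.

Lemma nrmN x : S x -> nrm (- x) = nrm x.
Proof. by move=> Sx; rewrite -scaleN1r nrmZ// normrN normr1 mul1r. Qed.

Lemma nrm0 : nrm 0 = 0.
Proof. by have := nrmZ 0 (ph0 H); rewrite scale0r normr0 mul0r. Qed.

Lemma ip0l v : S v -> ip 0 v = 0.
Proof. by move=> Sv; have := ipZl H 0 (ph0 H) Sv; rewrite scale0r mul0r. Qed.

Lemma ipBl x y v : S x -> S y -> S v -> ip (x - y) v = ip x v - ip y v.
Proof.
move=> Sx Sy Sv; rewrite (ipDl H) //; last exact: phN.
by rewrite -scaleN1r (ipZl H) // mulN1r.
Qed.

Lemma nrmD x y : S x -> S y -> nrm (x + y) <= nrm x + nrm y.
Proof.
move=> Sx Sy; rewrite -ler_sqr ?nnegrE ?addr_ge0 ?nrm_ge0// nrm_sqr; last exact: (phD H).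
have := @ip_sqrD 1 x y Sx Sy; rewrite scale1r => ->.
rewrite -!nrm_sqr //; have := ip_CS Sx Sy; have := ler_norm (ip x y).
by move=> h1 h2; nra.
Qed.

Lemma nrmB x y : S x -> S y -> nrm (x - y) <= nrm x + nrm y.
Proof. by move=> Sx Sy; rewrite -(nrmN Sy); apply: nrmD => //; exact: phN. Qed.

Lemma ip_le_nrm x b : S x -> 0 <= b -> ip x x <= b * nrm x -> nrm x <= b.
Proof.
move=> Sx b0; rewrite -nrm_sqr // expr2.
have := nrm_ge0 x; rewrite le_eqVlt => /predU1P[<-//|n0].
by rewrite ler_pM2r.
Qed.

(* An almost minimiser of |w|^2/2 - l w almost represents l; no completeness is needed. *)
Lemma approx_riesz (l : V -> R) K :
  (forall x y, S x -> S y -> l (x + y) = l x + l y) ->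
  (forall c x, S x -> l (c *: x) = c * l x) ->
  (forall x, S x -> `|l x| <= K * nrm x) ->
  forall eta, 0 < eta -> exists2 w, S w & forall v, S v -> `|ip w v - l v| <= eta * nrm v.
Proof.
move=> lD lZ lK eta e0.
pose J v := ip v v - 2 * l v.
have Jlb v : S v -> - K ^+ 2 <= J v.
  move=> Sv; rewrite /J -nrm_sqr //; have := lK v Sv; have := ler_norm (l v).
  have := sqr_ge0 (nrm v - K); nra.
pose A := [set J v | v in S].
have Ainf : has_inf A.
  split; first by exists (J 0), 0 => //; exact: (ph0 H).
  by exists (- K ^+ 2) => _ [v Sv <-]; exact: Jlb.
have e2 : 0 < eta ^+ 2 by rewrite exprn_gt0.
have [_ [w Sw <-] Jw] := inf_adherent e2 Ainf.
exists w => // v Sv.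
have Jt t : inf A <= J (w + t *: v).
  apply: ge_inf; first by case: Ainf.
  by exists (w + t *: v) => //; apply: (phD H) => //; exact: (phZ H).
set b := ip w v - l v.
(* J (w + t v) - J w = 2 t b + t^2 (v, v) is at least - eta^2 for every t, because w is minimal up
   to eta^2; the discriminant then gives b^2 <= eta^2 |v|^2. *)
have Q t : 0 <= eta ^+ 2 - 2 * t * (- b) + t ^+ 2 * ip v v.
  have := Jt t; move: Jw; rewrite /J ip_sqrD // lD ?lZ //; last exact: (phZ H).
  by rewrite /b; lra.
have := quad_disc (ip_ge0 H Sv) Q.
rewrite sqrrN -nrm_sqr // -exprMn -[b ^+ 2]real_normK ?num_real//.
by rewrite ler_sqr ?nnegrE ?mulr_ge0 ?nrm_ge0// ltW.
Qed.

(** * Chains, their deformation, and almost critical points *)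

Section MountainPass.
Variables (I : V -> R) (dI : V -> V -> R) (rho a M Rr kap : R) (e : V).
Hypothesis dID : forall x v w, S x -> S v -> S w -> dI x (v + w) = dI x v + dI x w.
Hypothesis dIZ : forall x c v, S x -> S v -> dI x (c *: v) = c * dI x v.
Hypothesis dI0 : forall v, S v -> dI 0 v = 0.
Hypothesis dIb : forall r, exists2 K, 0 <= K & forall x v, S x -> S v -> nrm x <= r -> `|dI x v| <= K * nrm v.
Hypothesis Idiff : forall r eps, 0 < eps -> exists2 del, 0 < del &
  forall x v, S x -> S v -> nrm x <= r -> nrm v <= del -> I (x + v) - I x - dI x v <= eps * nrm v.
Hypothesis dIc : forall r eps, 0 < eps -> exists2 del, 0 < del &
  forall x y v, S x -> S y -> S v -> nrm x <= r -> nrm y <= r -> nrm (x - y) <= del ->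
    `|dI x v - dI y v| <= eps * nrm v.
Hypotheses (rho0 : 0 < rho) (a0 : 0 < a) (rhoR : 2 * rho <= Rr) (kap0 : 0 < kap).
Hypothesis Ia : forall x, S x -> rho <= nrm x -> nrm x <= 2 * rho -> a <= I x.
Hypothesis Iout : forall x, S x -> Rr <= nrm x -> nrm x <= Rr + 1 -> I x <= M -> dI x x <= - kap.
Hypotheses (Se : S e) (e0 : 0 < nrm e) (Ie : forall t, 0 <= t -> I (t *: e) <= M).

(* Points joined to 0 by a chain of step del inside {I <= b}; chains stop on leaving the ball of radius Rr. *)
Inductive reach (del b : R) : V -> Prop :=
| reach0 : I 0 <= b -> reach del b 0
| reachS x y : reach del b x -> nrm x < Rr -> S y -> nrm (y - x) <= del -> I y <= b -> reach del b y.

(** Replaces the paths from 0 that leave the ball of radius Rr below level b. Such a path yields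
    chains of every step size, so the property that matters is [exits del b] for all small [del]. *)
Definition exits del b := exists2 x, reach del b x & Rr <= nrm x.

Lemma reach_in del b x : 0 <= del -> reach del b x -> [/\ S x, I x <= b & nrm x <= Rr + del].
Proof.
have R0 := rhoR; have r0 := rho0.
move=> d0; elim => [I0|{}x y rx [Sx Ix nx] xR Sy yx Iy].
  by split => //; [exact: (ph0 H) | rewrite nrm0; lra].
split => //; rewrite -(subrKC x y) in Sy *; apply: le_trans (nrmD Sx _) _.
  by rewrite -[y - x](addKr x) addrC; apply: phB.
lra.
Qed.

(** A chain starts at 0, and steps of length at most rho cannot jump over the shell rho <= |x| <= 2
    rho, where the energy is at least a > b. This is why [Ia] concerns a shell and not a sphere. *)
Lemma no_exit del b : 0 <= del -> del <= rho -> b < a -> ~ exits del b.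
Proof.
have R0 := rhoR; have r0 := rho0.
move=> d0 dr ba [x rx]; suff : nrm x < rho by lra.
elim: rx => [_|{}x y rx nx xR Sy yx Iy]; first by rewrite nrm0.
have [Sx _ _] := reach_in d0 rx.
have ny : nrm y <= 2 * rho.
  rewrite -(subrKC x y); apply: le_trans (nrmD Sx _) _; first exact: phB.
  lra.
rewrite ltNge; apply/negP => ry.
by have := Ia Sy ry ny; lra.
Qed.

(** Multiples of [th] place points on the ray at distance exactly [del] from each other, all of
    energy at most M. *)
Lemma ray_exits del : 0 < del -> exits del M.
Proof.
move=> d0; pose th := del / nrm e.
have R0 := rhoR; have r0 := rho0.
have th0 : 0 < th by rewrite divr_gt0.
have nk (k : nat) : nrm ((k%:R * th) *: e) = k%:R * del.
  rewrite nrmZ // ger0_norm; last exact: (mulr_ge0 _ (ltW th0)).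
  by rewrite -mulrA /th divfK ?gt_eqF.
have K : forall i : nat, reach del M ((i%:R * th) *: e) \/ exits del M.
  elim=> [|i [IH|]]; [|have [iR|Ri] := ltP (nrm ((i%:R * th) *: e)) Rr|by right].
  - left; rewrite mul0r scale0r; apply: reach0.
    by have := Ie (lexx 0); rewrite scale0r.
  - left; apply: (reachS IH iR); first exact: (phZ H).
      rewrite -scalerBl -mulrBl -natrB // subSnn mul1r nrmZ // ger0_norm ?(ltW th0)//.
      by rewrite /th divfK ?gt_eqF.
    by apply: Ie; rewrite mulr_ge0 ?(ltW th0).
  - by right; exists ((i%:R * th) *: e).
have [N _ HN] : \forall k \near \oo, Rr / del <= k%:R by exact: nbhs_infty_ger.
case: (K N) => [rk|//]; apply: (ex_intro2 _ _ _ rk).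
by have := HN N (leqnn N); rewrite nk -ler_pdivrMr.
Qed.

Section step.
Variable eps : R.
Hypotheses (eps0 : 0 < eps) (eps1 : eps <= 1).
Hypothesis noPS : forall x, S x -> nrm x <= Rr + 1 -> a / 2 <= I x ->
  exists2 v, S v & eps * nrm v < `|dI x v|.

(* Move every point x of a chain to x - s w(x) with w(x) an almost gradient: the energy drops by tau, and steps stay
   small because dI, hence w up to a small error, is uniformly continuous on balls. *)
Lemma deform : exists2 tau, 0 < tau & forall del', 0 < del' -> del' <= 1 ->
  exists2 del, 0 < del & del <= 1 /\ forall b, a <= b -> b <= M -> exits del b -> exits del' (b - tau).
Proof.
have := eps0; have := eps1; have := a0; have := kap0; have := rhoR; have := rho0.
move=> r0 rR k0 a00 ee1 ee0.
have [K K0 HK] := dIb (Rr + 1).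
have [d1 d10 Hd1] := Idiff (Rr + 1) (ltac:(lra) : 0 < eps / 8).
(* As |w| <= K + 1, the displacement s w stays within d1, where [Hd1] applies; and s (K + 1) <= a
   keeps points of energy below a / 2 below 3 a / 4, hence below b - tau. *)
pose s := Num.min 1 (Num.min (d1 / (K + 1)) (a / (K + 1))).
have K1 : 0 < K + 1 by lra.
have s0 : 0 < s by rewrite !lt_min !divr_gt0// ltr01.
have sd : s * (K + 1) <= d1 by rewrite -ler_pdivlMr// !ge_min lexx !orbT.
have sa : s * (K + 1) <= a by rewrite -ler_pdivlMr// !ge_min lexx !orbT.
clearbody s.
(* a / 4 is the room left for points of energy below a / 2; s eps^2 / 8 is the drop guaranteed at
   all others. *)
pose tau := Num.min (a / 4) (s * eps ^+ 2 / 8).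
have tau1 : tau <= a / 4 by rewrite ge_min lexx.
have tau2 : tau <= s * eps ^+ 2 / 8 by rewrite ge_min lexx orbT.
have tau0 : 0 < tau by rewrite lt_min !divr_gt0 ?mulr_gt0 ?exprn_gt0.
clearbody tau.
exists tau => // del' d'0 d'1.
(* The four bounds serve in turn |w| <= K + 1, the energy drop, the sign of (w, x) at an exit point,
   and the step size of the moved chain. *)
pose eta := Num.min (Num.min 1 (eps / 8)) (Num.min (kap / (Rr + 1)) (del' / (8 * s))).
have R1 : 0 < Rr + 1 by lra.
have eta0 : 0 < eta by rewrite !lt_min ltr01 !divr_gt0 ?mulr_gt0.
have eta1 : eta <= 1 by rewrite !ge_min lexx.
have eta2 : eta <= eps / 8 by rewrite !ge_min lexx orbT.
have eta3 : eta * (Rr + 1) <= kap by rewrite -ler_pdivlMr// !ge_min lexx !orbT.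
have eta4 : s * eta <= del' / 8.
  have -> : del' / 8 = s * (del' / (8 * s)) by field; rewrite gt_eqF.
  by rewrite ler_wpM2l ?(ltW s0)// !ge_min lexx !orbT.
clearbody eta.
have [d2 d20 Hd2] := dIc (Rr + 1) (ltac:(rewrite divr_gt0 ?mulr_gt0//) : 0 < del' / (4 * s)).
(* A moved step has norm at most del + s (del' / (4 s) + 2 eta) <= 3 del' / 4. *)
pose del := Num.min (del' / 4) (Num.min 1 d2).
have del0 : 0 < del by rewrite !lt_min ltr01 d20 divr_gt0.
have del1 : del <= 1 by rewrite !ge_min lexx orbT.
have del2 : del <= d2 by rewrite !ge_min lexx !orbT.
have del3 : del <= del' / 4 by rewrite !ge_min lexx.
clearbody del.
exists del => //; split => // b ab bM.
(* w 0 = 0 makes the moved chain start at 0 again; it is an admissible choice since dI 0 = 0.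
   Outside the ball 0 is a dummy value. *)
have : forall x, exists w, [/\ S w, x = 0 -> w = 0 &
    S x -> nrm x <= Rr + 1 -> forall v, S v -> `|ip w v - dI x v| <= eta * nrm v].
  move=> x; have [->|x0] := eqVneq x 0.
    exists 0; split => //; first exact: (ph0 H).
    move=> _ _ v Sv; rewrite dI0 // ip0l //.
    by rewrite subrr normr0 mulr_ge0 ?nrm_ge0 ?ltW.
  have [[Sx nx]|nS] := pselect (S x /\ nrm x <= Rr + 1); last first.
    by exists 0; split => //; [exact: (ph0 H) | move=> Sx nx; case: nS].
  have [w Sw Hw] := approx_riesz (fun v w Sv Sw => dID Sx Sv Sw) (fun c v Sv => dIZ c Sx Sv)
    (fun v Sv => HK x v Sx Sv nx) eta0.
  by exists w; split => // x00; move: x0; rewrite x00 eqxx.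
move=> /choice [w Hw].
have wK x : S x -> nrm x <= Rr + 1 -> nrm (w x) <= K + 1.
  move=> Sx nx; have [Sw _ /(_ Sx nx (w x) Sw)] := Hw x.
  move=> h; apply: (ip_le_nrm Sw); first by lra.
  have h2 := HK x (w x) Sx Sw nx; have := nrm_ge0 (w x).
  move: h h2; rewrite !ler_norml => /andP[_ h] /andP[_ h2]; nra.
pose y x := x - s *: w x.
have Sy x : S x -> S (y x).
  by move=> Sx; have [Sw _ _] := Hw x; apply: phB => //; exact: (phZ H).
have dec x : S x -> nrm x <= Rr + 1 -> I x <= b -> I (y x) <= b - tau.
  move=> Sx nx Ix; have [Sw _ /(_ Sx nx (w x) Sw) h] := Hw x.
  have nw := wK x Sx nx; have nw0 := nrm_ge0 (w x).
  have Ssw : S (- (s *: w x)) by apply: phN; exact: (phZ H).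
  have nsw : nrm (- (s *: w x)) = s * nrm (w x).
    by rewrite nrmN ?nrmZ ?gtr0_norm//; exact: (phZ H).
  have := Hd1 x _ Sx Ssw nx; rewrite nsw => /(_ _).
  have -> : dI x (- (s *: w x)) = - s * dI x (w x) by rewrite -scaleNr dIZ.
  rewrite -/(y x) => /(_ (le_trans (ler_wpM2l (ltW s0) nw) sd)) h2.
  move: h; rewrite -nrm_sqr // ler_norml => /andP[_ h].
  move: h h2 nw nw0; set n := nrm (w x) => h h2 nw nw0.
  have h3 : dI x (w x) >= n ^+ 2 - eta * n by lra.
  have h4 : I (y x) <= I x + s * (n * (eta + eps / 8 - n)).
    have := ler_wpM2l (ltW s0) h3; lra.
  have [Ilow|Ihigh] := ltP (I x) (a / 2).
    have : s * (n * (eta + eps / 8 - n)) <= a / 4.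
      apply: (@le_trans _ _ (s * ((K + 1) * (eps / 4)))).
        rewrite ler_wpM2l ?(ltW s0)//.
        apply: (@le_trans _ _ (n * (eps / 4))); first by rewrite ler_wpM2l//; lra.
        by rewrite ler_wpM2r// divr_ge0// ltW.
      by rewrite mulrA; nra.
    lra.
  have [v Sv hv] := noPS Sx nx Ihigh.
  have [_ _ /(_ Sx nx v Sv) hv2] := Hw x.
  have nv0 : 0 < nrm v.
    rewrite lt_neqAle nrm_ge0 andbT; apply/eqP => v0.
    by move: hv (HK x v Sx Sv nx); rewrite -v0 !mulr0; lra.
  (* Since |dI x v| > eps |v| and w represents dI x up to eta, n >= eps - eta >= 7 eps / 8; then n
     (eta + eps / 8 - n) <= - eps^2 / 8. *)
  have n1 : eps - eta <= n.
    have := ip_CS Sw Sv; rewrite -/n => cs.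
    rewrite -(ler_pM2r nv0); have := ler_distD (ip (w x) v) (dI x v) 0.
    by rewrite !subr0 [`|dI x v - _|]distrC; lra.
  have : s * (n * (eta + eps / 8 - n)) <= - (s * eps ^+ 2 / 8).
    rewrite -mulrA -mulrN ler_wpM2l ?(ltW s0)//; nra.
  lra.
have nchain x z : S x -> S z -> nrm x <= Rr + 1 -> nrm z <= Rr + 1 -> nrm (z - x) <= del ->
    nrm (y z - y x) <= del'.
  move=> Sx Sz nx nz zx.
  have [Swx _ /(_ Sx nx) hx] := Hw x; have [Swz _ /(_ Sz nz) hz] := Hw z.
  have Sw := phB Swz Swx; have Szx := phB Sz Sx.
  have -> : y z - y x = (z - x) - s *: (w z - w x).
    rewrite /y scalerBr; move: (s *: w z) (s *: w x) => p q.
    by rewrite !opprB addrACA [in RHS]addrACA [- p - x]addrC.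
  apply: le_trans (nrmB Szx (phZ H s Sw)) _; rewrite nrmZ // gtr0_norm//.
  have nw : nrm (w z - w x) <= del' / (4 * s) + 2 * eta.
    apply: (ip_le_nrm Sw); first by rewrite addr_ge0 ?mulr_ge0 ?invr_ge0 ?mulr_ge0 ?ltW.
    rewrite [leLHS]ipBl //.
    move: (hx _ Sw) (hz _ Sw) (Hd2 z x _ Sz Sx Sw nz nx (le_trans zx del2)).
    by rewrite !ler_norml => /andP[? ?] /andP[? ?] /andP[? ?]; lra.
  have : s * nrm (w z - w x) <= del' / 4 + 2 * (s * eta).
    apply: le_trans (ler_wpM2l (ltW s0) nw) _; rewrite le_eqVlt; apply/orP; left; apply/eqP.
    by field; rewrite gt_eqF.
  lra.
have tr x : reach del b x -> exits del' (b - tau) \/ reach del' (b - tau) (y x).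
  elim => [I0|{}x z rx IH xR Sz zx Iz].
    right; have [_ w0 _] := Hw 0.
    have y0 : y 0 = 0 by rewrite /y w0 // scaler0 subrr.
    rewrite y0; apply: reach0; rewrite -y0; apply: dec => //; first exact: (ph0 H).
    by rewrite nrm0 ltW.
  case: IH => [|IH]; first by left.
  have [Sx Ix nx] := reach_in (ltW del0) rx.
  have nx1 : nrm x <= Rr + 1 by lra.
  have nz1 : nrm z <= Rr + 1.
    rewrite -(subrKC x z); apply: le_trans (nrmD Sx (phB Sz Sx)) _; lra.
  have [yR|Ry] := ltP (nrm (y x)) Rr; last by left; exists (y x).
  by right; apply: (reachS IH yR); [exact: Sy | exact: nchain | exact: dec].
(* The exit point is moved outwards: (w, x) <= dI x x + eta |x| <= - kap + kap = 0, so |x - s w|^2 =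
   |x|^2 - 2 s (w, x) + s^2 |w|^2 >= |x|^2. *)
move=> [x rx Rx]; have [//|ry] := tr x rx.
exists (y x) => //.
have [Sx Ix nx] := reach_in (ltW del0) rx.
have nx1 : nrm x <= Rr + 1 by lra.
have [Sw _ /(_ Sx nx1 x Sx) hw] := Hw x.
apply: (le_trans Rx); rewrite -ler_sqr ?nnegrE ?nrm_ge0// nrm_sqr // nrm_sqr; last exact: Sy.
rewrite /y -scaleNr ip_sqrD // (ipC H Sx Sw).
have o := Iout Sx Rx nx1 (le_trans Ix bM).
have w0 := ip_ge0 H Sw.
move: hw; rewrite ler_norml => /andP[_ hw].
have i0 : ip (w x) x <= 0.
  have : eta * nrm x <= kap by apply: le_trans eta3; rewrite ler_wpM2l ?(ltW eta0).
  lra.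
have : 0 <= s * - ip (w x) x by rewrite mulr_ge0 ?(ltW s0)// oppr_ge0.
have : 0 <= s ^+ 2 * ip (w x) (w x) by rewrite mulr_ge0 ?sqr_ge0.
rewrite sqrrN; lra.
Qed.

End step.

(** Without almost critical points the level M could be lowered by the fixed amount tau any number
    of times while chains of every step size still exit; below level a this contradicts
    [no_exit]. *)
Lemma mountain_pass_PS eps : 0 < eps -> exists x, [/\ S x, nrm x <= Rr + 1, a / 2 <= I x &
  forall v, S v -> `|dI x v| <= eps * nrm v].
Proof.
move=> ep0; apply: contrapT => nex.
have r0 := rho0; have aa0 := a0.
pose ep := Num.min 1 eps.
have [|||tau tau0 Htau] := @deform ep.
- by rewrite lt_min ltr01.
- by rewrite ge_min lexx.
- move=> x Sx nx Ix; apply: contrapT => nv; apply: nex; exists x; split => // v Sv.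
  rewrite leNgt; apply/negP => hv; apply: nv; exists v => //.
  by apply: le_lt_trans hv; rewrite ler_wpM2r ?nrm_ge0// ge_min lexx orbT.
(* All step sizes are carried through the induction, since [deform] obtains step del' from chains of
   another step del. *)
have K (k : nat) : forall del, 0 < del -> del <= 1 -> exits del (M - k%:R * tau).
  elim: k => [|k IH] del d0 d1; first by rewrite mul0r subr0; exact: ray_exits.
  have [lo|hi] := ltP (M - k%:R * tau) a.
    exfalso; apply: (@no_exit (Num.min 1 rho) (M - k%:R * tau)) => //.
    - by rewrite le_min ler01 ltW.
    - by rewrite ge_min lexx orbT.
    - by apply: IH; [rewrite lt_min ltr01 | rewrite ge_min lexx].
  have [del2 d20 [d21 Hd2]] := Htau del d0 d1.
  have -> : M - k.+1%:R * tau = M - k%:R * tau - tau by rewrite -natr1; ring.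
  apply: Hd2 => //; last exact: IH.
  by rewrite gerBl mulr_ge0// ltW.
have [N _ HN] : \forall k \near \oo, (M - a + 1) / tau <= k%:R by exact: nbhs_infty_ger.
have := HN N (leqnn N); rewrite ler_pdivrMr// => hN.
apply: (@no_exit (Num.min 1 rho) (M - N%:R * tau)).
- by rewrite le_min ler01 ltW.
- by rewrite ge_min lexx orbT.
- lra.
- by apply: K; [rewrite lt_min ltr01 | rewrite ge_min lexx].
Qed.

End MountainPass.
End PreHilbert.

(** * Finite-dimensional calculus and the nonlinearity *)

Section Dotv.
Variables (R : realType) (n : nat).
Implicit Types x y z : 'rV[R]_n.

Lemma dotvC x y : dotv x y = dotv y x.
Proof. by apply: eq_bigr => i _; rewrite mulrC. Qed.

Lemma dotvDl x y z : dotv (x + y) z = dotv x z + dotv y z.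
Proof. by rewrite -big_split; apply: eq_bigr => i _; rewrite mxE mulrDl. Qed.

Lemma dotvZl c x y : dotv (c *: x) y = c * dotv x y.
Proof. by rewrite /dotv big_distrr /=; apply: eq_bigr => i _; rewrite mxE mulrA. Qed.

Lemma dotvDr x y z : dotv z (x + y) = dotv z x + dotv z y.
Proof. by rewrite dotvC dotvDl !(dotvC z). Qed.

Lemma dotvZr c x y : dotv y (c *: x) = c * dotv y x.
Proof. by rewrite dotvC dotvZl dotvC. Qed.

Lemma dotvNl x y : dotv (- x) y = - dotv x y.
Proof. by rewrite -scaleN1r dotvZl mulN1r. Qed.

Lemma dotvBl x y z : dotv (x - y) z = dotv x z - dotv y z.
Proof. by rewrite dotvDl dotvNl. Qed.

Lemma dotv0l x : dotv 0 x = 0.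
Proof. by rewrite -(scale0r (0 : 'rV[R]_n)) dotvZl mul0r. Qed.

Lemma sqnorm_ge0 x : 0 <= sqnorm x.
Proof. by apply: sumr_ge0 => i _; rewrite -expr2 sqr_ge0. Qed.

Lemma sqnormE x : sqnorm x = \sum_(i < n) x ord0 i ^+ 2.
Proof. by apply: eq_bigr => i _; rewrite expr2. Qed.

Lemma coord_sqnorm x i : x ord0 i ^+ 2 <= sqnorm x.
Proof.
rewrite sqnormE (bigD1 i) //= lerDl sumr_ge0// => j _; exact: sqr_ge0.
Qed.

Lemma sqnorm_eq0 x : (sqnorm x == 0) = (x == 0).
Proof.
apply/eqP/eqP => [x0|->]; last by rewrite /sqnorm dotv0l.
apply/rowP => i; rewrite mxE; apply/eqP; rewrite -sqrf_eq0 eq_le sqr_ge0 andbT -x0.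
exact: coord_sqnorm.
Qed.

Lemma sqnormZ c x : sqnorm (c *: x) = c ^+ 2 * sqnorm x.
Proof. by rewrite /sqnorm dotvZl dotvZr mulrA. Qed.

Lemma sqnormN x : sqnorm (- x) = sqnorm x.
Proof. by rewrite -scaleN1r sqnormZ sqrrN expr1n mul1r. Qed.

Lemma enorm_ge0 x : 0 <= enorm x. Proof. exact: sqrtr_ge0. Qed.

Lemma enorm_sqr x : enorm x ^+ 2 = sqnorm x.
Proof. by rewrite sqr_sqrtr // sqnorm_ge0. Qed.

Lemma enormZ c x : enorm (c *: x) = `|c| * enorm x.
Proof. by rewrite /enorm sqnormZ sqrtrM ?sqr_ge0// sqrtr_sqr. Qed.

Lemma dotv_CS x y : `|dotv x y| <= enorm x * enorm y.
Proof.
rewrite -sqrtr_sqr -sqrtrM ?sqnorm_ge0// ler_sqrt ?mulr_ge0 ?sqnorm_ge0//.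
apply: quad_disc; first exact: sqnorm_ge0.
move=> t; have := sqnorm_ge0 (x - t *: y); rewrite /sqnorm -scaleNr !(dotvDl, dotvDr, dotvZl, dotvZr) (dotvC y x).
lra.
Qed.

Lemma sqnormD x y : sqnorm (x + y) <= 2 * sqnorm x + 2 * sqnorm y.
Proof.
rewrite !sqnormE !mulr_sumr -big_split /=; apply: ler_sum => i _; rewrite mxE.
have := sqr_ge0 (x ord0 i - y ord0 i); lra.
Qed.

Lemma sqnormB x y : sqnorm (x - y) <= 2 * sqnorm x + 2 * sqnorm y.
Proof. by rewrite -(sqnormN y); exact: sqnormD. Qed.

Lemma enormD x y : enorm (x + y) <= enorm x + enorm y.
Proof.
rewrite -ler_sqr ?nnegrE ?addr_ge0 ?enorm_ge0// enorm_sqr.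
rewrite /sqnorm dotvDl !dotvDr (dotvC y x) -!/(sqnorm _) -!enorm_sqr.
have := dotv_CS x y; have := ler_norm (dotv x y) => h1 h2; nra.
Qed.

Lemma enorm0_eq0 x : (enorm x == 0) = (x == 0).
Proof. by rewrite sqrtr_eq0 le_eqVlt ltNge sqnorm_ge0 orbF sqnorm_eq0. Qed.

Lemma enorm0 : enorm (0 : 'rV[R]_n) = 0.
Proof. by apply/eqP; rewrite enorm0_eq0. Qed.

Lemma norm_leP x c : 0 <= c -> (forall i, `|x ord0 i| <= c) -> `|x| <= c.
Proof.
move=> c0 H; rewrite /Num.norm /= mx_normrE; apply/bigmax_leP; split=> // [[i j] _ /=].
by rewrite (ord1 i).
Qed.

Lemma norm_le_enorm x : `|x| <= enorm x.
Proof.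
apply: norm_leP (enorm_ge0 x) _ => i.
by rewrite -sqrtr_sqr ler_sqrt ?sqnorm_ge0//; exact: coord_sqnorm.
Qed.

Lemma coord_le_norm x i : `|x ord0 i| <= `|x|.
Proof.
by rewrite [leRHS]/Num.norm /= mx_normrE; apply: (le_bigmax _ (fun p : 'I_1 * 'I_n => `|x p.1 p.2|) (ord0, i)).
Qed.

Lemma sqnorm_le_norm x : sqnorm x <= n%:R * `|x| ^+ 2.
Proof.
rewrite sqnormE; apply: (@le_trans _ _ (\sum_(i < n) `|x| ^+ 2)).
  apply: ler_sum => i _; rewrite -real_normK ?num_real// ler_sqr ?nnegrE//.
  exact: coord_le_norm.
by rewrite sumr_const card_ord mulr_natl.
Qed.

End Dotv.

(** * Functions with continuous partial derivatives *)

Section Grad.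
Variables (R : realType) (n : nat).
Implicit Types (G : 'rV[R]_n -> R) (x v : 'rV[R]_n).

(** [gradW W t] is convertible to [partials (W t)], so the calculus below transfers to W. *)
Definition partials G x : 'rV[R]_n := \row_i ('D_(delta_mx ord0 i) G x).

Lemma is_derive_line G x e (s : R) : derivable G (x + s *: e) e ->
  is_derive s 1 (fun s : R => G (x + s *: e)) ('D_e G (x + s *: e)).
Proof.
move=> dG.
have E : (fun h : R => h^-1 *: ((fun s : R => G (x + s *: e)) (h *: (1 : R) + s) - G (x + s *: e))) =
         (fun h : R => h^-1 *: (G (h *: e + (x + s *: e)) - G (x + s *: e))).
  apply/funext => h; congr (_ *: (G _ - _)).
  by rewrite /GRing.scale /= mulr1 -/(GRing.scale _ _) scalerDl addrCA.
apply: DeriveDef; first by rewrite /derivable E.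
by rewrite /derive E.
Qed.

Lemma MVT0 (f df : R -> R) (c : R) : (forall s : R, is_derive s 1 f (df s)) ->
  exists2 th : R, `|th| <= `|c| & f c - f 0 = df th * c.
Proof.
move=> D.
have cf : continuous f.
  by move=> s; apply: differentiable_continuous; apply/derivable1_diffP; have [] := D s.
have [c0|c0] := leP 0 c.
  have [th] := @MVT_segment R f df 0 c c0 (fun s _ => D s) (continuous_subspaceT cf).
  rewrite in_itv/= subr0 => /andP[t0 tc] ->; exists th => //.
  by rewrite !ger0_norm.
have [th] := @MVT_segment R f df c 0 (ltW c0) (fun s _ => D s) (continuous_subspaceT cf).
rewrite in_itv/= sub0r => /andP[ct t0] h; exists th.
  by rewrite !ler0_norm ?(ltW c0)// lerN2.
by rewrite -opprB h mulrN opprK.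
Qed.

Definition trunc k v : 'rV[R]_n := \row_i (if (i < k)%N then v ord0 i else 0).

Lemma truncS v (k : 'I_n) : trunc k.+1 v = trunc k v + v ord0 k *: delta_mx ord0 k.
Proof.
apply/rowP => i; rewrite !mxE eqxx /= ltnS leq_eqVlt.
have [->|ik] := eqVneq i k; first by rewrite eqxx /= ltnn add0r mulr1.
by rewrite -val_eqE in ik; rewrite (negbTE ik) /= mulr0 addr0.
Qed.

Lemma trunc0 v : trunc 0 v = 0.
Proof. by apply/rowP => i; rewrite !mxE. Qed.

Lemma truncn v : trunc n v = v.
Proof. by apply/rowP => i; rewrite !mxE ltn_ord. Qed.

Lemma trunc_norm k v : `|trunc k v| <= `|v|.
Proof.
apply: norm_leP => // i; rewrite mxE; case: ifP => _; last by rewrite normr0.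
exact: coord_le_norm.
Qed.

Lemma delta_norm (i : 'I_n) : `|delta_mx ord0 i : 'rV[R]_n| <= 1.
Proof.
by apply: (norm_leP ler01) => j; rewrite mxE; case: (_ && _); rewrite ?normr1 ?normr0 ?ler01.
Qed.

(* Telescoping along coordinates: each increment is a one-variable mean value. *)
Lemma increment_le G x v (del eps : R) :
  (forall z i, derivable G z (delta_mx ord0 i)) ->
  (forall z i, `|z - x| <= del -> `|partials G z ord0 i - partials G x ord0 i| <= eps) ->
  2 * `|v| <= del ->
  `|G (x + v) - G x - dotv (partials G x) v| <= eps * (n%:R * `|v|).
Proof.
move=> dG cG vd.
have step (k : 'I_n) : `|G (x + trunc k.+1 v) - G (x + trunc k v) - partials G x ord0 k * v ord0 k|
    <= eps * `|v|.
  pose e : 'rV[R]_n := delta_mx ord0 k.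
  pose z := x + trunc k v.
  have D (s : R) : is_derive s 1 (fun s : R => G (z + s *: e)) (partials G (z + s *: e) ord0 k).
    by rewrite mxE; apply: is_derive_line; exact: dG.
  have [th tv] := MVT0 (v ord0 k) D.
  rewrite scale0r addr0 /z -addrA -truncS => ->.
  rewrite -mulrBl normrM ler_pM//; last exact: coord_le_norm.
  (* The truncated vector and the last coordinate step are each at most |v|, whence the factor 2 in
     the hypothesis. *)
  apply: cG; rewrite /z -[x + _ + _]addrA [x + _]addrC addrK.
  apply: le_trans (ler_normD _ _) _; apply: le_trans vd.
  rewrite mulr_natl mulr2n lerD ?trunc_norm// normrZ.
  rewrite -[leRHS]mulr1 ler_pM ?delta_norm//.
  by apply: le_trans tv _; exact: coord_le_norm.
have tel k : (k <= n)%N -> G (x + trunc k v) - G x = \sum_(i < n | (i < k)%N) (G (x + trunc i.+1 v) - G (x + trunc i v)).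
  elim: k => [|k IH] kn; first by rewrite trunc0 addr0 subrr big_pred0.
  have kn' := ltnW kn; rewrite (bigD1 (Ordinal kn)) //= (eq_bigl (fun i : 'I_n => (i < k)%N)); last first.
    move=> i; rewrite ltnS -val_eqE /=.
    by rewrite [RHS]ltn_neqAle andbC.
  by rewrite -IH // addrA subrK.
have := tel n (leqnn n); rewrite truncn => ->.
rewrite (eq_bigl xpredT); last by move=> i; rewrite ltn_ord.
rewrite /dotv -sumrB; apply: le_trans (ler_norm_sum _ _ _) _.
apply: le_trans (ler_sum _ (fun k _ => step k)) _.
by rewrite sumr_const card_ord -[leLHS]mulr_natl mulrCA.
Qed.

(** [increment_le] along h v: near x the partials vary by at most e / N, with N >= n |v|, so the
    error is at most e |h|. *)
Lemma is_derive_dir G x v :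
  (forall z i, derivable G z (delta_mx ord0 i)) ->
  (forall i, continuous (fun z => partials G z ord0 i)) ->
  is_derive x v G (dotv (partials G x) v).
Proof.
move=> dG cG.
have L : h^-1 *: (G (h *: v + x) - G x) @[h --> 0^'] --> dotv (partials G x) v.
  apply/cvgrPdist_le => e e0.
  have [N [N0 N1 N2]] : exists N : R, [/\ 0 < N, `|v| <= N & n%:R * `|v| <= N].
    exists (n%:R * `|v| + `|v| + 1); have v0 := normr_ge0 v.
    have nv0 : 0 <= n%:R * `|v| by rewrite mulr_ge0.
    by split; lra.
  have : \forall z \near x, forall i, `|partials G z ord0 i - partials G x ord0 i| <= e / N.
    apply: (@filter_forall _ 'I_n (fun i z => `|partials G z ord0 i - partials G x ord0 i| <= e / N) (nbhs x) _) => i.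
    have /cvgrPdist_le /(_ _ (divr_gt0 e0 N0)) := cG i x.
    by apply: filterS => z; rewrite distrC.
  move=> /nbhs_ballP[del /= del0 Hdel].
  near=> h.
  have h0 : h != 0 by near: h; exact: nbhs_dnbhs_neq.
  have hp : 0 < `|h| by rewrite normr_gt0.
  have -> : dotv (partials G x) v - h^-1 *: (G (h *: v + x) - G x) =
     - (h^-1 * (G (x + h *: v) - G x - dotv (partials G x) (h *: v))).
    by rewrite dotvZr [x + _]addrC /GRing.scale /=; field.
  rewrite normrN normrM normfV ler_pdivrMl//.
  have hd : 2 * `|h *: v| <= del / 2.
    rewrite normrZ.
    have : `|h| <= del / (4 * N) by near: h; apply: dnbhs0_le; rewrite divr_gt0 ?mulr_gt0.
    rewrite ler_pdivlMr ?mulr_gt0// => hN.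
    have : `|h| * `|v| <= `|h| * N.
      by rewrite ler_wpM2l.
    lra.
  have := @increment_le G x (h *: v) (del / 2) (e / N) dG _ hd.
  move=> /(_ _) H; apply: le_trans (H _) _.
    move=> z i zd; apply: Hdel; rewrite -ball_normE /= distrC.
    by apply: le_lt_trans zd _; rewrite ltr_pdivrMr// ltr_pMr// ltr1n.
  rewrite normrZ.
  have -> : e / N * (n%:R * (`|h| * `|v|)) = `|h| * (e / N * (n%:R * `|v|)) by ring.
  rewrite ler_wpM2l//.
  by rewrite mulrAC ler_pdivrMr // ler_wpM2l ?(ltW e0).
by apply: DeriveDef; [apply/cvg_ex; exists (dotv (partials G x) v) | exact/cvg_lim].
Unshelve. all: by end_near. Qed.

Lemma grad_MVT G x v :
  (forall z i, derivable G z (delta_mx ord0 i)) ->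
  (forall i, continuous (fun z => partials G z ord0 i)) ->
  exists th : R, [/\ 0 <= th, th <= 1 & G (x + v) - G x = dotv (partials G (x + th *: v)) v].
Proof.
move=> dG cG.
have D (s : R) : is_derive s 1 (fun s : R => G (x + s *: v)) (dotv (partials G (x + s *: v)) v).
  have [d1 d2] := is_derive_dir (x + s *: v) v dG cG.
  by rewrite -d2; exact: is_derive_line.
have cf : continuous (fun s : R => G (x + s *: v)).
  by move=> s; apply: differentiable_continuous; apply/derivable1_diffP; have [] := D s.
have [th] := @MVT_segment R _ _ 0 1 ler01 (fun s _ => D s) (continuous_subspaceT cf).
rewrite in_itv/= scale1r scale0r addr0 subr0 mulr1 => /andP[t0 tc] e.
by exists th.
Qed.

End Grad.

(** * Boundedness and uniform continuity on bounded sets *)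

Section Heine.
Variables (R : realType) (n : nat).

Lemma compact_box (r : R) : compact [set v : 'rV[R]_n | forall i, `[- r, r]%classic (v ord0 i)].
Proof. by apply: (@rV_compact _ _ (fun=> `[- r, r]%classic)) => _; exact: segment_compact. Qed.

Lemma in_box (r : R) (x : 'rV[R]_n) : enorm x <= r -> forall i, `[- r, r]%classic (x ord0 i).
Proof.
move=> xr i; rewrite /= in_itv/= -ler_norml; apply: le_trans xr.
by apply: le_trans (norm_le_enorm x); exact: coord_le_norm.
Qed.

Lemma bounded_on_ball (f : 'rV[R]_n -> R) (r : R) : continuous f ->
  exists2 m : R, 0 <= m & forall x, enorm x <= r -> `|f x| <= m.
Proof.
move=> cf.
have c : compact (f @` [set v : 'rV[R]_n | forall i, `[- r, r]%classic (v ord0 i)]).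
  by apply: continuous_compact (@compact_box r); exact: continuous_subspaceT.
have [M [_ HM]] := compact_bounded c.
exists (`|M| + 1); first by rewrite addr_ge0.
move=> x xr; apply: HM; first by rewrite ltr_pwDr// ler_norm.
by exists x => //; exact: in_box.
Qed.

(** Compactness is used in near-covering form, the radius being the parameter. Only (t, x) is
    confined to the compact box; y is any point within [del] of x. *)
Lemma heine (f : R * 'rV[R]_n -> R) (T r eps : R) : continuous f -> 0 < eps ->
  exists2 del : R, 0 < del & forall t x y, `|t| <= T -> enorm x <= r -> enorm (x - y) <= del ->
    `|f (t, x) - f (t, y)| <= eps.
Proof.
move=> cf e0.
pose K := `[- T, T]%classic `*` [set v : 'rV[R]_n | forall i, `[- r, r]%classic (v ord0 i)].
have cK : compact K by apply: compact_setX; [exact: segment_compact | exact: compact_box].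
have := (@compact_near_coveringP (R * 'rV[R]_n)%type K).1 cK.
move=> /(_ R (0^'+) (fun d p => forall y, `|p.2 - y| <= d -> `|f p - f (p.1, y)| <= eps) _).
case.
  move=> p Kp; have /cvgrPdist_le /(_ _ (divr_gt0 e0 (ltr0n R 2))) := cf p.
  move=> /nbhs_ballP[d /= d0 Hd].
  exists ([set q | ball p (d / 2) q], [set d' | d' < d / 2]).
    split => /=; first by apply: nbhsx_ballx; rewrite divr_gt0.
    by apply: nbhs_right_lt; rewrite divr_gt0.
  move=> [q d'] /= [bq d'd] y qy.
  have b1 : `|f p - f q| <= eps / 2.
    by apply: Hd; apply: le_ball bq; rewrite ler_pdivrMr// ler_pMr// ler1n.
  have b2 : `|f p - f (q.1, y)| <= eps / 2.
    apply: Hd; have [b3 b4] := bq; split => /=.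
      by apply: le_ball b3; rewrite ler_pdivrMr// ler_pMr// ler1n.
    have -> : d = d / 2 + d / 2 by lra.
    apply: ball_triangle b4 _; rewrite -ball_normE /=.
    exact: le_lt_trans qy d'd.
  apply: le_trans (ler_distD (f p) _ _) _; rewrite distrC; lra.
move=> d /= d0 Hd; exists (d / 2); first by rewrite divr_gt0.
move=> t x y tT xr xy.
have dd : d / 2 < d by lra.
have d20 : 0 < d / 2 by rewrite divr_gt0.
have bd : ball_ (fun x : R => `|x|) 0 d (d / 2) by rewrite /= sub0r normrN gtr0_norm.
apply: (Hd _ bd d20 (t, x)) => /=.
  split => /=; first by rewrite in_itv/= -ler_norml.
  exact: in_box.
exact: le_trans (norm_le_enorm _) xy.
Qed.

End Heine.

(** * Consequences of (W1), (W2) and (W3) *)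

Section Nonlin.
Variables (R : realType) (n : nat) (W : R -> 'rV[R]_n -> R) (mu : R).

Record nonlin : Prop := Nonlin {
  nlC1 : C1W W;
  nlmu : 2 < mu;
  nlAR : forall t x, x != 0 -> 0 < mu * W t x /\ mu * W t x <= dotv x (gradW W t x);
  nl2 : forall eps : R, 0 < eps -> exists delta : R, 0 < delta /\
     forall t (x : 'rV[R]_n), enorm x < delta -> enorm (gradW W t x) <= eps * enorm x;
  nl3 : exists Wbar : 'rV[R]_n -> R, continuous Wbar /\
     forall t x, `|W t x| + enorm (gradW W t x) <= `|Wbar x| }.

Hypothesis H : nonlin.

Lemma W_derivable t z i : derivable (W t) z (delta_mx ord0 i).
Proof. by have [_ [_ [d _]]] := nlC1 H; exact: d. Qed.

Lemma gradW_cont2 i : continuous (fun p : R * 'rV[R]_n => gradW W p.1 p.2 ord0 i).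
Proof. by have [_ [_ [_ [_ c]]]] := nlC1 H; exact: c. Qed.

Lemma gradW_cont t i : continuous (fun z => partials (W t) z ord0 i).
Proof.
move=> z; have c1 : {for z, continuous (fun z : 'rV[R]_n => (t, z))}.
  move=> A /nbhs_ballP [e /= e0 He]; apply/nbhs_ballP; exists e => //= y zy.
  by apply: He; split => //=; exact: ballxx.
exact: (continuous_comp c1 (@gradW_cont2 i (t, z))).
Qed.

Lemma W_MVT t x v : exists th : R, [/\ 0 <= th, th <= 1 &
  W t (x + v) - W t x = dotv (gradW W t (x + th *: v)) v].
Proof. by apply: grad_MVT; [exact: W_derivable | exact: gradW_cont]. Qed.

Lemma gradW0 t : gradW W t 0 = 0.
Proof.
have [d [d0 Hd]] := nl2 H ltr01.
have := Hd t 0; rewrite enorm0 => /(_ d0); rewrite mulr0 => h.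
by apply/eqP; rewrite -enorm0_eq0 eq_le h enorm_ge0.
Qed.

(* Both bounds at 0 come from W(t,x) - W(t,0) = grad W(t, th x).x and (W1). *)
Lemma W_small eps : (0 < n)%N -> 0 < eps -> exists2 delta, 0 < delta &
  forall t x, enorm x < delta -> 0 <= W t x /\ W t x <= eps * sqnorm x.
Proof.
move=> n0 e0; have mu2 := nlmu H; have [d [d0 Hd]] := nl2 H e0; exists d => // t.
have key x : x != 0 -> enorm x < d -> 0 < W t x /\ W t x <= eps / 2 * sqnorm x.
  move=> x0 xd; have [h1 h2] := nlAR H t x0.
  have mu0 : 0 < mu by lra.
  have W0 : 0 < W t x by rewrite pmulr_rgt0 in h1.
  split => //.
  have h3 : dotv x (gradW W t x) <= eps * sqnorm x.
    apply: le_trans (ler_norm _) _; apply: le_trans (dotv_CS _ _) _.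
    rewrite -enorm_sqr expr2 mulrCA ler_wpM2l ?enorm_ge0//; exact: Hd.
  nra.
(* (W1) excludes x = 0, so the value there is read off from a small vector c e_i: the bound |W t 0|
   <= 2 eps c contradicts c <= |W t 0| / (4 eps). *)
have W00 : W t 0 = 0.
  apply/eqP/negPn/negP => w0.
  pose i0 : 'I_n := Ordinal n0.
  pose c := Num.min 1 (Num.min (d / 2) (`|W t 0| / (4 * eps))).
  have w1 : 0 < `|W t 0| by rewrite normr_gt0.
  have c0 : 0 < c by rewrite !lt_min ltr01 !divr_gt0// mulr_gt0.
  have c1 : c <= 1 by rewrite !ge_min lexx.
  have cd : c < d by apply: (@le_lt_trans _ _ (d / 2)); [rewrite !ge_min lexx !orbT | lra].
  have cw : c * (4 * eps) <= `|W t 0| by rewrite -ler_pdivlMr ?mulr_gt0// !ge_min lexx !orbT.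
  clearbody c.
  pose x : 'rV[R]_n := c *: delta_mx ord0 i0.
  have sx : sqnorm x = c ^+ 2.
    rewrite sqnormZ sqnormE (bigD1 i0) //= big1 => [|i ii0]; rewrite mxE ?eqxx ?expr1n ?addr0 ?mulr1//.
    by rewrite (negbTE ii0) andbF expr0n.
  have ex : enorm x = c by rewrite /enorm sx sqrtr_sqr ger0_norm// ltW.
  have x0 : x != 0 by rewrite -enorm0_eq0 ex gt_eqF.
  have [h1 h2] := key x x0 ltac:(rewrite ex//).
  have [th [th0 th1]] := W_MVT t 0 x; rewrite !add0r => h3.
  have h4 : `|dotv (gradW W t (th *: x)) x| <= eps * c ^+ 2.
    apply: le_trans (dotv_CS _ _) _; rewrite ex.
    have eth : enorm (th *: x) <= c by rewrite enormZ ger0_norm// ex ler_piMl// ltW.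
    have := Hd t (th *: x) (le_lt_trans eth cd).
    move=> h; rewrite expr2 mulrA ler_wpM2r ?(ltW c0)//.
    by apply: le_trans h _; rewrite ler_wpM2l// ltW.
  have : `|W t 0| <= 2 * eps * c.
    have -> : W t 0 = W t x - dotv (gradW W t (th *: x)) x by rewrite -h3; ring.
    apply: le_trans (ler_normB _ _) _; rewrite gtr0_norm //.
    have : eps * c ^+ 2 <= eps * c by rewrite ler_wpM2l ?(ltW e0)// expr2 ler_piMl// ltW.
    rewrite sx in h2; lra.
  lra.
move=> x xd; have [->|x0] := eqVneq x 0.
  by rewrite W00 /sqnorm dotv0l mulr0.
have [h1 h2] := key x x0 xd; split; first exact: ltW.
by apply: le_trans h2 _; rewrite ler_wpM2r ?sqnorm_ge0//; lra.
Qed.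

(** Below the radius d of (W2) the gradient is at most |x|; above it the bound m from (W3) is at
    most (m / d) |x|. The bound on W follows from W <= mu W <= (x, grad W). *)
Lemma W_growth r : (0 < n)%N -> exists2 C, 0 <= C & forall t x, enorm x <= r ->
  [/\ enorm (gradW W t x) <= C * enorm x, 0 <= W t x & W t x <= C * sqnorm x].
Proof.
move=> n0; have mu2 := nlmu H; have mu0 : 0 < mu by lra.
have [d [d0 Hd]] := nl2 H ltr01.
have [d' d'0 Hd'] := W_small n0 ltr01.
have [Wb [cWb HWb]] := nl3 H.
have [m m0 Hm] := bounded_on_ball r cWb.
have C0 : 0 <= 1 + m / d by rewrite addr_ge0// divr_ge0// ltW.
have G t x : enorm x <= r -> enorm (gradW W t x) <= (1 + m / d) * enorm x.
  move=> xr; rewrite mulrDl mul1r; have [xd|dx] := ltP (enorm x) d.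
    apply: le_trans (Hd t x xd) _; rewrite mul1r lerDl.
    by rewrite mulr_ge0 ?enorm_ge0// divr_ge0// ltW.
  rewrite -[leLHS]add0r lerD ?enorm_ge0//.
  apply: (@le_trans _ _ m).
    have := HWb t x; have := Hm x xr; have := normr_ge0 (W t x); lra.
  by rewrite mulrAC ler_pdivlMr// ler_wpM2l.
exists (1 + m / d) => // t x xr; split; first exact: G.
  have [->|x0] := eqVneq x 0; first by have [] := Hd' t 0; first by rewrite enorm0.
  by have [h _] := nlAR H t x0; rewrite (pmulr_rgt0 _ mu0) in h; exact: ltW.
have [->|x0] := eqVneq x 0.
  have [|_] := Hd' t 0; first by rewrite enorm0.
  by rewrite /sqnorm dotv0l !mulr0.
have [h1 h2] := nlAR H t x0.
have h3 : dotv x (gradW W t x) <= (1 + m / d) * sqnorm x.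
  apply: le_trans (ler_norm _) _; apply: le_trans (dotv_CS _ _) _.
  rewrite -enorm_sqr expr2 mulrCA ler_wpM2l ?enorm_ge0//; exact: G.
have W0 : 0 < W t x by rewrite (pmulr_rgt0 _ mu0) in h1.
apply: le_trans h3; apply: le_trans h2; rewrite ler_peMl ?(ltW W0)//; lra.
Qed.

Lemma gradW_unif (T r eps : R) : 0 < eps -> exists2 del : R, 0 < del &
  forall t x y, `|t| <= T -> enorm x <= r -> enorm (x - y) <= del ->
    sqnorm (gradW W t x - gradW W t y) <= eps.
Proof.
move=> e0; pose e1 := Num.sqrt (eps / (n%:R + 1)).
have n1 : 0 < n%:R + 1 :> R by rewrite ltr_wpDl.
have e10 : 0 < e1 by rewrite sqrtr_gt0 divr_gt0.
have : forall i : 'I_n, exists del : R, 0 < del /\ forall t x y, `|t| <= T -> enorm x <= r -> enorm (x - y) <= del ->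
    `|gradW W t x ord0 i - gradW W t y ord0 i| <= e1.
  by move=> i; have [del d0 Hd] := heine T r (@gradW_cont2 i) e10; exists del.
move=> /choice [del Hdel].
have dmin0 : 0 < \big[Num.min/1]_(i < n) del i.
  by apply/bigmin_gtP; split => // i _; have [] := Hdel i.
exists (\big[Num.min/1]_(i < n) del i) => // t x y tT xr xy.
rewrite sqnormE; apply: (@le_trans _ _ (\sum_(i < n) (eps / (n%:R + 1)))).
  apply: ler_sum => i _; rewrite !mxE.
  have [_ /(_ t x y tT xr)] := Hdel i.
  rewrite !mxE => h; have {h} := h (le_trans xy _).
  have -> : eps / (n%:R + 1) = e1 ^+ 2 by rewrite sqr_sqrtr// divr_ge0// ltW.
  move=> h; rewrite -real_normK ?num_real// ler_sqr ?nnegrE ?(ltW e10)//.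
  by apply: h; exact: bigmin_le.
rewrite sumr_const card_ord -[leLHS]mulr_natl mulrCA ler_piMr ?(ltW e0)//.
by rewrite ler_pdivrMr// mul1r lerDl.
Qed.

(** By (W1) the function s^(-mu) W(t, s x) has nonnegative derivative in s. *)
Lemma W_superquad t x (s : R) : x != 0 -> 1 <= s -> s `^ mu * W t x <= W t (s *: x).
Proof.
move=> x0 s1; have s0 : 0 < s by lra.
have D (c : R) : 0 < c -> is_derive c 1 (fun s : R => W t (s *: x) * s `^ (- mu))
   (W t (c *: x) * (- mu * c `^ (- mu - 1)) + c `^ (- mu) * dotv (gradW W t (c *: x)) x).
  move=> c0.
  have D1 : is_derive c 1 (fun s : R => W t (s *: x)) (dotv (gradW W t (c *: x)) x).
    have [d1 d2] := is_derive_dir (0 + c *: x) x (@W_derivable t) (@gradW_cont t).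
    have := is_derive_line d1; rewrite d2 add0r.
    by under eq_fun do rewrite add0r.
  have D2 := derive_powR (- mu) c0.
  exact: (is_deriveM D1 D2).
have cf : {within `[1, s], continuous (fun s : R => W t (s *: x) * s `^ (- mu))}.
  apply: derivable_within_continuous => c; rewrite in_itv/= => /andP[c1 _].
  by have [] := D c (lt_le_trans ltr01 c1).
have Ds (c : R) : c \in `]1, s[ -> is_derive c 1 (fun s : R => W t (s *: x) * s `^ (- mu))
   (W t (c *: x) * (- mu * c `^ (- mu - 1)) + c `^ (- mu) * dotv (gradW W t (c *: x)) x).
  by rewrite in_itv/= => /andP[c1 _]; exact: (D c (lt_trans ltr01 c1)).
have [c] := MVT_segment s1 Ds cf.
rewrite in_itv/= scale1r powR1 mulr1 => /andP[c1 _] h.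
have c0 : 0 < c by lra.
have cx0 : c *: x != 0 by rewrite scaler_eq0 negb_or x0 gt_eqF.
have [_ AR] := nlAR H t cx0.
rewrite dotvZl dotvC in AR.
have E : c `^ (- mu) = c * c `^ (- mu - 1).
  rewrite [in LHS](_ : - mu = 1 + (- mu - 1)); last by ring.
  by rewrite powRD ?powRr1 ?(ltW c0)// (gt_eqF c0) implybT.
have : 0 <= W t (s *: x) * s `^ (- mu) - W t x.
  rewrite h mulr_ge0 ?subr_ge0// E.
  have P := powR_ge0 c (- mu - 1).
  have := mulr_ge0 P (ltac:(rewrite subr_ge0; exact: AR) : 0 <= c * dotv (gradW W t (c *: x)) x - mu * W t (c *: x)).
  lra.
rewrite subr_ge0 powRN ler_pdivlMr ?powR_gt0// mulrC.
by [].
Qed.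


End Nonlin.

(** * The spaces H^alpha and X^alpha *)

Section L2space.
Variable R : realType.
Local Notation mu := (@lebesgue_measure R).

Lemma real_cauchy_cvg (f : nat -> R) :
  (forall e : R, 0 < e -> exists N, forall i j, (N <= i)%N -> (N <= j)%N -> `|f i - f j| <= e) ->
  cvg (f @ \oo).
Proof.
move=> H; apply: R_complete; apply: cauchy_exP => e e0.
have [N HN] := H (e / 2) (divr_gt0 e0 (ltr0n R 2)).
exists (f N); exists N => // i /= Ni; rewrite -ball_normE /=.
by apply: le_lt_trans (HN N i (leqnn N) Ni) _; rewrite ltr_pdivrMr// ltr_pMr// ltr1n.
Qed.

Lemma geo_cauchy (f : nat -> R) (C : R) : 0 <= C ->
  (forall m, `|f m.+1 - f m| <= C * 2^-1 ^+ m) -> cvg (f @ \oo).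
Proof.
move=> C0 Hf.
have p0 m : 0 <= (2^-1 : R) ^+ m by rewrite exprn_ge0 ?invr_ge0.
have K i k : `|f (i + k)%N - f i| <= 2 * C * 2^-1 ^+ i - 2 * C * 2^-1 ^+ (i + k).
  elim: k => [|k IH]; first by rewrite addn0 !subrr normr0.
  rewrite addnS; apply: le_trans (ler_distD (f (i + k)%N) _ _) _.
  have := Hf (i + k)%N; rewrite exprS; lra.
apply: real_cauchy_cvg => e e0.
have : 2 * C * 2^-1 ^+ m @[m --> \oo] --> 2 * C * 0.
  by apply: cvgM; [exact: cvg_cst | apply: cvg_expr; rewrite ger0_norm ?invr_ge0// invf_lt1// ltr1n].
rewrite mulr0 => /cvgrPdist_le /(_ _ (divr_gt0 e0 (ltr0n R 2))) [N _ HN].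
exists N => i j Ni Nj.
have B k : (N <= k)%N -> `|f k - f N| <= e / 2.
  move=> Nk; rewrite -(subnKC Nk); apply: le_trans (K _ _) _.
  have := HN N (leqnn N); rewrite sub0r normrN ger0_norm ?mulr_ge0//.
  have := mulr_ge0 C0 (p0 (N + (k - N))%N); lra.
apply: le_trans (ler_distD (f N) _ _) _; rewrite [`|f N - _|]distrC.
have := B i Ni; have := B j Nj; lra.
Qed.

Lemma Fatou_Ig (f_ : nat -> R -> R) (f : R -> R) (c : R) :
  (forall k, integ (f_ k)) -> (forall k x, 0 <= f_ k x) ->
  (\forall k \near \oo, Ig (f_ k) <= c) -> (forall x, f_ k x @[k --> \oo] --> f x) ->
  integ f /\ Ig f <= c.
Proof.
move=> fi f0 fc fl.
have mf : measurable_fun setT f.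
  by apply: (@measurable_fun_cvg _ _ R setT f_) => // k; exact: integ_msr.
have pf x : 0 <= f x.
  apply: (@ler_cvg_to _ _ _ _ (fun=> 0) (f_ ^~ x) 0 (f x) (cvg_cst _) (fl x)).
  by apply: nearW => k; exact: f0.
have F : (\int[mu]_x (f x)%:E <= c%:E)%E.
  have := @fatou _ (measurableTypeR R) R mu setT measurableT (fun k x => (f_ k x)%:E).
  move=> /(_ _ _) h; apply: le_trans (_ : limn_einf (fun k => \int[mu]_x (f_ k x)%:E)%E <= _)%E.
    apply: le_trans (h _ _).
    - rewrite le_eqVlt; apply/orP; left; apply/eqP; apply: eq_integral => x _.
      have cE : (f_ k x)%:E @[k --> \oo] --> (f x)%:E by apply: cvg_EFin; [exact: nearW | exact: fl].
      by rewrite is_cvg_limn_einfE; [exact/esym/cvg_lim | exact: (cvgP _ cE)].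
    - by move=> k; apply/measurable_EFinP; exact: integ_msr.
    - by move=> k x _; rewrite lee_fin.
  rewrite limn_einf_lim; apply: lime_le; first exact: is_cvg_einfs.
  have [N _ HN] := fc; apply: nearW => k.
  apply: (@le_trans _ _ (\int[mu]_x (f_ (maxn k N) x)%:E)%E).
    by apply: ereal_inf_lbound; exists (maxn k N) => //=; exact: leq_maxl.
  by rewrite integ_fin // lee_fin; apply: HN => /=; exact: leq_maxr.
have i : integ f by apply: integ_lty => //; apply: le_lt_trans F _; exact: ltry.
by split => //; rewrite -lee_fin -integ_fin.
Qed.

(** Riesz-Fischer: a fast subsequence converges almost everywhere, and Fatou turns its pointwise
    limit into the L^2 limit of the whole sequence. *)
Lemma L2_complete_scalar (f : nat -> R -> R) :
  (forall k, measurable_fun setT (f k)) -> (forall j k, integ (fun x => (f j x - f k x) ^+ 2)) ->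
  (forall e : R, 0 < e -> exists N, forall j k, (N <= j)%N -> (N <= k)%N ->
      Ig (fun x => (f j x - f k x) ^+ 2) <= e) ->
  exists2 g : R -> R, measurable_fun setT g &
    forall e : R, 0 < e -> exists N, forall k, (N <= k)%N ->
      integ (fun x => (f k x - g x) ^+ 2) /\ Ig (fun x => (f k x - g x) ^+ 2) <= e.
Proof.
move=> mf fi fC.
have e8 m : 0 < (8^-1 : R) ^+ m by rewrite exprn_gt0// invr_gt0.
have [N HN] := choice (fun m => fC _ (e8 m)).
pose sg := fix sg m := if m is m'.+1 then (maxn (sg m').+1 (N m)) else N 0%N.
have sgN m : (N m <= sg m)%N by case: m => [|m] //=; exact: leq_maxr.
have sgm i j : (i <= j)%N -> (sg i <= sg j)%N.
  move=> ij; rewrite -(subnKC ij); elim: (j - i)%N => [|k IH]; first by rewrite addn0.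
  by rewrite addnS; apply: leq_trans IH _; rewrite /=; apply: leq_trans (leqnSn _) (leq_maxl _ _).
have sgb m : Ig (fun x => (f (sg m.+1) x - f (sg m) x) ^+ 2) <= 8^-1 ^+ m.
  by apply: HN => //; apply: leq_trans (sgN m) _; exact: sgm.
have sgge m : (m <= sg m)%N.
  by elim: m => [//|m IH]; apply: leq_trans (leq_maxl _ _); rewrite ltnS.
clearbody sg.
(* The squared increments have integral at most 8^(-m), so with weight 4^m they still sum to an
   integrable F; where F x is finite, the increments are at most sqrt(F x) 2^(-m). *)
pose h m x : R := 4 ^+ m * (f (sg m.+1) x - f (sg m) x) ^+ 2.
have h0 m x : 0 <= h m x by rewrite mulr_ge0 ?sqr_ge0// exprn_ge0.
have hi m : integ (h m) by apply: integZ.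
have mh m : measurable_fun setT (EFin \o h m) by apply/measurable_EFinP; exact: integ_msr.
pose F (x : R) : \bar R := (\sum_(0 <= m <oo) (h m x)%:E)%E.
have F0 x : (0 <= F x)%E by apply: nneseries_ge0 => m _ _; rewrite lee_fin.
have mF : measurable_fun setT F.
  by apply: (@ge0_emeasurable_sum _ (measurableTypeR R) R setT (fun m x => (h m x)%:E) xpredT); [move=> k x _ _; rewrite lee_fin | move=> k _; exact: mh].
have hsum m : (\int[mu]_x (h m x)%:E <= (2 / (2 ^ (m + 1))%:R)%:E)%E.
  rewrite (integ_fin (hi m)) lee_fin /h (IgZ _ (fi _ _)).
  apply: (@le_trans _ _ (4 ^+ m * 8^-1 ^+ m)); first by rewrite ler_wpM2l ?exprn_ge0.
  rewrite -exprMn (_ : 4 * 8^-1 = 2^-1 :> R); last by field.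
  by rewrite addn1 expnS natrM invfM mulrA mulfV// mul1r natrX exprVn.
have iF : (\int[mu]_x F x < +oo)%E.
  rewrite /F (@integral_nneseries _ (measurableTypeR R) R mu setT measurableT (fun m x => (h m x)%:E) mh); last first.
    by move=> m x _; rewrite lee_fin.
  apply: (@le_lt_trans _ _ (\sum_(0 <= m <oo) (2 / (2 ^ (m + 1))%:R)%:E)%E).
    apply: lee_nneseries; last by move=> m _; exact: hsum.
    by move=> m _ _; apply: integral_ge0 => x _; rewrite lee_fin.
  have /cvg_lim := @cvg_geometric_eseries_half R 2 0.
  by move=> ->//; exact: ltry.
pose E := [set x | (F x < +oo)%E].
have mE : measurable E.
  by rewrite /E -[X in measurable X]setTI; exact: emeasurable_fun_infty_o.
have aeE : {ae mu, forall x, E x}.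
  have iFE : mu.-integrable setT F.
    apply/integrableP; split => //; apply: le_lt_trans iF.
    by rewrite le_eqVlt; apply/orP; left; apply/eqP; apply: eq_integral => x _; rewrite gee0_abs.
  have := integrable_ae measurableT iFE.
  apply: (@filterS _ _ (ae_filter_ringOfSetsType mu)) => x /(_ I).
  by rewrite ge0_fin_numE.
have cvgE x : E x -> cvg (f (sg m) x @[m --> \oo]).
  move=> Ex; have [c [c0 Hc]] : exists c, 0 <= c /\ forall m, h m x <= c.
    exists (fine (F x)); split; first exact: fine_ge0.
    move=> m; rewrite -lee_fin fineK; last by rewrite ge0_fin_numE.
    apply: le_trans (_ : \sum_(0 <= i < m.+1) (h i x)%:E <= _)%E.
      rewrite big_nat_recr//= leeDr// sume_ge0// => i _; first by rewrite lee_fin.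
    by apply: nneseries_lim_ge => i _ _; rewrite lee_fin.
  apply: (@geo_cauchy _ (Num.sqrt c)); first exact: sqrtr_ge0.
  move=> m.
  rewrite -ler_sqr ?nnegrE ?mulr_ge0 ?sqrtr_ge0 ?exprn_ge0 ?invr_ge0//.
  rewrite exprMn sqr_sqrtr// real_normK ?num_real//.
  have := Hc m; rewrite /h -exprM mulnC exprM.
  rewrite (_ : (2^-1 ^+ 2) = (4^-1 : R)); last by field.
  rewrite exprVn ler_pdivlMr ?exprn_gt0// mulrC.
  by [].
(* On the null set where F is infinite, g and its approximants are put to 0, so that convergence
   holds everywhere and g is Borel measurable. *)
pose g x := if (F x < +oo)%E then lim (f (sg m) x @[m --> \oo]) else 0.
pose fg m x := if (F x < +oo)%E then f (sg m) x else 0.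
have fgl x : fg m x @[m --> \oo] --> g x.
  by rewrite /fg /g; case: ifPn => [Ex|_]; [exact: cvgE | exact: cvg_cst].
have mfg m : measurable_fun setT (fg m).
  rewrite (_ : fg m = f (sg m) \_ E).
    by apply/measurable_restrict => //; exact: measurable_funTS.
  by apply/funext => x; rewrite patchE /fg; case: ifPn => [Ex|nEx]; [rewrite mem_set | rewrite memNset//; exact/negP].
have mg : measurable_fun setT g by exact: (@measurable_fun_cvg _ _ R setT fg).
exists g => // e e0; have [N' HN'] := fC e e0.
exists N' => k kN'.
have mi (u : R -> R) : integ u -> (forall x, 0 <= u x) ->
    integ (fun x => if (F x < +oo)%E then u x else 0) /\
    Ig (fun x => if (F x < +oo)%E then u x else 0) = Ig u.
  move=> iu u0; apply: Ig_ae => //.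
    rewrite (_ : (fun x => _) = u \_ E).
      by apply/measurable_restrict => //; apply: measurable_funTS; exact: integ_msr.
    by apply/funext => x; rewrite patchE; case: ifPn => [Ex|nEx]; [rewrite mem_set | rewrite memNset//; exact/negP].
  by apply: (@filterS _ _ (ae_filter_ringOfSetsType mu) _ _ _ aeE) => x; rewrite /E /= => ->.
have [i1 b1] : integ (fun x => if (F x < +oo)%E then (f k x - g x) ^+ 2 else 0) /\
  Ig (fun x => if (F x < +oo)%E then (f k x - g x) ^+ 2 else 0) <= e.
  apply: (@Fatou_Ig (fun m x => if (F x < +oo)%E then (f k x - f (sg m) x) ^+ 2 else 0)).
  - by move=> m; have [] := mi _ (fi k (sg m)) (fun x => sqr_ge0 _).
  - by move=> m x; case: ifP => // _; exact: sqr_ge0.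
  - exists N' => // m /= N'm; have [_ ->] := mi _ (fi k (sg m)) (fun x => sqr_ge0 _).
    by apply: HN' => //; apply: leq_trans (sgge m).
  - move=> x; case: ifPn => [Ex|_]; last exact: cvg_cst.
    have := fgl x; rewrite /fg Ex => l.
    by rewrite expr2; under eq_cvg do rewrite expr2; apply: cvgM; apply: cvgB => //; exact: cvg_cst.
have [i2 e2] : integ (fun x => (f k x - g x) ^+ 2) /\
  Ig (fun x => (f k x - g x) ^+ 2) = Ig (fun x => if (F x < +oo)%E then (f k x - g x) ^+ 2 else 0).
  apply: Ig_ae => //; first by apply: measurable_sqr; exact: measurable_funB.
  by apply: (@filterS _ _ (ae_filter_ringOfSetsType mu) _ _ _ aeE) => x; rewrite /E /= => ->.
by rewrite e2.
Qed.

End L2space.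

(** * Vector-valued square integrable functions *)

Section L2vec.
Variables (R : realType) (n : nat).
Local Notation mu := (@lebesgue_measure R).
Local Notation vfun := (R -> 'rV[R]_n).
Implicit Types u v w : vfun.

Definition L2 u := (forall i, measurable_fun setT (fun t => u t ord0 i)) /\
  integ (fun t => sqnorm (u t)).

Definition ipL2 u v := Ig (fun t => dotv (u t) (v t)).

Lemma measurable_dotv u v : (forall i, measurable_fun setT (fun t => u t ord0 i)) ->
  (forall i, measurable_fun setT (fun t => v t ord0 i)) ->
  measurable_fun setT (fun t => dotv (u t) (v t)).
Proof. by move=> mu1 mv1; apply: measurable_sum => i; exact: measurable_funM. Qed.

Lemma L2_integ u v : L2 u -> L2 v -> integ (fun t => dotv (u t) (v t)).
Proof.
move=> [mu1 iu] [mv1 iv].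
apply: integ_le (measurable_dotv mu1 mv1) (integD iu iv) _ => t.
apply: le_trans (dotv_CS _ _) _; rewrite -!enorm_sqr.
have := sqr_ge0 (enorm (u t) - enorm (v t)).
have := enorm_ge0 (u t); have := enorm_ge0 (v t); nra.
Qed.

Lemma L2_ph : prehilbert L2 ipL2.
Proof.
split.
- split; first by move=> i; under eq_fun do rewrite mxE; exact: measurable_cst.
  rewrite (_ : (fun t => _) = fun=> 0); first exact: integrable0.
  by apply/funext => t; rewrite /sqnorm dotv0l.
- move=> u v Lu Lv; have iuv := L2_integ Lu Lv; case: Lu Lv => mu1 iu [mv1 iv].
  have m i : measurable_fun setT (fun t => (u + v) t ord0 i).
    by rewrite (_ : (fun t => _) = fun t => u t ord0 i + v t ord0 i);
      [exact: measurable_funD | apply/funext => t; rewrite mxE].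
  split => //; apply: integ_le (integD (integZ 2 iu) (integZ 2 iv)) _.
    exact: measurable_dotv.
  by move=> t; rewrite ger0_norm ?sqnorm_ge0//; exact: sqnormD.
- move=> c u [mu1 iu]; split.
    move=> i; rewrite (_ : (fun t => _) = fun t => c * u t ord0 i).
      by apply: measurable_funM => //; exact: measurable_cst.
    by apply/funext => t; rewrite mxE.
  rewrite (_ : (fun t => _) = fun t => c ^+ 2 * sqnorm (u t)); first exact: integZ.
  by apply/funext => t; rewrite sqnormZ.
- by move=> u v _ _; apply: eq_Ig => t; exact: dotvC.
- move=> u v w Lu Lv Lw; rewrite /ipL2 -(IgD (L2_integ Lu Lw) (L2_integ Lv Lw)).
  by apply: eq_Ig => t; exact: dotvDl.
- move=> c u v Lu Lv; rewrite /ipL2 -(IgZ c (L2_integ Lu Lv)).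
  by apply: eq_Ig => t; exact: dotvZl.
- by move=> u _; apply: Ig_ge0 => t; exact: sqnorm_ge0.
Qed.

Definition nL2 u := nrm ipL2 u.

Lemma nL2_sqr u : L2 u -> nL2 u ^+ 2 = Ig (fun t => sqnorm (u t)).
Proof. by move=> Lu; rewrite /nL2 (nrm_sqr L2_ph Lu). Qed.

Lemma L2B u v : L2 u -> L2 v -> L2 (u - v).
Proof. exact: (phB L2_ph). Qed.

Lemma L2_coord u i : L2 u -> integ (fun t => u t ord0 i ^+ 2).
Proof.
move=> [mu1 iu]; apply: integ_le (measurable_sqr (mu1 i)) iu _ => t.
by rewrite ger0_norm ?sqr_ge0//; exact: coord_sqnorm.
Qed.

Lemma Ig_sum (I : eqType) (s : seq I) (F : I -> R -> R) : (forall i, integ (F i)) ->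
  integ (fun t => \sum_(i <- s) F i t) /\ Ig (fun t => \sum_(i <- s) F i t) = \sum_(i <- s) Ig (F i).
Proof.
move=> iF; elim: s => [|i s [IH1 IH2]].
  rewrite big_nil (_ : (fun t => _) = fun=> 0); last by apply/funext => t; rewrite big_nil.
  by split; [exact: integrable0 | rewrite /Rintegral integral0].
rewrite big_cons (_ : (fun t => _) = fun t => F i t + \sum_(j <- s) F j t); last first.
  by apply/funext => t; rewrite big_cons.
by split; [exact: integD | rewrite (IgD (iF i) IH1) IH2].
Qed.

Lemma L2_sqnorm u : (forall i, measurable_fun setT (fun t => u t ord0 i)) ->
  (forall i, integ (fun t => u t ord0 i ^+ 2)) ->
  L2 u /\ Ig (fun t => sqnorm (u t)) = \sum_i Ig (fun t => u t ord0 i ^+ 2).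
Proof.
move=> mu1 iu; have [i1 e1] := Ig_sum (index_enum 'I_n) iu.
have E : (fun t => sqnorm (u t)) = (fun t => \sum_i u t ord0 i ^+ 2).
  by apply/funext => t; rewrite sqnormE.
by split; [split => //; rewrite E | rewrite E].
Qed.

Lemma L2_complete (u : nat -> vfun) : (forall k, L2 (u k)) ->
  (forall e : R, 0 < e -> exists N, forall j k, (N <= j)%N -> (N <= k)%N -> nL2 (u j - u k) <= e) ->
  exists2 v, L2 v & nL2 (u k - v) @[k --> \oo] --> (0 : R).
Proof.
move=> Lu uC.
have H (i : 'I_n) : exists g : R -> R, measurable_fun setT g /\
    forall e : R, 0 < e -> exists N, forall k, (N <= k)%N ->
      integ (fun x => (u k x ord0 i - g x) ^+ 2) /\ Ig (fun x => (u k x ord0 i - g x) ^+ 2) <= e.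
  have D j k : (fun x => (u j x ord0 i - u k x ord0 i) ^+ 2) = (fun x => (u j - u k) x ord0 i ^+ 2).
    by apply/funext => x; rewrite !mxE.
  have [|||g mg Hg] := @L2_complete_scalar R (fun k x => u k x ord0 i).
  - by move=> k; have [] := Lu k.
  - by move=> j k; rewrite D; apply: L2_coord; exact: L2B.
  - move=> e e0; have [N HN] := uC (Num.sqrt e) (ltac:(rewrite sqrtr_gt0//)).
    exists N => j k Nj Nk; rewrite D.
    have Ljk := L2B (Lu j) (Lu k).
    apply: (@le_trans _ _ (Ig (fun t => sqnorm ((u j - u k) t)))).
      by apply: Ig_le; [exact: L2_coord | by case: Ljk | move=> t; exact: coord_sqnorm].
    rewrite -(nL2_sqr Ljk) -[leRHS]sqr_sqrtr ?(ltW e0)//.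
    by rewrite ler_sqr ?nnegrE ?sqrtr_ge0 ?HN.
  by exists g.
have {H} [g Hg] := choice H.
pose v : vfun := fun t => \row_i g i t.
have mv i : measurable_fun setT (fun t => v t ord0 i).
  rewrite (_ : (fun t => _) = g i); first by have [] := Hg i.
  by apply/funext => t; rewrite mxE.
have mB k i : measurable_fun setT (fun t => (u k - v) t ord0 i).
  rewrite (_ : (fun t => _) = fun t => u k t ord0 i - v t ord0 i).
    by apply: measurable_funB => //; have [] := Lu k.
  by apply/funext => t; rewrite !mxE.
have K (e : R) : 0 < e -> exists N, forall k, (N <= k)%N -> L2 (u k - v) /\ nL2 (u k - v) <= e.
  move=> e0; pose e1 := e ^+ 2 / (n%:R + 1).
  have n1 : 0 < n%:R + 1 :> R by rewrite ltr_wpDl.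
  have e10 : 0 < e1 by rewrite divr_gt0// exprn_gt0.
  have [N HN] := choice (fun i => (Hg i).2 _ e10).
  exists (\max_i N i)%N => k Nk.
  have E i : (fun t => (u k - v) t ord0 i ^+ 2) = (fun x => (u k x ord0 i - g i x) ^+ 2).
    by apply/funext => t; rewrite !mxE.
  have Nik i : (N i <= k)%N by apply: leq_trans Nk; exact: leq_bigmax.
  have [|Lk eL] := L2_sqnorm (mB k).
    by move=> i; rewrite E; have [] := HN i k (Nik i).
  split => //.
  rewrite -ler_sqr ?nnegrE ?(ltW e0) ?sqrtr_ge0// (nL2_sqr Lk) eL.
  apply: (@le_trans _ _ (\sum_(i < n) e1)).
    by apply: ler_sum => i _; rewrite E; have [] := HN i k (Nik i).
  rewrite sumr_const card_ord -[leLHS]mulr_natl /e1 mulrCA ler_piMr ?sqr_ge0//.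
  by rewrite ler_pdivrMr// mul1r lerDl.
exists v.
  have [N HN] := K 1 ltr01; have [LN _] := HN N (leqnn N).
  by have := L2B (Lu N) LN; rewrite opprB addrC subrK.
apply/cvgrPdist_le => e e0; have [N HN] := K e e0.
exists N => // k /= Nk; rewrite sub0r normrN ger0_norm ?sqrtr_ge0//.
by have [] := HN k Nk.
Qed.

Lemma L2funP u : L2fun u <-> L2 u.
Proof.
split=> [[m i]|[m i]]; split=> //; last by rewrite (integ_fin i) ltry.
by apply: integ_lty => //; [exact: measurable_dotv | move=> t; exact: sqnorm_ge0].
Qed.

Lemma nL2_cvgP (u_ : nat -> vfun) u : (forall k, L2 (u_ k)) -> L2 u ->
  ((\int[mu]_x (sqnorm (u_ k x - u x))%:E) @[k --> \oo] --> 0)%E <->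
  nL2 (u_ k - u) @[k --> \oo] --> (0 : R).
Proof.
move=> Lk Lu.
have E k : (\int[mu]_x (sqnorm (u_ k x - u x))%:E)%E = (nL2 (u_ k - u) ^+ 2)%:E.
  have LB := L2B (Lk k) Lu; rewrite (nL2_sqr LB) -integ_fin//.
  by case: LB.
under eq_cvg do rewrite E.
split=> h.
  have h2 : nL2 (u_ k - u) ^+ 2 @[k --> \oo] --> (0 : R).
    by move/fine_cvgP : h => [_].
  have h3 := continuous_cvg _ (@sqrt_continuous R 0) h2.
  rewrite sqrtr0 in h3.
  rewrite (_ : (fun k => nL2 (u_ k - u)) = (fun k => Num.sqrt (nL2 (u_ k - u) ^+ 2))); first exact: h3.
  by apply/funext => k; rewrite sqrtr_sqr ger0_norm// sqrtr_ge0.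
have h4 := cvgM h h; rewrite mulr0 in h4.
by apply: cvg_EFin; [exact: nearW | exact: h4].
Qed.

End L2vec.

(** * Test functions and the closure of the graph of D^a *)

Section Smooth.
Variables (R : realType) (n : nat).
Local Notation mu := (@lebesgue_measure R).
Local Notation vfun := (R -> 'rV[R]_n).

Definition smooth1 (f : R -> R) := forall (k : nat) x, derivable (derive1n k f) x 1.

Lemma derive1nD (f g : R -> R) k : smooth1 f -> smooth1 g ->
  derive1n k (fun x => f x + g x) = fun x => derive1n k f x + derive1n k g x.
Proof.
move=> sf sg; elim: k => [//|k IH].
apply/funext => x; rewrite derive1nS IH derive1E.
have := @deriveD _ _ _ (derive1n k f) (derive1n k g) x 1 (sf k x) (sg k x).
by rewrite !derive1nS !derive1E.
Qed.

Lemma derive1nZ (f : R -> R) c k : smooth1 f ->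
  derive1n k (fun x => c * f x) = fun x => c * derive1n k f x.
Proof.
move=> sf; elim: k => [//|k IH].
apply/funext => x; rewrite derive1nS IH derive1E.
have := @deriveZ _ _ _ (derive1n k f) c x 1 (sf k x).
by rewrite !derive1nS !derive1E.
Qed.

Lemma smooth1D f g : smooth1 f -> smooth1 g -> smooth1 (fun x => f x + g x).
Proof. by move=> sf sg k x; rewrite derive1nD //; apply: derivableD; [exact: sf | exact: sg]. Qed.

Lemma smooth1Z c f : smooth1 f -> smooth1 (fun x => c * f x).
Proof. by move=> sf k x; rewrite derive1nZ //; apply: derivableZ; exact: sf. Qed.

Implicit Types phi psi u g : vfun.

Lemma smooth_C1c phi i : smooth_compact phi -> C1c (fun t => phi t ord0 i).
Proof.
move=> [s [M HM]]; split.
- by move=> x; exact: (s i 0%N x).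
- move=> x; apply: differentiable_continuous; apply/derivable1_diffP.
  by have := s i 1%N x; rewrite derive1nS.
- exists (`|M| + 1); first by rewrite ltr_wpDl.
  move=> x xM; rewrite HM ?mxE//; apply: le_lt_trans xM.
  by apply: le_trans (ler_norm M) _; rewrite lerDl.
Qed.

Lemma smooth_compactD phi psi : smooth_compact phi -> smooth_compact psi -> smooth_compact (phi + psi).
Proof.
move=> [s1 [M1 H1]] [s2 [M2 H2]]; split.
  move=> i; rewrite (_ : (fun t => (phi + psi) t ord0 i) = fun t => phi t ord0 i + psi t ord0 i).
    exact: (@smooth1D (fun t => phi t ord0 i) (fun t => psi t ord0 i) (s1 i) (s2 i)).
  by apply/funext => t; rewrite mxE.
exists (Num.max M1 M2) => x; rewrite gt_max => /andP[h1 h2].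
have -> : (phi + psi) x = phi x + psi x by [].
by rewrite H1 // H2 // addr0.
Qed.

Lemma smooth_compactZ c phi : smooth_compact phi -> smooth_compact (c *: phi).
Proof.
move=> [s1 [M1 H1]]; split.
  move=> i; rewrite (_ : (fun t => (c *: phi) t ord0 i) = fun t => c * phi t ord0 i).
    exact: (@smooth1Z c (fun t => phi t ord0 i) (s1 i)).
  by apply/funext => t; rewrite mxE.
exists M1 => x h1.
have -> : (c *: phi) x = c *: phi x by [].
by rewrite H1 // scaler0.
Qed.

Variable a : R.
Hypotheses (a0 : 1 / 2 < a) (a1 : a < 1).

Lemma fracG_integ (f : R -> R) (x : R) : C1c f -> integ (fun s : R => kp (- a) s * (derive1 f) (x - s)).
Proof.
move=> cf; have [K [M [K0 M0 fK fM]]] := C1c_bounds cf.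
have [_ cdf _] := cf.
apply: (@integ_kp _ (- a) K M) => //; first by rewrite ltrN2.
- exact: continuous_measurable_fun.
- by move=> y; have [] := fK y.
- by move=> y yM; have [] := fM y; first by rewrite ltr_normr; apply/orP; right; rewrite ltrNr.
Qed.

Lemma LWder_lin (f g : R -> R) c d : C1c f -> C1c g -> C1c (fun x => c * f x + d * g x) ->
  forall x, LWder a (fun x => c * f x + d * g x) x = c * LWder a f x + d * LWder a g x.
Proof.
move=> cf cg cfg x; rewrite !LWderE //.
have key : fracG a (fun x => c * f x + d * g x) x = c * fracG a f x + d * fracG a g x; last first.
  by rewrite key mulrDl !mulrA.
have i1 := fracG_integ x cf; have i2 := fracG_integ x cg.
have e := IgD (integZ c i1) (integZ d i2).
rewrite (IgZ c i1) (IgZ d i2) in e; apply: etrans _ e.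
apply: eq_Ig => s; have [df _ _] := cf; have [dg _ _] := cg.
have -> : derive1 (fun x => c * f x + d * g x) (x - s) = c * derive1 f (x - s) + d * derive1 g (x - s).
  have D1 : is_derive (x - s) 1 f (derive1 f (x - s)) by rewrite derive1E; apply: derivableP.
  have D2 : is_derive (x - s) 1 g (derive1 g (x - s)) by rewrite derive1E; apply: derivableP.
  rewrite derive1E.
  by have [_ ->] := is_deriveD (is_deriveZ c D1) (is_deriveZ d D2).
ring.
Qed.

Lemma LWderv_lin phi psi c d : smooth_compact phi -> smooth_compact psi ->
  LWderv a (c *: phi + d *: psi) = c *: LWderv a phi + d *: LWderv a psi.
Proof.
move=> s1 s2; apply/funext => x; apply/rowP => i.
have -> : (c *: LWderv a phi + d *: LWderv a psi) x ord0 i =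
  c * LWder a (fun t => phi t ord0 i) x + d * LWder a (fun t => psi t ord0 i) x.
  by rewrite [LHS]mxE [X in X + _]mxE [X in _ + X]mxE /LWderv !mxE.
rewrite mxE.
have E : (fun t => (c *: phi + d *: psi) t ord0 i) = fun t => c * phi t ord0 i + d * psi t ord0 i.
  by apply/funext => t; rewrite !mxE.
rewrite E LWder_lin //; [exact: smooth_C1c | exact: smooth_C1c | rewrite -E].
by apply: smooth_C1c; apply: smooth_compactD; exact: smooth_compactZ.
Qed.

Lemma C1c_L2 (f : R -> R) : C1c f -> integ (fun x => f x ^+ 2).
Proof.
move=> cf; have mf := continuous_measurable_fun (C1c_cont cf).
have [K [M [K0 M0 fK fM]]] := C1c_bounds cf.
have [ib _] := @Ig_box R (- M) M (K ^+ 2) ltac:(lra).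
apply: integ_le (measurable_sqr mf) ib _ => y; rewrite in_itv/= -ler_norml.
have [h|h] := leP `|y| M; last by have [-> _] := fM _ h; rewrite expr0n normr0.
rewrite ger0_norm ?sqr_ge0// -real_normK ?num_real// ler_sqr ?nnegrE//.
by have [] := fK y.
Qed.

Lemma smooth_L2 phi : smooth_compact phi -> L2 phi /\ L2 (LWderv a phi).
Proof.
move=> s; have c i := smooth_C1c i s; split.
  have [] // := @L2_sqnorm R n phi.
    by move=> i; apply: continuous_measurable_fun; exact: C1c_cont.
  by move=> i; exact: C1c_L2.
have E i : (fun t => LWderv a phi t ord0 i) = LWder a (fun t => phi t ord0 i).
  by apply/funext => t; rewrite mxE.
have [] // := @L2_sqnorm R n (LWderv a phi).
  by move=> i; rewrite E; apply: continuous_measurable_fun; exact: (LWder_cont a0 a1 (c i)).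
move=> i; have := LWder_L2 a0 a1 (c i); rewrite -E; exact.
Qed.

Lemma smooth_bounds phi : smooth_compact phi -> forall x,
  sqnorm (phi x) <= 2 * nL2 phi ^+ 2 + 2 * fracC a * nL2 (LWderv a phi) ^+ 2 /\
  forall h, 0 < h -> sqnorm (phi (x + h) - phi x) <= fracC a * h `^ (2 * a - 1) * nL2 (LWderv a phi) ^+ 2.
Proof.
move=> s x; have c i := smooth_C1c i s; have [L1 L2'] := smooth_L2 s.
have E i : (fun t => LWder a (fun t => phi t ord0 i) t ^+ 2) = (fun t => LWderv a phi t ord0 i ^+ 2).
  by apply/funext => t; rewrite mxE.
have [_ e1] := L2_sqnorm (L1.1) (fun i => L2_coord i L1).
have [_ e2] := L2_sqnorm (L2'.1) (fun i => L2_coord i L2').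
rewrite (nL2_sqr L1) (nL2_sqr L2') e1 e2; split.
  rewrite sqnormE !mulr_sumr -big_split /=; apply: ler_sum => i _; rewrite -E.
  exact: (C1c_sup_bound a0 a1 (c i) x).
move=> h h0; rewrite sqnormE !mulr_sumr; apply: ler_sum => i _; rewrite -E !mxE.
exact: (LWder_holder a0 a1 (c i) x h0).
Qed.

(* The graph of D^a on H^a, with u the continuous representative: the approximations converge pointwise everywhere. *)
Definition HS u g := [/\ L2 u, L2 g & exists phi : nat -> vfun,
  [/\ forall k, smooth_compact (phi k), nL2 (phi k - u) @[k --> \oo] --> (0 : R),
      nL2 (LWderv a (phi k) - g) @[k --> \oo] --> (0 : R) &
      forall t i, phi k t ord0 i @[k --> \oo] --> u t ord0 i]].

Lemma HS_smooth phi : smooth_compact phi -> HS phi (LWderv a phi).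
Proof.
move=> s; have [L1 L2'] := smooth_L2 s; split => //; exists (fun=> phi); split => //.
- rewrite (_ : (fun=> _) = fun=> 0); [exact: cvg_cst | apply/funext => k].
  by rewrite subrr /nL2 (nrm0 (L2_ph R n)).
- rewrite (_ : (fun=> _) = fun=> 0); [exact: cvg_cst | apply/funext => k].
  by rewrite subrr /nL2 (nrm0 (L2_ph R n)).
- by move=> t i; exact: cvg_cst.
Qed.

Lemma nL2_lin_cvg (u_ v_ : nat -> vfun) u v c d : (forall k, L2 (u_ k)) -> (forall k, L2 (v_ k)) ->
  L2 u -> L2 v -> nL2 (u_ k - u) @[k --> \oo] --> (0 : R) -> nL2 (v_ k - v) @[k --> \oo] --> (0 : R) ->
  nL2 ((c *: u_ k + d *: v_ k) - (c *: u + d *: v)) @[k --> \oo] --> (0 : R).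
Proof.
move=> Lu_ Lv_ Lu Lv cu cv; have P := L2_ph R n.
have h : `|c| * nL2 (u_ k - u) + `|d| * nL2 (v_ k - v) @[k --> \oo] --> (`|c| * 0 + `|d| * 0 : R).
  by apply: cvgD; (apply: cvgM; first exact: cvg_cst); [exact: cu | exact: cv].
rewrite !mulr0 addr0 in h.
apply: (@squeeze_cvgr _ _ _ _ (fun=> 0) _ _ _ _ _ h); last exact: cvg_cst.
apply: nearW => k; rewrite /nL2 nrm_ge0 /=.
have LB1 := L2B (Lu_ k) Lu; have LB2 := L2B (Lv_ k) Lv.
rewrite -(nrmZ P c LB1) -(nrmZ P d LB2) opprD addrACA -!scalerBr.
by apply: (nrmD P); exact: (phZ P).
Qed.

Lemma HS_lin u g v h c d : HS u g -> HS v h -> HS (c *: u + d *: v) (c *: g + d *: h).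
Proof.
move=> [Lu Lg [phi [s1 cu cg pu]]] [Lv Lh [psi [s2 cv ch pv]]].
have P := L2_ph R n.
split; [by apply: (phD P); exact: (phZ P) | by apply: (phD P); exact: (phZ P) |].
exists (fun k => c *: phi k + d *: psi k); split.
- by move=> k; apply: smooth_compactD; exact: smooth_compactZ.
- by apply: nL2_lin_cvg => // k; [have [] := smooth_L2 (s1 k) | have [] := smooth_L2 (s2 k)].
- under eq_cvg do rewrite LWderv_lin //.
  by apply: nL2_lin_cvg => // k; [have [] := smooth_L2 (s1 k) | have [] := smooth_L2 (s2 k)].
- move=> t i; rewrite (_ : (fun k => _) = fun k => c * phi k t ord0 i + d * psi k t ord0 i).
    have -> : (c *: u + d *: v) t ord0 i = c * u t ord0 i + d * v t ord0 i by rewrite !mxE.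
    by apply: cvgD; (apply: cvgM; first exact: cvg_cst); [exact: pu | exact: pv].
  by apply/funext => k; rewrite !mxE.
Qed.

Lemma nL2_cvg (u_ : nat -> vfun) u : (forall k, L2 (u_ k)) -> L2 u ->
  nL2 (u_ k - u) @[k --> \oo] --> (0 : R) -> nL2 (u_ k) ^+ 2 @[k --> \oo] --> nL2 u ^+ 2.
Proof.
move=> Lu_ Lu cu; have P := L2_ph R n.
have h : nL2 (u_ k) @[k --> \oo] --> nL2 u.
  apply/cvgrPdist_le => e e0; move/cvgrPdist_le: cu => /(_ e e0).
  apply: filterS => k; rewrite sub0r normrN ger0_norm ?nrm_ge0// => h.
  have LB := L2B (Lu_ k) Lu; apply: le_trans h.
  have h1 := nrmD P LB Lu; rewrite subrK in h1.
  have h2 := nrmB P (Lu_ k) LB; rewrite opprB addrC subrK in h2.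
  by rewrite ler_norml /nL2; apply/andP; split; lra.
exact: (cvgM h h).
Qed.

Lemma sqnorm_cvg (z_ : nat -> 'rV[R]_n) (z : 'rV[R]_n) :
  (forall i, z_ k ord0 i @[k --> \oo] --> z ord0 i) -> sqnorm (z_ k) @[k --> \oo] --> sqnorm z.
Proof.
move=> cz; rewrite /sqnorm /dotv; apply: cvg_big => [|i _]; first exact: add_continuous.
by apply: cvgM; exact: cz.
Qed.

(** Both sides pass to the limit from [smooth_bounds]: the left because the test functions converge
    at every point, the right because their L^2 norms converge. *)
Lemma HS_bounds u g : HS u g -> forall x,
  sqnorm (u x) <= 2 * nL2 u ^+ 2 + 2 * fracC a * nL2 g ^+ 2 /\
  forall h, 0 < h -> sqnorm (u (x + h) - u x) <= fracC a * h `^ (2 * a - 1) * nL2 g ^+ 2.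
Proof.
move=> [Lu Lg [phi [s cu cg pu]]] x.
have L1 k : L2 (phi k) by have [] := smooth_L2 (s k).
have L2' k : L2 (LWderv a (phi k)) by have [] := smooth_L2 (s k).
have n1 := nL2_cvg L1 Lu cu; have n2 := nL2_cvg L2' Lg cg.
split.
  have A : sqnorm (phi k x) @[k --> \oo] --> sqnorm (u x).
    by apply: (@sqnorm_cvg (fun k => phi k x)) => i; exact: pu.
  have B : 2 * nL2 (phi k) ^+ 2 + 2 * fracC a * nL2 (LWderv a (phi k)) ^+ 2 @[k --> \oo] -->
      2 * nL2 u ^+ 2 + 2 * fracC a * nL2 g ^+ 2.
    by apply: cvgD; (apply: cvgM; first exact: cvg_cst); [exact: n1 | exact: n2].
  by apply: (ler_cvg_to A B); apply: nearW => k; have [] := smooth_bounds (s k) x.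
move=> h h0.
have A : sqnorm (phi k (x + h) - phi k x) @[k --> \oo] --> sqnorm (u (x + h) - u x).
  apply: (@sqnorm_cvg (fun k => phi k (x + h) - phi k x)) => i.
  rewrite (_ : (fun k => _) = fun k => phi k (x + h) ord0 i - phi k x ord0 i).
    have -> : (u (x + h) - u x) ord0 i = u (x + h) ord0 i - u x ord0 i by rewrite !mxE.
    by apply: cvgB; exact: pu.
  by apply/funext => k; rewrite !mxE.
have B : fracC a * h `^ (2 * a - 1) * nL2 (LWderv a (phi k)) ^+ 2 @[k --> \oo] -->
    fracC a * h `^ (2 * a - 1) * nL2 g ^+ 2.
  by apply: cvgM; [exact: cvg_cst | exact: n2].
by apply: (ler_cvg_to A B); apply: nearW => k; have [_] := smooth_bounds (s k) x; exact.
Qed.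

End Smooth.

(** * Continuous representatives *)

Section Repr.
Variables (R : realType) (n : nat).
Local Notation mu := (@lebesgue_measure R).
Local Notation vfun := (R -> 'rV[R]_n).

Lemma Ig0_ae (f : R -> R) : integ f -> (forall x, 0 <= f x) -> Ig f <= 0 -> {ae mu, forall x, f x = 0}.
Proof.
move=> fi f0 If.
have mf : measurable_fun setT (EFin \o f) := measurable_int mu fi.
have E : (\int[mu]_x `|(EFin \o f) x| = 0)%E.
  rewrite (_ : (\int[mu]_x _)%E = (\int[mu]_x (f x)%:E)%E); last first.
    by apply: eq_integral => x _ /=; rewrite ger0_norm.
  by rewrite (integ_fin fi); congr (_%:E); apply: le_anti; rewrite If Ig_ge0.
have := (ae_eq_integral_abs mu measurableT mf).1 E.
by apply: (@filterS _ _ (ae_filter_ringOfSetsType mu)) => x /(_ I) [].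
Qed.

Lemma nL2_ge0 (u : vfun) : 0 <= nL2 u. Proof. exact: nrm_ge0. Qed.

Lemma nL2_tri (u v w : vfun) : L2 u -> L2 v -> L2 w -> nL2 (u - v) <= nL2 (u - w) + nL2 (v - w).
Proof.
move=> Lu Lv Lw; have P := L2_ph R n.
have -> : u - v = (u - w) - (v - w) by rewrite opprB addrA subrK.
exact: (nrmB P (L2B Lu Lw) (L2B Lv Lw)).
Qed.

Variable a : R.
Hypotheses (a0 : 1 / 2 < a) (a1 : a < 1).

Lemma HSB u g v h : HS a u g -> HS a v h -> @HS R n a (u - v) (g - h).
Proof.
by move=> Hu Hv; have := HS_lin a0 a1 1 (-1) Hu Hv; rewrite !scale1r !scaleN1r.
Qed.

Lemma pointwise_lim (u : nat -> vfun) :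
  (forall e : R, 0 < e -> exists N, forall j k, (N <= j)%N -> (N <= k)%N ->
     forall t, sqnorm (u j t - u k t) <= e) ->
  exists v : vfun, (forall t i, u k t ord0 i @[k --> \oo] --> v t ord0 i).
Proof.
move=> uC; exists (fun t => \row_i lim (u k t ord0 i @[k --> \oo])) => t i; rewrite mxE.
apply: real_cauchy_cvg => e e0; have [N HN] := uC (e ^+ 2) (ltac:(rewrite exprn_gt0//)).
exists N => j k Nj Nk; rewrite -ler_sqr ?nnegrE ?(ltW e0)// real_normK ?num_real//.
apply: le_trans (HN j k Nj Nk t).
by have := coord_sqnorm (u j t - u k t) i; rewrite !mxE.
Qed.

(** The sup bound makes the approximating test functions uniformly Cauchy, so they converge
    everywhere; Fatou identifies the limit with [v] almost everywhere. *)
Lemma Halpha_repr (v h : vfun) : Halpha_der a v h ->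
  exists2 u : vfun, HS a u h & {ae mu, forall t, v t = u t}.
Proof.
move=> [/L2funP Lv [/L2funP Lh [phi [s [cv ch]]]]].
have Lp k : L2 (phi k) by have [] := smooth_L2 a0 a1 (s k).
have Ld k : L2 (LWderv a (phi k)) by have [] := smooth_L2 a0 a1 (s k).
move/(nL2_cvgP Lp Lv) in cv; move/(nL2_cvgP Ld Lh) in ch.
have P := L2_ph R n; have F0 := fracC_ge0 a0 a1.
have [|u pu] := @pointwise_lim phi.
  (* Both squared L^2 differences are at most 4 e1^2, so [HS_bounds] bounds the squared sup
     difference by (8 + 8 fracC a) e1^2 = e. *)
  move=> e e0; pose e1 := Num.sqrt (e / (8 + 8 * fracC a)).
  have d0 : 0 < 8 + 8 * fracC a by rewrite ltr_wpDr// mulr_ge0.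
  have e10 : 0 < e1 by rewrite sqrtr_gt0 divr_gt0.
  have e1E : e1 ^+ 2 * (8 + 8 * fracC a) = e.
    by rewrite sqr_sqrtr ?divfK ?gt_eqF// divr_ge0// ltW.
  clearbody e1.
  move/cvgrPdist_le: cv => /(_ _ e10) [N1 _ HN1].
  move/cvgrPdist_le: ch => /(_ _ e10) [N2 _ HN2].
  exists (maxn N1 N2) => j k; rewrite !geq_max => /andP[j1 j2] /andP[k1 k2] t.
  have [b _] := HS_bounds a0 a1 (HSB (HS_smooth a0 a1 (s j)) (HS_smooth a0 a1 (s k))) t.
  apply: (le_trans b).
  have A (w_ : nat -> vfun) w : (forall k, L2 (w_ k)) -> L2 w -> `|0 - nL2 (w_ j - w)| <= e1 ->
      `|0 - nL2 (w_ k - w)| <= e1 -> nL2 (w_ j - w_ k) ^+ 2 <= 4 * e1 ^+ 2.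
    move=> Lw_ Lw; rewrite !sub0r !normrN !ger0_norm ?nL2_ge0// => h1 h2.
    have h3 : nL2 (w_ j - w_ k) <= 2 * e1.
      have := nL2_tri (Lw_ j) (Lw_ k) Lw; move: (nL2 _) (nL2 _) (nL2 _) h1 h2 => x y z *; lra.
    have := nL2_ge0 (w_ j - w_ k); move: (nL2 _) h3 => x *; nra.
  have := A _ _ Lp Lv (HN1 _ j1) (HN1 _ k1); have := A _ _ Ld Lh (HN2 _ j2) (HN2 _ k2).
  move=> B1 B2; have := ler_wpM2l F0 B1; lra.
have mphi k i : measurable_fun setT (fun t => phi k t ord0 i) := (Lp k).1 i.
have mu1 i : measurable_fun setT (fun t => u t ord0 i).
  by apply: (@measurable_fun_cvg _ _ R setT (fun k t => phi k t ord0 i)).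
have FT (e : R) : 0 < e -> integ (fun t => sqnorm (u t - v t)) /\ Ig (fun t => sqnorm (u t - v t)) <= e.
  move=> e0; apply: (@Fatou_Ig _ (fun k t => sqnorm (phi k t - v t))).
  - by move=> k; have [] := L2B (Lp k) Lv.
  - by move=> k t; exact: sqnorm_ge0.
  - have se : 0 < Num.sqrt e by rewrite sqrtr_gt0.
    move/cvgrPdist_le: cv => /(_ _ se); apply: filterS => k.
    rewrite sub0r normrN ger0_norm ?nL2_ge0// => hk.
    have := nL2_sqr (L2B (Lp k) Lv) => <-.
    by rewrite -[leRHS]sqr_sqrtr ?(ltW e0)// ler_sqr ?nnegrE ?nL2_ge0 ?sqrtr_ge0.
  - move=> t; apply: (@sqnorm_cvg _ _ (fun k => phi k t - v t)) => i.
    rewrite (_ : (fun k => _) = fun k => phi k t ord0 i - v t ord0 i).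
      have -> : (u t - v t) ord0 i = u t ord0 i - v t ord0 i by rewrite !mxE.
      by apply: cvgB; [exact: pu | exact: cvg_cst].
    by apply/funext => k; rewrite !mxE.
have [iuv _] := FT 1 ltr01.
have Luv : L2 (u - v).
  split => // i; rewrite (_ : (fun t => _) = fun t => u t ord0 i - v t ord0 i).
    by apply: measurable_funB => //; exact: (Lv.1 i).
  by apply/funext => t; rewrite !mxE.
have Iuv : Ig (fun t => sqnorm (u t - v t)) <= 0.
  by apply/ler_addgt0Pr => e e0; rewrite add0r; have [] := FT e e0.
have Lu : L2 u by have := phD P Luv Lv; rewrite subrK.
have n0 : nL2 (u - v) = 0.
  apply/eqP; rewrite -sqrf_eq0 (nL2_sqr Luv) eq_le Iuv Ig_ge0// => t.
  exact: sqnorm_ge0.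
exists u.
  split; [exact: Lu | exact: Lh | exists phi; split; [exact: s | | exact: ch | exact: pu]].
  apply: (@squeeze_cvgr _ _ _ _ (fun=> 0) _ _ _ _ _ cv); last exact: cvg_cst.
  apply: nearW => k; rewrite nL2_ge0 /=.
  by have := nL2_tri (Lp k) Lu Lv; rewrite n0 addr0.
have := Ig0_ae iuv (fun t => sqnorm_ge0 _) Iuv.
apply: (@filterS _ _ (ae_filter_ringOfSetsType mu)) => t /eqP.
by rewrite sqnorm_eq0 subr_eq0 => /eqP.
Qed.

End Repr.

(** * Quadratic forms of symmetric matrices *)

Section Qform.
Variables (R : realType) (n : nat).
Implicit Types (A : 'M[R]_n) (x y z : 'rV[R]_n).

Lemma qformDl A x y z : qform A (x + y) z = qform A x z + qform A y z.
Proof.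
rewrite /qform -big_split; apply: eq_bigr => i _; rewrite -big_split; apply: eq_bigr => j _.
rewrite mxE /=; ring.
Qed.

Lemma qformZl A c x y : qform A (c *: x) y = c * qform A x y.
Proof.
rewrite /qform mulr_sumr; apply: eq_bigr => i _; rewrite mulr_sumr; apply: eq_bigr => j _.
rewrite mxE; ring.
Qed.

Lemma qformC A x y : A^T = A -> qform A x y = qform A y x.
Proof.
move=> sA; rewrite /qform exchange_big; apply: eq_bigr => i _; apply: eq_bigr => j _.
rewrite -[in LHS]sA mxE; ring.
Qed.

Lemma qformDr A x y z : A^T = A -> qform A z (x + y) = qform A z x + qform A z y.
Proof. by move=> sA; rewrite qformC // qformDl !(qformC z). Qed.

Lemma qformZr A c x y : A^T = A -> qform A y (c *: x) = c * qform A y x.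
Proof. by move=> sA; rewrite qformC // qformZl qformC. Qed.

Lemma qform0 A y : qform A 0 y = 0.
Proof. by rewrite -(scale0r (0 : 'rV[R]_n)) qformZl mul0r. Qed.

Lemma qform_le A x y : A^T = A -> (forall z, 0 <= qform A z z) ->
  `|qform A x y| <= qform A x x + qform A y y.
Proof.
move=> sA pA.
have h1 := pA (x + y); have h2 := pA (x - y).
rewrite -scaleN1r in h2.
rewrite !(qformDl, qformDr, qformZl, qformZr) // (qformC y x) // in h1 h2.
have := pA x; have := pA y; rewrite ler_norml => h3 h4; apply/andP; split; lra.
Qed.

Lemma qformD_le A x y : A^T = A -> (forall z, 0 <= qform A z z) ->
  qform A (x + y) (x + y) <= 2 * qform A x x + 2 * qform A y y.
Proof.
move=> sA pA; have := qform_le x y sA pA; rewrite ler_norml => /andP[_ h].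
have h2 := pA (x - y); rewrite -scaleN1r in h2.
rewrite !(qformDl, qformDr, qformZl, qformZr) // (qformC y x) // in h2 *; lra.
Qed.

End Qform.

(** * Subsequences converging on a countable set *)

Section Subsequence.
Variables (R : realType) (n : nat).
Local Notation vfun := (R -> 'rV[R]_n).

(* A cluster point in the product topology (Tychonoff) replaces a diagonal extraction. *)
Lemma bounded_subseq (v : nat -> nat -> 'rV[R]_n) (K : R) : (forall k i, enorm (v k i) <= K) ->
  exists f : nat -> 'rV[R]_n, exists s : nat -> nat, forall j, (j <= s j)%N /\
    forall i, (i <= j)%N -> `|v (s j) i - f i| <= harmonic j.
Proof.
move=> vK; pose F : set_system (forall i : nat, 'rV[R]_n) := fmap v \oo.
have c := @tychonoff nat (fun=> 'rV[R]_n) _ (fun _ => @compact_box R n K).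
have [|f [_ fF]] := c F _.
  by exists 0%N => // k _ i; exact: in_box.
exists f.
suff A j : exists k, (j <= k)%N /\ forall i, (i <= j)%N -> `|v k i - f i| <= harmonic j.
  by have [s Hs] := choice A; exists s.
have h0 : (0 : R) < harmonic j by rewrite /harmonic /= invr_gt0.
have N1 : F [set w | exists2 k, (j <= k)%N & w = v k].
  by exists j => // k /= jk; exists k.
(* A neighbourhood in the product may constrain only finitely many coordinates, here those with i <=
   j. *)
have N2 : nbhs f [set w : forall i : nat, 'rV[R]_n | forall i : 'I_j.+1, `|w i - f i| <= harmonic j].
  apply: (@filter_forall _ _ (fun (i : 'I_j.+1) (w : forall i : nat, 'rV[R]_n) => `|w i - f i| <= harmonic j) (nbhs f) (nbhs_filter f)) => i.
  have hc : nbhs f [set w | `|proj (i : nat) f - proj (i : nat) w| <= harmonic j].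
    by move/cvgrPdist_le : (@proj_continuous nat (fun=> 'rV[R]_n) (i : nat) f) => /(_ (nbhs_filter f) _ h0).
  apply: (filterS _ hc) => w; rewrite distrC; exact.
have [w [[k jk ->] Hw]] := fF _ _ N1 N2.
by exists k; split => // i ij; have := Hw (@Ordinal j.+1 i ij).
Qed.

End Subsequence.

(** * The space X^a: embedding, completeness, local compactness of sequences *)

Section XSpace.
Variables (R : realType) (n : nat) (a : R) (L : R -> 'M[R]_n) (l : R -> R).
Variables (W : R -> 'rV[R]_n -> R) (th : R).
Local Notation mu := (@lebesgue_measure R).
Local Notation vfun := (R -> 'rV[R]_n).

Record coercive : Prop := Coercive {
  cvL : continuous L;
  cvS : forall t, (L t)^T = L t;
  cvl : continuous l;
  cvl0 : forall t, 0 < l t;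
  cvly : l t @[t --> +oo%R] --> +oo%R;
  cvlNy : l t @[t --> -oo%R] --> +oo%R;
  cvb : forall t x, l t * sqnorm x <= qform (L t) x x }.

Hypotheses (n0 : (0 < n)%N) (a0 : 1 / 2 < a) (a1 : a < 1) (H : coercive) (HW : nonlin W th).

Lemma l_large (K : R) : exists2 T : R, 0 < T & forall t, T < `|t| -> K <= l t.
Proof.
have [T1 [_ H1]] := (cvgryPge _).1 (cvly H) K.
have [T2 [_ H2]] := (cvgryPge _).1 (cvlNy H) K.
exists (`|T1| + `|T2| + 1); first by rewrite ltr_wpDl// addr_ge0.
move=> t; have n1 := normr_ge0 T1; have n2 := normr_ge0 T2.
rewrite ltr_normr => /orP[h|h].
- by apply: H1; apply: le_lt_trans (ler_norm _) _; lra.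
- apply: H2; rewrite -ltrN2; apply: le_lt_trans (_ : `|T2| < _); last by lra.
  by rewrite -normrN ler_norm.
Qed.

Lemma l_min : exists2 l0 : R, 0 < l0 & forall t, l0 <= l t.
Proof.
have [T T0 HT] := l_large 1.
have NT : - T <= T by lra.
have [c _ Hc] := @EVT_min R l (- T) T NT (continuous_subspaceT (cvl H)).
exists (Num.min 1 (l c)); first by rewrite lt_min ltr01 (cvl0 H).
move=> t; have [tT|Tt] := leP `|t| T.
  by rewrite ge_min Hc ?orbT// in_itv/= -ler_norml.
by rewrite ge_min HT.
Qed.

Lemma qform_ge0 t x : 0 <= qform (L t) x x.
Proof.
by apply: le_trans (cvb H t x); rewrite mulr_ge0 ?sqnorm_ge0// ltW// (cvl0 H).
Qed.

Lemma measurable_qform (u v : vfun) : (forall i, measurable_fun setT (fun t => u t ord0 i)) ->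
  (forall i, measurable_fun setT (fun t => v t ord0 i)) ->
  measurable_fun setT (fun t => qform (L t) (u t) (v t)).
Proof.
move=> mu1 mv1; apply: measurable_sum => i; apply: measurable_sum => j.
apply: measurable_funM => //; apply: measurable_funM => //.
apply: continuous_measurable_fun => t.
by apply: (@continuous_comp _ _ _ L (fun M : 'M[R]_n => M i j)); [exact: (cvL H) | exact: coord_continuous].
Qed.

(* X^a as the set of pairs (u, D^a u). *)
Definition SX : set (vfun * vfun) :=
  [set p | HS a p.1 p.2 /\ integ (fun t => qform (L t) (p.1 t) (p.1 t))].

Definition ipX (p q : vfun * vfun) :=
  Ig (fun t => dotv (p.2 t) (q.2 t) + qform (L t) (p.1 t) (q.1 t)).

Definition QX (p : vfun * vfun) := Ig (fun t => qform (L t) (p.1 t) (p.1 t)).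

Lemma SX_L2 p : SX p -> L2 p.1 /\ L2 p.2.
Proof. by move=> [[L1 L2' _] _]. Qed.

Lemma SX_qinteg p q : SX p -> SX q -> integ (fun t => qform (L t) (p.1 t) (q.1 t)).
Proof.
move=> Sp Sq; have [[mp _] _] := SX_L2 Sp; have [[mq _] _] := SX_L2 Sq.
apply: integ_le (measurable_qform mp mq) (integD Sp.2 Sq.2) _ => t.
by apply: qform_le; [exact: (cvS H) | exact: qform_ge0].
Qed.

Lemma SX_integ p q : SX p -> SX q ->
  integ (fun t => dotv (p.2 t) (q.2 t) + qform (L t) (p.1 t) (q.1 t)).
Proof.
move=> Sp Sq; apply: integD; last exact: SX_qinteg.
by apply: L2_integ; [have [] := SX_L2 Sp | have [] := SX_L2 Sq].
Qed.

Lemma SX_lin c d p q : SX p -> SX q -> SX (c *: p + d *: q).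
Proof.
move=> Sp Sq; split; first exact: (HS_lin a0 a1 c d Sp.1 Sq.1).
have i1 := SX_qinteg Sp Sq; have [ip iq] := (Sp.2, Sq.2).
rewrite (_ : (fun t => _) = fun t => (c ^+ 2 * qform (L t) (p.1 t) (p.1 t) +
   2 * c * d * qform (L t) (p.1 t) (q.1 t)) + d ^+ 2 * qform (L t) (q.1 t) (q.1 t)).
  by apply: integD; [apply: integD|]; exact: integZ.
apply/funext => t.
have -> : (c *: p + d *: q).1 t = c *: p.1 t + d *: q.1 t by [].
have sL := cvS H t.
rewrite !(qformDl, qformDr, qformZl, qformZr) // (qformC (q.1 t) (p.1 t)) //; ring.
Qed.

Lemma X_ph : prehilbert SX ipX.
Proof.
split.
- have z : @smooth_compact R n 0.
    split; last by exists 0.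
    move=> i k x; rewrite (_ : (fun t => (0 : vfun) t ord0 i) = cst 0); last first.
      by apply/funext => t; rewrite mxE.
    have -> : derive1n k (cst 0 : R -> R) = cst 0; last exact: derivable_cst.
    by elim: k => [//|k IH]; apply/funext => t; rewrite derive1nS IH derive1_cst.
  have h := HS_lin a0 a1 0 0 (HS_smooth a0 a1 z) (HS_smooth a0 a1 z).
  rewrite !scale0r !addr0 in h; split => //.
  rewrite (_ : (fun t => _) = fun=> 0); first exact: integrable0.
  by apply/funext => t; rewrite qform0.
- by move=> p q Sp Sq; have := SX_lin 1 1 Sp Sq; rewrite !scale1r.
- by move=> c p Sp; have := SX_lin c 0 Sp Sp; rewrite scale0r addr0.
- move=> p q _ _; apply: eq_Ig => t; rewrite dotvC qformC //; exact: (cvS H).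
- move=> p q r Sp Sq Sr; rewrite /ipX -(IgD (SX_integ Sp Sr) (SX_integ Sq Sr)).
  by apply: eq_Ig => t; rewrite dotvDl qformDl addrACA.
- move=> c p q Sp Sq; rewrite /ipX -(IgZ c (SX_integ Sp Sq)).
  by apply: eq_Ig => t; rewrite dotvZl qformZl mulrDr.
- move=> p _; apply: Ig_ge0 => t; rewrite addr_ge0 ?qform_ge0//; exact: sqnorm_ge0.
Qed.

Definition nX p := nrm ipX p.

Lemma nX_ge0 p : 0 <= nX p. Proof. exact: nrm_ge0. Qed.

Lemma QX_ge0 p : 0 <= QX p. Proof. by apply: Ig_ge0 => t; exact: qform_ge0. Qed.

Lemma nX_sqr p : SX p -> nX p ^+ 2 = nL2 p.2 ^+ 2 + QX p.
Proof.
move=> Sp; have [_ Lg] := SX_L2 Sp.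
rewrite /nX (nrm_sqr X_ph Sp) (nL2_sqr Lg) /QX -(IgD _ Sp.2) //; by case: Lg.
Qed.

Lemma QX_le p : SX p -> QX p <= nX p ^+ 2.
Proof. by move=> Sp; rewrite (nX_sqr Sp) lerDr sqr_ge0. Qed.

Lemma nL2g_le p : SX p -> nL2 p.2 ^+ 2 <= nX p ^+ 2.
Proof. by move=> Sp; rewrite (nX_sqr Sp) lerDl QX_ge0. Qed.

(** The term with l0 comes from l0 |u|^2 <= (L u, u), where l0 is a positive lower bound of l;
    everything else is [HS_bounds]. *)
Lemma X_embed : exists2 C : R, 0 < C & forall p, SX p ->
  [/\ nL2 p.1 ^+ 2 <= C * nX p ^+ 2, forall t, sqnorm (p.1 t) <= C * nX p ^+ 2 &
   forall t h, 0 < h -> sqnorm (p.1 (t + h) - p.1 t) <= C * h `^ (2 * a - 1) * nX p ^+ 2].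
Proof.
have [l0 l00 Hl] := l_min; have F0 := fracC_ge0 a0 a1.
have i0 : 0 < l0^-1 by rewrite invr_gt0.
exists (2 * l0^-1 + 2 * fracC a); first by apply: ltr_wpDr; [rewrite mulr_ge0 | rewrite mulr_gt0].
move=> p Sp; have [Lu Lg] := SX_L2 Sp.
have N0 : 0 <= nX p ^+ 2 by exact: sqr_ge0.
have u2 : nL2 p.1 ^+ 2 <= l0^-1 * nX p ^+ 2.
  apply: le_trans (ler_wpM2l (ltW i0) (QX_le Sp)).
  rewrite (nL2_sqr Lu) /QX -(IgZ _ Sp.2).
  apply: Ig_le; [by case: Lu | exact: (integZ _ Sp.2) | move=> t].
  rewrite mulrC ler_pdivlMr // mulrC; apply: le_trans (cvb H t _).
  by rewrite ler_wpM2r ?sqnorm_ge0.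
have g2 := nL2g_le Sp.
have FN : 0 <= fracC a * nX p ^+ 2 by rewrite mulr_ge0.
have IN : 0 <= l0^-1 * nX p ^+ 2 by rewrite mulr_ge0 ?(ltW i0).
have Fg : fracC a * nL2 p.2 ^+ 2 <= fracC a * nX p ^+ 2 by rewrite ler_wpM2l.
split.
- by move: (nX p ^+ 2) (nL2 _ ^+ 2) N0 u2 FN IN {g2 Fg} => x y *; lra.
- move=> t; have [b _] := HS_bounds a0 a1 Sp.1 t; apply: (le_trans b).
  move: (nX p ^+ 2) (nL2 p.1 ^+ 2) (nL2 p.2 ^+ 2) u2 FN IN Fg {N0 g2 b} => x y z *; lra.
- move=> t h h0; have [_ /(_ h h0) b] := HS_bounds a0 a1 Sp.1 t; apply: (le_trans b).
  have P := powR_ge0 h (2 * a - 1).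
  rewrite mulrAC [leRHS]mulrAC; apply: ler_wpM2r => //; apply: (le_trans Fg).
  rewrite mulrDl; move: (nX p ^+ 2) FN IN {N0 g2 u2 Fg b} => x *; lra.
Qed.

(** A test function is chosen within 1 / (k + 1) of the k-th pair in both L^2 norms. The sup bound
    makes the two close at every point as well, which yields the everywhere convergence built into
    [HS]. *)
Lemma HS_closed (u_ g_ : nat -> vfun) u g : (forall k, HS a (u_ k) (g_ k)) -> L2 u -> L2 g ->
  nL2 (u_ k - u) @[k --> \oo] --> (0 : R) -> nL2 (g_ k - g) @[k --> \oo] --> (0 : R) ->
  (forall t i, u_ k t ord0 i @[k --> \oo] --> u t ord0 i) -> HS a u g.
Proof.
move=> Hk Lu Lg cu cg pu; split => //.
have P := L2_ph R n; have F0 := fracC_ge0 a0 a1.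
have A k : exists phi : vfun, [/\ smooth_compact phi, nL2 (phi - u_ k) <= harmonic k &
    nL2 (LWderv a phi - g_ k) <= harmonic k].
  have [_ _ [phi [s c1 c2 _]]] := Hk k.
  have h0 : (0 : R) < harmonic k by rewrite /harmonic /= invr_gt0.
  move/cvgrPdist_le: c1 => /(_ _ h0) [N1 _ HN1].
  move/cvgrPdist_le: c2 => /(_ _ h0) [N2 _ HN2].
  exists (phi (maxn N1 N2)); split => //.
  - by have := HN1 _ (leq_maxl N1 N2); rewrite sub0r normrN ger0_norm ?nL2_ge0.
  - by have := HN2 _ (leq_maxr N1 N2); rewrite sub0r normrN ger0_norm ?nL2_ge0.
have {A} [phi Hphi] := choice A.
have s k : smooth_compact (phi k) by have [] := Hphi k.
have Lp k : L2 (phi k) by have [] := smooth_L2 a0 a1 (s k).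
have Ld k : L2 (LWderv a (phi k)) by have [] := smooth_L2 a0 a1 (s k).
have Lu_ k : L2 (u_ k) by have [] := Hk k.
have Lg_ k : L2 (g_ k) by have [] := Hk k.
have C (w_ v_ : nat -> vfun) w : (forall k, L2 (w_ k)) -> (forall k, L2 (v_ k)) -> L2 w ->
    (forall k, nL2 (v_ k - w_ k) <= harmonic k) ->
    nL2 (w_ k - w) @[k --> \oo] --> (0 : R) -> nL2 (v_ k - w) @[k --> \oo] --> (0 : R).
  move=> Lw_ Lv_ Lw h c.
  have c2 : harmonic k + nL2 (w_ k - w) @[k --> \oo] --> (0 : R).
    by have := cvgD (@cvg_harmonic R) c; rewrite addr0; exact.
  apply: (@squeeze_cvgr _ _ _ _ (fun=> 0) _ _ _ _ _ c2); last exact: cvg_cst.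
  apply: nearW => k; rewrite nL2_ge0 /=; apply: le_trans (_ : nL2 (v_ k - w_ k) + nL2 (w_ k - w) <= _).
    have -> : v_ k - w = (v_ k - w_ k) + (w_ k - w) by rewrite addrA subrK.
    by apply: (nrmD P); exact: L2B.
  by rewrite lerD2r; exact: h.
exists phi; split; first exact: s.
- by apply: (C u_) => // k; have [] := Hphi k.
- by apply: (C g_) => // k; have [] := Hphi k.
- move=> t i.
  have c0 : phi k t ord0 i - u_ k t ord0 i @[k --> \oo] --> (0 : R).
    pose K := Num.sqrt (2 + 2 * fracC a).
    have K2 : K ^+ 2 = 2 + 2 * fracC a by rewrite sqr_sqrtr// addr_ge0// mulr_ge0.
    have K0 : 0 <= K by exact: sqrtr_ge0.
    clearbody K.
    have c2 : K * harmonic k @[k --> \oo] --> K * 0 by apply: cvgM; [exact: cvg_cst | exact: cvg_harmonic].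
    rewrite mulr0 in c2.
    have c3 : - (K * harmonic k) @[k --> \oo] --> (0 : R) by have := cvgN c2; rewrite oppr0; exact.
    apply: (@squeeze_cvgr _ _ _ _ _ _ _ _ _ c3 c2).
    apply: nearW => k; rewrite -ler_norml.
    have [_ h1 h2] := Hphi k.
    have h0 : (0 : R) <= harmonic k by rewrite /harmonic /= invr_ge0.
    rewrite -ler_sqr ?nnegrE ?mulr_ge0// real_normK ?num_real// exprMn K2.
    have := coord_sqnorm ((phi k - u_ k) t) i; rewrite !mxE => /le_trans; apply.
    have [b _] := HS_bounds a0 a1 (HSB a0 a1 (HS_smooth a0 a1 (s k)) (Hk k)) t.
    apply: (le_trans b).
    have E1 : nL2 (phi k - u_ k) ^+ 2 <= harmonic k ^+ 2 by rewrite ler_sqr ?nnegrE ?nL2_ge0.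
    have E2 : nL2 (LWderv a (phi k) - g_ k) ^+ 2 <= harmonic k ^+ 2 by rewrite ler_sqr ?nnegrE ?nL2_ge0.
    have E3 := ler_wpM2l F0 E2.
    move: (harmonic k ^+ 2) (nL2 _ ^+ 2) (nL2 _ ^+ 2) E1 E3 {b h1 h2 E2} => x y z *; lra.
  have c4 : (phi k t ord0 i - u_ k t ord0 i) + u_ k t ord0 i @[k --> \oo] --> 0 + u t ord0 i.
    exact: (cvgD c0 (pu t i)).
  rewrite add0r in c4; move: c4.
  by rewrite (_ : (fun k => _ + _) = fun k => phi k t ord0 i)//; apply/funext => k; rewrite subrK.
Qed.

Lemma qform_cvg (A : 'M[R]_n) (z_ : nat -> 'rV[R]_n) (z : 'rV[R]_n) :
  (forall i, z_ k ord0 i @[k --> \oo] --> z ord0 i) -> qform A (z_ k) (z_ k) @[k --> \oo] --> qform A z z.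
Proof.
move=> cz; rewrite /qform; apply: cvg_big => [|i _]; first exact: add_continuous.
apply: cvg_big => [|j _]; first exact: add_continuous.
by apply: cvgM; [apply: cvgM; [exact: cvg_cst | exact: cz] | exact: cz].
Qed.

(** Because L is unbounded, L^2 convergence does not control the weighted part; there Fatou is
    applied to p_k - p_j with k fixed and j tending to infinity. *)
Lemma X_complete (p_ : nat -> vfun * vfun) : (forall k, SX (p_ k)) ->
  (forall e : R, 0 < e -> exists N, forall j k, (N <= j)%N -> (N <= k)%N -> nX (p_ j - p_ k) <= e) ->
  exists2 p, SX p & forall e : R, 0 < e -> exists N, forall k, (N <= k)%N -> nX (p_ k - p) <= e.
Proof.
move=> Sp pC; have P := X_ph.
have SB j k : SX (p_ j - p_ k) := phB P (Sp j) (Sp k).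
have Lu k : L2 (p_ k).1 by have [] := SX_L2 (Sp k).
have Lg k : L2 (p_ k).2 by have [] := SX_L2 (Sp k).
have [C C0 HC] := X_embed.
have sC (e : R) : 0 < e -> exists N, forall j k, (N <= j)%N -> (N <= k)%N -> nX (p_ j - p_ k) ^+ 2 <= e.
  move=> e0; have [N HN] := pC (Num.sqrt e) (ltac:(rewrite sqrtr_gt0//)).
  exists N => j k Nj Nk; rewrite -[leRHS]sqr_sqrtr ?(ltW e0)//.
  by rewrite ler_sqr ?nnegrE ?nX_ge0 ?sqrtr_ge0 ?HN.
have [|u pu] := @pointwise_lim R n (fun k => (p_ k).1).
  move=> e e0; have [N HN] := sC (C^-1 * e) (ltac:(rewrite mulr_gt0 ?invr_gt0//)).
  exists N => j k Nj Nk t; have [_ /(_ t) h _] := HC _ (SB j k); apply: (le_trans h).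
  by have := HN j k Nj Nk; rewrite mulrC ler_pdivlMr // mulrC.
have [|g Lg' cg] := L2_complete Lg.
  move=> e e0; have [N HN] := pC e e0; exists N => j k Nj Nk.
  apply: le_trans (HN j k Nj Nk); rewrite -ler_sqr ?nnegrE ?nX_ge0 ?nL2_ge0//.
  exact: (nL2g_le (SB j k)).
have FT (e : R) : 0 < e -> exists N, forall k, (N <= k)%N ->
    [/\ integ (fun t => sqnorm ((p_ k).1 t - u t)), Ig (fun t => sqnorm ((p_ k).1 t - u t)) <= C * e,
      integ (fun t => qform (L t) ((p_ k).1 t - u t) ((p_ k).1 t - u t)) &
      Ig (fun t => qform (L t) ((p_ k).1 t - u t) ((p_ k).1 t - u t)) <= e].
  move=> e0; have [N HN] := sC e e0; exists N => k Nk.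
  have cw t i : ((p_ k).1 t - (p_ j).1 t) ord0 i @[j --> \oo] --> ((p_ k).1 t - u t) ord0 i.
    rewrite (_ : (fun j => _) = fun j => (p_ k).1 t ord0 i - (p_ j).1 t ord0 i).
      have -> : ((p_ k).1 t - u t) ord0 i = (p_ k).1 t ord0 i - u t ord0 i by rewrite !mxE.
      by apply: cvgB; [exact: cvg_cst | exact: pu].
    by apply/funext => j; rewrite !mxE.
  have [i1 b1] : integ (fun t => sqnorm ((p_ k).1 t - u t)) /\ Ig (fun t => sqnorm ((p_ k).1 t - u t)) <= C * e.
    apply: (@Fatou_Ig _ (fun j t => sqnorm ((p_ k).1 t - (p_ j).1 t))).
    - by move=> j; have [] := L2B (Lu k) (Lu j).
    - by move=> j t; exact: sqnorm_ge0.
    - exists N => // j /= Nj; have <- := nL2_sqr (L2B (Lu k) (Lu j)).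
      have [h _ _] := HC _ (SB k j); apply: (le_trans h).
      by apply: ler_wpM2l; [exact: ltW | exact: HN].
    - by move=> t; apply: (@sqnorm_cvg _ _ (fun j => (p_ k).1 t - (p_ j).1 t)); exact: cw.
  have [i2 b2] : integ (fun t => qform (L t) ((p_ k).1 t - u t) ((p_ k).1 t - u t)) /\
      Ig (fun t => qform (L t) ((p_ k).1 t - u t) ((p_ k).1 t - u t)) <= e.
    apply: (@Fatou_Ig _ (fun j t => qform (L t) ((p_ k).1 t - (p_ j).1 t) ((p_ k).1 t - (p_ j).1 t))).
    - by move=> j; have [] := SB k j.
    - by move=> j t; exact: qform_ge0.
    - exists N => // j /= Nj; apply: le_trans (HN k j Nk Nj).
      exact: (QX_le (SB k j)).
    - by move=> t; apply: (@qform_cvg _ (fun j => (p_ k).1 t - (p_ j).1 t)); exact: cw.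
  by split.
have mu1 i : measurable_fun setT (fun t => u t ord0 i).
  by apply: (@measurable_fun_cvg _ _ R setT (fun k t => (p_ k).1 t ord0 i)) => // k; have [] := Lu k.
have LB k : integ (fun t => sqnorm ((p_ k).1 t - u t)) -> L2 ((p_ k).1 - u).
  split => // i; rewrite (_ : (fun t => _) = fun t => (p_ k).1 t ord0 i - u t ord0 i).
    by apply: measurable_funB => //; exact: ((Lu k).1 i).
  by apply/funext => t; rewrite !mxE.
have [N0 HN0] := FT 1 ltr01.
have [j1 _ j2 _] := HN0 N0 (leqnn N0).
have Lu' : L2 u by have := L2B (Lu N0) (LB _ j1); rewrite opprB addrC subrK.
(* u is the difference of p_N0 and p_N0 - u, both of finite weighted norm. *)
have iq : integ (fun t => qform (L t) (u t) (u t)).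
  apply: integ_le (measurable_qform mu1 mu1) (integD (integZ 2 (Sp N0).2) (integZ 2 j2)) _ => t.
  rewrite ger0_norm ?qform_ge0//.
  have := @qformD_le _ _ (L t) ((p_ N0).1 t) (- ((p_ N0).1 t - u t)) (cvS H t) (qform_ge0 t).
  have -> : (p_ N0).1 t + - ((p_ N0).1 t - u t) = u t by rewrite opprB addrC subrK.
  by rewrite -scaleN1r qformZl (qformZr _ _ _ (cvS H t)) !mulN1r opprK.
have cu : nL2 ((p_ k).1 - u) @[k --> \oo] --> (0 : R).
  apply/cvgrPdist_le => e e0.
  have [N HN] := FT (C^-1 * e ^+ 2) (ltac:(rewrite mulr_gt0 ?invr_gt0// exprn_gt0//)).
  exists N => // k /= Nk; rewrite sub0r normrN ger0_norm ?nL2_ge0//.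
  have [i1 b1 _ _] := HN k Nk.
  rewrite -ler_sqr ?nnegrE ?(ltW e0) ?nL2_ge0//.
  have -> := nL2_sqr (LB k i1); apply: (le_trans b1).
  by rewrite mulrA divff ?mul1r// gt_eqF.
have Sq : SX (u, g).
  split; last exact: iq.
  apply: (@HS_closed (fun k => (p_ k).1) (fun k => (p_ k).2) u g _ Lu' Lg' cu cg pu).
  by move=> k; have [] := Sp k.
exists (u, g) => // e e0.
have e2 : 0 < e / 2 by rewrite divr_gt0.
move/cvgrPdist_le: cg => /(_ _ e2) [N1 _ HN1].
have [N2 HN2] := FT (e ^+ 2 / 4) (ltac:(rewrite divr_gt0// exprn_gt0//)).
exists (maxn N1 N2) => k; rewrite geq_max => /andP[k1 k2].
rewrite -ler_sqr ?nnegrE ?(ltW e0) ?nX_ge0//.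
rewrite (nX_sqr (phB P (Sp k) Sq)).
have [_ _ _ b2] := HN2 k k2.
have := HN1 k k1; rewrite sub0r normrN ger0_norm ?nL2_ge0// => b1.
have b3 : nL2 ((p_ k).2 - g) ^+ 2 <= e ^+ 2 / 4.
  apply: le_trans (_ : (e / 2) ^+ 2 <= _); first by rewrite ler_sqr ?nnegrE ?nL2_ge0 ?(ltW e2).
  by rewrite expr_div_n; lra.
have E2 := sqr_ge0 e.
apply: le_trans (lerD b3 b2) _; move: (e ^+ 2) E2 => x *; lra.
Qed.

Lemma X_bounds : exists2 c : R, 0 < c & forall p, SX p ->
  nL2 p.1 <= c * nX p /\ forall t, enorm (p.1 t) <= c * nX p.
Proof.
have [C C0 HC] := X_embed.
exists (Num.sqrt C); first by rewrite sqrtr_gt0.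
move=> p Sp; have [b1 b2 _] := HC p Sp.
have cE : (Num.sqrt C * nX p) ^+ 2 = C * nX p ^+ 2 by rewrite exprMn sqr_sqrtr// ltW.
have c0 : 0 <= Num.sqrt C * nX p by rewrite mulr_ge0 ?sqrtr_ge0 ?nX_ge0.
split=> [|t]; rewrite -ler_sqr ?nnegrE ?nL2_ge0 ?enorm_ge0// cE ?enorm_sqr.
  exact: b1.
exact: b2.
Qed.

Lemma X_modulus (B eta : R) : 0 < eta -> exists2 h0 : R, 0 < h0 & forall p, SX p -> nX p <= B ->
  forall t h, 0 <= h <= h0 -> enorm (p.1 (t + h) - p.1 t) <= eta.
Proof.
move=> eta0; have [C C0 HC] := X_embed.
(* The root of (C B^2 + 1) h^(2a-1) = eta^2; the summand 1 avoids a division by zero. *)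
pose h0 := (eta ^+ 2 / (C * B ^+ 2 + 1)) `^ (2 * a - 1)^-1.
have CB : 0 < C * B ^+ 2 + 1 by rewrite ltr_wpDl// mulr_ge0 ?sqr_ge0 ?(ltW C0).
have h00 : 0 < h0 by apply: powR_gt0; rewrite divr_gt0 ?exprn_gt0.
have a2 : 0 < 2 * a - 1 by have := a0; lra.
exists h0 => // p Sp pB t h /andP[].
have B0 : 0 <= B by apply: le_trans pB; exact: nX_ge0.
rewrite le_eqVlt => /orP[/eqP <- _|hp hh].
  by rewrite addr0 subrr enorm0 ltW.
rewrite -ler_sqr ?nnegrE ?enorm_ge0 ?(ltW eta0)// enorm_sqr.
have [_ _ /(_ t h hp) b] := HC _ Sp; apply: (le_trans b).
have h1 : h `^ (2 * a - 1) <= eta ^+ 2 / (C * B ^+ 2 + 1).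
  apply: le_trans (_ : h0 `^ (2 * a - 1) <= _).
    by apply: ge0_ler_powR => //; rewrite ?nnegrE; apply: ltW.
  by rewrite /h0 -powRrM mulVf ?gt_eqF// powRr1// divr_ge0 ?sqr_ge0// ltW.
have P := powR_ge0 h (2 * a - 1).
rewrite mulrAC; apply: le_trans (_ : C * B ^+ 2 * h `^ (2 * a - 1) <= _).
  apply: ler_wpM2r => //; apply: ler_wpM2l; first exact: ltW.
  by rewrite ler_sqr ?nnegrE ?nX_ge0.
rewrite ler_pdivlMr// mulrC in h1; apply: le_trans h1.
by apply: ler_wpM2r => //; rewrite lerDl.
Qed.

Lemma SX_cont p : SX p -> continuous p.1.
Proof.
move=> Sp t; apply/cvgrPdist_le => e e0.
have [h0 h00 Hh] := X_modulus (nX p) e0.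
apply/nbhs_ballP; exists h0 => //= s; rewrite /ball /= => /ltW; rewrite ler_norml => /andP[x1 x2].
apply: le_trans (norm_le_enorm _) _.
have [st|ts] := leP s t.
  have := Hh p Sp (lexx _) s (t - s); rewrite [s + _]addrC subrK; apply.
  by rewrite subr_ge0 st.
have := Hh p Sp (lexx _) t (s - t); rewrite [t + _]addrC subrK /enorm -sqnormN opprB; apply.
by rewrite subr_ge0 ltW//= -lerN2 opprB.
Qed.

(* Convergence on the rational grid i/(m+1) - m spreads to |t| <= T by the common Hoelder modulus. *)
Lemma X_compact (p_ : nat -> vfun * vfun) (B : R) : (forall k, SX (p_ k)) ->
  (forall k, nX (p_ k) <= B) ->
  exists2 s : nat -> nat, (forall j, (j <= s j)%N) &
    forall T eta : R, 0 < eta -> exists N, forall j k, (N <= j)%N -> (N <= k)%N ->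
      forall t, `|t| <= T -> enorm ((p_ (s j)).1 t - (p_ (s k)).1 t) <= eta.
Proof.
move=> Sp pB; have [c c0 Hc] := X_bounds.
have uK k t : enorm ((p_ k).1 t) <= c * B.
  have [_ /(_ t) h] := Hc _ (Sp k); apply: (le_trans h).
  by apply: ler_wpM2l; [exact: ltW | exact: pB].
(* Decodes a natural number into a pair (i, m) and its grid point; numbers that code no pair get the
   dummy value 0. *)
pose q (c : nat) : R := if unpickle c is Some im then (im : nat * nat).1%:R / im.2.+1%:R - im.2%:R else 0.
have [f [s Hs]] := bounded_subseq (fun k i => uK k (q i)).
exists s; first by move=> j; have [] := Hs j.
move=> T eta eta0.
have e40 : 0 < eta / 4 by rewrite divr_gt0.
have [h0 h00 Hh] := X_modulus B e40.
have hold h : 0 <= h <= h0 -> forall k t, enorm ((p_ k).1 (t + h) - (p_ k).1 t) <= eta / 4.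
  by move=> hh k t; exact: Hh.
(* The grid of index m reaches beyond T and has mesh 1 / (m + 1) <= h0. *)
pose m := (Num.truncn `|T| + Num.truncn h0^-1).+2.
have mT : `|T| <= m%:R.
  have /andP[_ h] := truncn_itv (normr_ge0 T); apply: (le_trans (ltW h)).
  by rewrite ler_nat /m !ltnS leqW// leq_addr.
have mh : m.+1%:R^-1 <= h0.
  rewrite -[leRHS]invrK lef_pV2 ?posrE ?invr_gt0//.
  have /andP[_ h] := truncn_itv (ltW (ltac:(rewrite invr_gt0//) : 0 < h0^-1)).
  apply: (le_trans (ltW h)); rewrite ler_nat /m !ltnS ltnW// ltnS.
  by rewrite leqW// leq_addl.
clearbody m.
(* The largest grid index for points of [-m, m], as (t + m) (m + 1) <= 2 m (m + 1). *)
pose M := (2 * m * m.+1)%N.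
(* The factor n + 1 pays for the passage from the sup norm to the Euclidean norm. Four errors eta /
   4 are added at the end, two from the modulus and two from the grid point. *)
have cv i : exists N, forall j, (N <= j)%N -> `|(p_ (s j)).1 (q i) - f i| <= eta / (4 * n.+1%:R).
  have e0 : 0 < eta / (4 * n.+1%:R) by rewrite divr_gt0.
  have /cvgrPdist_le /(_ _ e0) [N _ HN] := @cvg_harmonic R.
  exists (maxn N i) => j; rewrite geq_max => /andP[j1 j2].
  have [_ /(_ i j2) h] := Hs j; apply: (le_trans h); apply: le_trans (HN j j1).
  by rewrite sub0r normrN ler_norm.
have {cv} [N HN] := choice cv.
exists (\max_(i < M.+1) N (pickle (i : nat, m)))%N => j k Nj Nk t tT.
have tm : 0 <= t + m%:R.
  by have := le_trans tT (le_trans (ler_norm T) mT); rewrite ler_norml => /andP[x _]; lra.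
have tm2 : t + m%:R <= 2 * m%:R.
  by have := le_trans tT (le_trans (ler_norm T) mT); rewrite ler_norml => /andP[_ x]; lra.
have m0 : (0 : R) < m.+1%:R by [].
pose i := Num.truncn ((t + m%:R) * m.+1%:R).
have /andP[i1 i2] := truncn_itv (mulr_ge0 tm (ltW m0)).
have iM : (i < M.+1)%N.
  rewrite ltnS -(@ler_nat R); apply: (le_trans i1).
  by rewrite /M !natrM ler_pM2r.
rewrite -/i in i1 i2.
pose qi := q (pickle (i, m)).
have qE : qi = i%:R / m.+1%:R - m%:R by rewrite /qi /q pickleK.
have tq : 0 <= t - qi <= h0.
  rewrite -ler_pdivrMr// in i1; rewrite -ltr_pdivlMr// -natr1 mulrDl mul1r in i2.
  rewrite qE; apply/andP; split; last apply: (le_trans _ mh);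
    move: (m.+1%:R^-1) (_ / _) i1 i2 => x z i1 i2; lra.
have D k' : enorm ((p_ k').1 t - (p_ k').1 qi) <= eta / 4.
  by have := hold _ tq k' qi; rewrite [qi + _]addrC subrK.
have G k' : (\max_(i < M.+1) N (pickle (i : nat, m)) <= k')%N -> enorm ((p_ (s k')).1 qi - f (pickle (i, m))) <= eta / 4.
  move=> Nk'; have := HN (pickle (i, m)) k' (leq_trans (leq_bigmax (Ordinal iM)) Nk').
  move=> h; rewrite -ler_sqr ?nnegrE ?enorm_ge0 ?(ltW e40)// enorm_sqr.
  apply: le_trans (sqnorm_le_norm _) _.
  have nR : (0 : R) < n.+1%:R by [].
  have E : eta / 4 = n.+1%:R * (eta / (4 * n.+1%:R)).
    by rewrite invfM mulrCA (mulrCA n.+1%:R) divff ?mulr1// gt_eqF.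
  rewrite E exprMn; apply: ler_pM; [by [] | exact: sqr_ge0 | | ].
    by rewrite -natrX ler_nat; apply: leq_trans (leqnSn n) _; rewrite -mulnn leq_pmulr.
  by rewrite ler_sqr ?nnegrE// divr_ge0 ?(ltW eta0).
have -> : (p_ (s j)).1 t - (p_ (s k)).1 t = ((p_ (s j)).1 t - (p_ (s j)).1 qi) +
    ((p_ (s j)).1 qi - f (pickle (i, m))) - (((p_ (s k)).1 t - (p_ (s k)).1 qi) +
    ((p_ (s k)).1 qi - f (pickle (i, m)))).
  by rewrite !addrA !subrK opprB addrA subrK.
apply: le_trans (enormD _ _) _.
have EN (x : 'rV[R]_n) : enorm (- x) = enorm x by rewrite /enorm sqnormN.
rewrite EN.
have h1 := enormD ((p_ (s j)).1 t - (p_ (s j)).1 qi) ((p_ (s j)).1 qi - f (pickle (i, m))).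
have h2 := enormD ((p_ (s k)).1 t - (p_ (s k)).1 qi) ((p_ (s k)).1 qi - f (pickle (i, m))).
have h3 := D (s j); have h4 := D (s k); have h5 := G j Nj; have h6 := G k Nk.
lra.
Qed.

Let P := X_ph.

(** * The functional *)

Definition GW (p : vfun * vfun) : vfun := fun t => gradW W t (p.1 t).
Definition PW (p : vfun * vfun) := Ig (fun t => W t (p.1 t)).

Lemma SX_pair_cont p : SX p -> continuous (fun t => (t, p.1 t)).
Proof.
move=> Sp t; have h1 : s @[s --> t] --> t by [].
exact: (cvg_pair h1 (SX_cont Sp (x := t))).
Qed.

Lemma measurable_W p : SX p -> measurable_fun setT (fun t => W t (p.1 t)).
Proof.
move=> Sp; apply: continuous_measurable_fun => t; have [cW _] := nlC1 HW.
exact: (continuous_comp (@SX_pair_cont p Sp t) (cW (t, p.1 t))).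
Qed.

Lemma measurable_GW p i : SX p -> measurable_fun setT (fun t => GW p t ord0 i).
Proof.
move=> Sp; apply: continuous_measurable_fun => t.
exact: (continuous_comp (@SX_pair_cont p Sp t) (gradW_cont2 HW (i := i) (x := (t, p.1 t)))).
Qed.

(** Elements of a ball of X^a take their values in one ball of R^n, so the local bounds of
    [W_growth] hold along all of them with one constant. *)
Lemma X_growth (B : R) : exists2 C : R, 0 <= C & forall p, SX p -> nX p <= B -> forall t,
  [/\ enorm (GW p t) <= C * enorm (p.1 t), 0 <= W t (p.1 t) & W t (p.1 t) <= C * sqnorm (p.1 t)].
Proof.
have [c c0 Hc] := X_bounds; have [C C0 HC] := W_growth HW (c * B) n0.
exists C => // p Sp pB t; apply: HC; have [_ /(_ t) h] := Hc p Sp.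
by apply: (le_trans h); rewrite ler_pM2l.
Qed.

Lemma L2_GW p : SX p -> L2 (GW p).
Proof.
move=> Sp; have [C C0 HC] := X_growth (nX p).
split; first by move=> i; exact: measurable_GW.
have [[mp ip] _] := SX_L2 Sp.
apply: integ_le (integZ (C ^+ 2) ip) _.
  by apply: measurable_dotv => i; exact: measurable_GW.
move=> t; rewrite ger0_norm ?sqnorm_ge0// -!enorm_sqr -exprMn.
have [h _ _] := HC p Sp (lexx _) t.
by rewrite ler_sqr ?nnegrE ?enorm_ge0// mulr_ge0// enorm_ge0.
Qed.

Lemma nL2_GW (B : R) : exists2 K : R, 0 <= K & forall p, SX p -> nX p <= B -> nL2 (GW p) <= K.
Proof.
have [C C0 HC] := X_growth B; have [c c0 Hc] := X_bounds.
exists (C * (c * `|B|)); first by rewrite mulr_ge0// mulr_ge0// ltW.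
move=> p Sp pB; have [Lp _] := SX_L2 Sp; have LG := L2_GW Sp.
apply: le_trans (_ : C * nL2 p.1 <= _); last first.
  apply: ler_wpM2l => //; have [h _] := Hc p Sp; apply: (le_trans h); rewrite ler_pM2l//.
  by apply: (le_trans pB); exact: ler_norm.
rewrite -ler_sqr ?nnegrE ?nL2_ge0 ?mulr_ge0 ?nL2_ge0// exprMn (nL2_sqr LG) (nL2_sqr Lp).
have [_ ip] := Lp; rewrite -(IgZ _ ip).
apply: Ig_le; [by case: LG | exact: integZ | move=> t].
rewrite -!enorm_sqr -exprMn; have [h _ _] := HC p Sp pB t.
by rewrite ler_sqr ?nnegrE ?enorm_ge0// mulr_ge0// enorm_ge0.
Qed.

Lemma integ_W p : SX p -> integ (fun t => W t (p.1 t)).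
Proof.
move=> Sp; have [C C0 HC] := X_growth (nX p); have [[mp ip] _] := SX_L2 Sp.
apply: integ_le (measurable_W Sp) (integZ C ip) _ => t.
by have [_ h1 h2] := HC p Sp (lexx _) t; rewrite ger0_norm.
Qed.

Lemma PW_ge0 p : SX p -> 0 <= PW p.
Proof.
by move=> Sp; have [C C0 HC] := X_growth (nX p); apply: Ig_ge0 => t; have [] := HC p Sp (lexx _) t.
Qed.

Definition energy p := nX p ^+ 2 / 2 - PW p.
Definition denergy p q := ipX p q - ipL2 (GW p) q.1.

Lemma nX_cvx p q s : SX p -> SX q -> 0 <= s -> s <= 1 -> nX (p + s *: q) <= nX p + nX q.
Proof.
move=> Sp Sq s0 s1; apply: le_trans (nrmD P Sp (phZ P s Sq)) _; rewrite (nrmZ P s Sq) ger0_norm// lerD2l.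
by rewrite ler_piMl// nX_ge0.
Qed.

(* Uniform modulus for the superposition operator: on |t| <= T by uniform continuity, outside by coercivity of L. *)
Lemma GW_modulus (r eps : R) : 0 < eps -> exists2 del : R, 0 < del & forall p q, SX p -> SX q ->
  nX p <= r -> nX q <= del -> exists A : R -> R, [/\ integ A, Ig A <= eps &
    forall t s, 0 <= s -> s <= 1 -> sqnorm (GW (p + s *: q) t - GW p t) <= A t].
Proof.
move=> e0; have [c c0 Hc] := X_bounds.
pose r1 : R := `|r| + 1.
have r10 : 0 < r1 by rewrite ltr_wpDl.
have [C C0 HC] := X_growth r1.
(* Beyond T the majorant is (6 C^2 / K) Q, of integral at most eps / 2 for this K; on [-T, T] the
   constant e1 = eps / (4 T) contributes the other eps / 2. *)
pose K := 12 * C ^+ 2 * (r1 ^+ 2 + 1) / eps + 1.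
have r2 : 0 < r1 ^+ 2 + 1 by rewrite ltr_wpDl// sqr_ge0.
have C2 : 0 <= 12 * C ^+ 2 by rewrite mulr_ge0// sqr_ge0.
have K0 : 0 < K by rewrite ltr_wpDl// divr_ge0 ?(ltW e0)// mulr_ge0// ltW.
have [T T0 HT] := l_large K.
pose e1 := eps / (4 * T).
have e10 : 0 < e1 by rewrite divr_gt0// mulr_gt0.
have [d d0 Hd] := gradW_unif HW T (c * r1) e10.
exists (Num.min 1 (d / c)); first by rewrite lt_min ltr01 divr_gt0.
move=> p q Sp Sq pr; rewrite le_min => /andP[q1 qd].
have pr1 : nX p <= r1 by rewrite /r1; apply: (le_trans pr); apply: (le_trans (ler_norm r)); rewrite lerDl.
pose Q t := qform (L t) (p.1 t) (p.1 t) + qform (L t) (q.1 t) (q.1 t).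
have iQ : integ Q by apply: integD; [exact: Sp.2 | exact: Sq.2].
have IQ : Ig Q <= r1 ^+ 2 + 1.
  rewrite (IgD Sp.2 Sq.2); apply: lerD.
    apply: le_trans (QX_le Sp) _; rewrite ler_sqr ?nnegrE ?nX_ge0//; exact: ltW.
  apply: le_trans (QX_le Sq) _; rewrite -[leRHS](expr1n _ 2).
  by rewrite ler_sqr ?nnegrE ?nX_ge0.
pose b t := if t \in `[- T, T] then e1 else 0 : R.
have NT : - T <= T by lra.
have [ib Ib] := Ig_box e1 NT.
pose k := 6 * C ^+ 2 / K.
(* One majorant has to serve every s in [0, 1]: in [energy_diff] the intermediate point s of the
   mean value theorem varies with t. *)
exists (fun t => b t + k * Q t); split.
- by apply: integD => //; exact: integZ.
- rewrite (IgD ib (integZ k iQ)) Ib (IgZ k iQ).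
  have E1 : e1 * (T - - T) = eps / 2 by rewrite /e1; field; rewrite gt_eqF.
  rewrite E1 [leRHS](splitr eps) lerD2l.
  have k0 : 0 <= k by rewrite /k divr_ge0 ?(ltW K0)// mulr_ge0// sqr_ge0.
  apply: le_trans (ler_wpM2l k0 IQ) _; rewrite /k mulrAC ler_pdivrMr//.
  have KE : eps / 2 * K = 6 * C ^+ 2 * (r1 ^+ 2 + 1) + eps / 2 by rewrite /K; field; rewrite gt_eqF.
  by rewrite KE lerDl divr_ge0// ltW.
move=> t s s0 s1.
have q0 x : 0 <= qform (L t) x x by exact: qform_ge0.
have Q0 : 0 <= Q t by rewrite /Q addr_ge0.
have k0 : 0 <= k by rewrite /k divr_ge0 ?(ltW K0)// mulr_ge0// sqr_ge0.
have [tT|Tt] := leP `|t| T.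
  rewrite /b in_itv/= -ler_norml tT.
  apply: le_trans (_ : e1 <= _); last by rewrite lerDl mulr_ge0.
  rewrite -sqnormN opprB; apply: (Hd t (p.1 t) ((p + s *: q).1 t) tT).
    by have [_ /(_ t) h] := Hc p Sp; apply: (le_trans h); rewrite ler_pM2l.
  rewrite (_ : p.1 t - (p + s *: q).1 t = - (s *: q.1 t)); last first.
    have -> : (p + s *: q).1 t = p.1 t + s *: q.1 t by [].
    by rewrite opprD addrA subrr add0r.
  rewrite /enorm sqnormN -/(enorm _) enormZ ger0_norm//.
  apply: le_trans (_ : enorm (q.1 t) <= _); first by rewrite ler_piMl// enorm_ge0.
  have [_ /(_ t) h] := Hc q Sq; apply: (le_trans h).
  by rewrite mulrC -ler_pdivlMr.
have b0 : 0 <= b t by rewrite /b; case: ifP => // _; exact: ltW.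
apply: le_trans (_ : k * Q t <= _); last by rewrite lerDr.
have Sps : SX (p + s *: q) by apply: (phD P Sp); exact: (phZ P).
have ps : nX (p + s *: q) <= r1.
  apply: le_trans (nX_cvx Sp Sq s0 s1) _; rewrite /r1; apply: lerD => //.
  by apply: (le_trans pr); exact: ler_norm.
have sq p' : SX p' -> nX p' <= r1 -> sqnorm (GW p' t) <= C ^+ 2 * sqnorm (p'.1 t).
  move=> Sp' p'r; have [h _ _] := HC p' Sp' p'r t.
  by rewrite -!enorm_sqr -exprMn ler_sqr ?nnegrE ?enorm_ge0// mulr_ge0// enorm_ge0.
apply: le_trans (sqnormB _ _) _.
have h1 := sq _ Sps ps; have h2 := sq _ Sp pr1.
have h3 : sqnorm ((p + s *: q).1 t) <= 2 * sqnorm (p.1 t) + 2 * sqnorm (q.1 t).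
  apply: le_trans (sqnormD _ _) _; rewrite lerD2l ler_pM2l// sqnormZ ler_piMl ?sqnorm_ge0//.
  by rewrite -[leRHS](expr1n _ 2) ler_sqr ?nnegrE.
have C20 : 0 <= C ^+ 2 := sqr_ge0 C.
have h4 : 2 * sqnorm (GW (p + s *: q) t) + 2 * sqnorm (GW p t) <= 6 * C ^+ 2 * (sqnorm (p.1 t) + sqnorm (q.1 t)).
  have h5 := ler_wpM2l C20 h3.
  have h6 : 0 <= C ^+ 2 * sqnorm (q.1 t) by rewrite mulr_ge0// sqnorm_ge0.
  move: (sqnorm _) (sqnorm _) (sqnorm _) (sqnorm _) (sqnorm _) (C ^+ 2) h1 h2 h5 h6 => x1 x2 x3 x4 x5 y *.
  lra.
apply: (le_trans h4); rewrite /k -(mulrA (6 * C ^+ 2)); apply: ler_wpM2l; first by rewrite mulr_ge0.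
rewrite mulrC ler_pdivlMr// mulrC mulrDr /Q.
have Kx x : K * sqnorm x <= qform (L t) x x.
  by apply: le_trans (cvb H t x); rewrite ler_wpM2r ?sqnorm_ge0// HT.
by apply: lerD.
Qed.

Let LG p (Sp : SX p) : L2 (GW p) := L2_GW Sp.
Let Lu p (Sp : SX p) : L2 p.1 := (SX_L2 Sp).1.

Lemma denergy_D x v w : SX x -> SX v -> SX w -> denergy x (v + w) = denergy x v + denergy x w.
Proof.
move=> Sx Sv Sw; rewrite /denergy (ipDr P Sv Sw Sx).
have -> : (v + w).1 = v.1 + w.1 by [].
by rewrite (ipDr (L2_ph R n) (Lu Sv) (Lu Sw) (LG Sx)) opprD addrACA.
Qed.

Lemma denergy_Z x c v : SX x -> SX v -> denergy x (c *: v) = c * denergy x v.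
Proof.
move=> Sx Sv; rewrite /denergy (ipZr P c Sv Sx).
have -> : (c *: v).1 = c *: v.1 by [].
by rewrite (ipZr (L2_ph R n) c (Lu Sv) (LG Sx)) mulrBr.
Qed.

Lemma GW0 : GW (0 : vfun * vfun) = 0.
Proof. by apply/funext => t; rewrite /GW (gradW0 HW). Qed.

Lemma denergy_0 v : SX v -> denergy 0 v = 0.
Proof.
move=> Sv; rewrite /denergy GW0 (ip0l P Sv) sub0r.
by rewrite (ip0l (L2_ph R n) (Lu Sv)) oppr0.
Qed.

Lemma ipL2_le (f g : vfun) : L2 f -> L2 g -> `|ipL2 f g| <= nL2 f * nL2 g.
Proof. exact: (ip_CS (L2_ph R n)). Qed.

Lemma denergy_bounded r : exists2 K, 0 <= K & forall x v, SX x -> SX v -> nX x <= r ->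
  `|denergy x v| <= K * nX v.
Proof.
have [K K0 HK] := nL2_GW r; have [c c0 Hc] := X_bounds.
exists (`|r| + K * c); first by rewrite addr_ge0// mulr_ge0// ltW.
move=> x v Sx Sv xr; rewrite /denergy; apply: le_trans (ler_normB _ _) _; rewrite mulrDl; apply: lerD.
  apply: le_trans (ip_CS P Sx Sv) _; apply: ler_wpM2r; first exact: nX_ge0.
  by apply: (le_trans xr); exact: ler_norm.
apply: le_trans (ipL2_le (LG Sx) (Lu Sv)) _; rewrite -mulrA.
by apply: ler_pM; [exact: nL2_ge0 | exact: nL2_ge0 | exact: HK | have [] := Hc v Sv].
Qed.

Lemma denergy_cont r eps : 0 < eps -> exists2 del, 0 < del &
  forall x y v, SX x -> SX y -> SX v -> nX x <= r -> nX y <= r -> nX (x - y) <= del ->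
    `|denergy x v - denergy y v| <= eps * nX v.
Proof.
move=> e0; have [c c0 Hc] := X_bounds.
have e20 : 0 < eps / 2 by rewrite divr_gt0.
pose e1 := eps / (2 * c).
have e10 : 0 < e1 by rewrite divr_gt0// mulr_gt0.
have e12 : 0 < e1 ^+ 2 by rewrite exprn_gt0.
have [d d0 Hd] := GW_modulus r e12.
exists (Num.min (eps / 2) d); first by rewrite lt_min e20.
move=> x y v Sx Sy Sv xr yr; rewrite le_min => /andP[xy1 xy2].
have Sxy := phB P Sx Sy.
have [A [iA IA bA]] := Hd y (x - y) Sy Sxy yr xy2.
have LB := L2B (LG Sx) (LG Sy).
have nG : nL2 (GW x - GW y) <= e1.
  rewrite -ler_sqr ?nnegrE ?nL2_ge0 ?(ltW e10)// (nL2_sqr LB).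
  apply: le_trans IA; apply: Ig_le; [by case: LB | exact: iA | move=> t].
  have := bA t 1 ler01 (lexx _); rewrite scale1r [y + _]addrC subrK; exact.
have -> : denergy x v - denergy y v = ipX (x - y) v - ipL2 (GW x - GW y) v.1.
  rewrite (ipBl P Sx Sy Sv) (ipBl (L2_ph R n) (LG Sx) (LG Sy) (Lu Sv)) /denergy.
  move: (ipX _ _) (ipX _ _) (ipL2 _ _) (ipL2 _ _) => x1 x2 x3 x4; ring.
apply: le_trans (ler_normB _ _) _.
rewrite [eps in leRHS](splitr eps) mulrDl; apply: lerD.
  apply: le_trans (ip_CS P Sxy Sv) _; apply: ler_wpM2r; [exact: nX_ge0 | exact: xy1].
apply: le_trans (ipL2_le LB (Lu Sv)) _.
apply: le_trans (_ : e1 * (c * nX v) <= _).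
  by apply: ler_pM; [exact: nL2_ge0 | exact: nL2_ge0 | exact: nG | have [] := Hc v Sv].
rewrite mulrA; apply: ler_wpM2r; first exact: nX_ge0.
by rewrite /e1 le_eqVlt; apply/orP; left; apply/eqP; field; rewrite gt_eqF.
Qed.

(** Cauchy-Schwarz for sqrt(A) and |w|. In [energy_diff] the mean value point is chosen separately
    for each t, with no measurability, so what is available is a pointwise bound by a measurable
    majorant. *)
Lemma Ig_dominated (f A : R -> R) (w : vfun) (al : R) : measurable_fun setT f -> integ A -> L2 w ->
  0 <= al -> Ig A <= al ^+ 2 -> (forall t, 0 <= A t) ->
  (forall t, `|f t| <= Num.sqrt (A t) * enorm (w t)) -> `|Ig f| <= al * nL2 w.
Proof.
move=> mf iA Lw al0 IA A0 fb.
have msq (g : R -> R) : measurable_fun setT g -> measurable_fun setT (fun t => Num.sqrt (g t)).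
  by move=> mg; apply: (measurableT_comp _ mg); apply: continuous_measurable_fun; exact: sqrt_continuous.
have m1 := msq _ (integ_msr iA).
have m2 : measurable_fun setT (fun t => enorm (w t)) by apply: msq; exact: (integ_msr Lw.2).
have E1 : (fun t => Num.sqrt (A t) ^+ 2) = A by apply/funext => t; rewrite sqr_sqrtr.
have E2 : (fun t => enorm (w t) ^+ 2) = fun t => sqnorm (w t) by apply/funext => t; rewrite enorm_sqr.
have [|i1 b1] := Ig_CS m1 m2 _ (ltac:(rewrite E2; exact: Lw.2)); first by rewrite E1.
apply: le_trans (Ig_normle mf i1 fb) _.
have I0 : 0 <= Ig (fun t => Num.sqrt (A t) * enorm (w t)).
  by apply: Ig_ge0 => t; rewrite mulr_ge0 ?sqrtr_ge0 ?enorm_ge0.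
rewrite -ler_sqr ?nnegrE ?mulr_ge0 ?nL2_ge0// exprMn (nL2_sqr Lw).
apply: (le_trans b1); rewrite E1 E2; apply: ler_wpM2r => //.
by apply: Ig_ge0 => t; exact: sqnorm_ge0.
Qed.

Lemma energy_diff r eps : 0 < eps -> exists2 del, 0 < del &
  forall x v, SX x -> SX v -> nX x <= r -> nX v <= del ->
    energy (x + v) - energy x - denergy x v <= eps * nX v.
Proof.
move=> e0; have [c c0 Hc] := X_bounds.
have e20 : 0 < eps / 2 by rewrite divr_gt0.
pose e1 := eps / (2 * c).
have e10 : 0 < e1 by rewrite divr_gt0// mulr_gt0.
have e12 : 0 < e1 ^+ 2 by rewrite exprn_gt0.
have [d d0 Hd] := GW_modulus r e12.
(* nX v <= eps makes the quadratic remainder nX v ^ 2 / 2 at most (eps / 2) nX v. *)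
exists (Num.min eps d); first by rewrite lt_min e0.
move=> x v Sx Sv xr; rewrite le_min => /andP[v1 v2].
have [A [iA IA bA]] := Hd x v Sx Sv xr v2.
have Sxv := phD P Sx Sv.
have i1 := integ_W Sxv; have i2 := integ_W Sx.
have i3 := L2_integ (LG Sx) (Lu Sv).
pose f t := W t ((x + v).1 t) - W t (x.1 t) - dotv (GW x t) (v.1 t).
have i12 := integB i1 i2.
have fi : integ f := integB i12 i3.
have E : PW (x + v) - PW x - ipL2 (GW x) v.1 = Ig f.
  by rewrite /f (IgB i12 i3) (IgB i1 i2).
have A0 t : 0 <= A t by apply: le_trans (bA t 0 (lexx _) ler01); exact: sqnorm_ge0.
have fb t : `|f t| <= Num.sqrt (A t) * enorm (v.1 t).
  have [s [s0 s1 Es]] := W_MVT HW t (x.1 t) (v.1 t).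
  have -> : f t = dotv (GW (x + s *: v) t - GW x t) (v.1 t).
    by rewrite dotvBl /GW -Es.
  apply: le_trans (dotv_CS _ _) _; apply: ler_wpM2r; first exact: enorm_ge0.
  by apply: ler_wsqrtr; exact: bA.
have If := Ig_dominated (integ_msr fi) iA (Lu Sv) (ltW e10) IA A0 fb.
have nxv : nX (x + v) ^+ 2 = nX x ^+ 2 + 2 * ipX x v + nX v ^+ 2.
  rewrite /nX (nrm_sqr P Sxv) (nrm_sqr P Sx) (nrm_sqr P Sv).
  by have := ip_sqrD P 1 Sx Sv; rewrite scale1r mulr1 expr1n mul1r.
have -> : energy (x + v) - energy x - denergy x v = nX v ^+ 2 / 2 - Ig f.
  rewrite -E /energy /denergy nxv.
  by move: (PW _) (PW _) (ipX _ _) (ipL2 _ _) (nX _) (nX _) => *; field.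
rewrite [eps in leRHS](splitr eps) mulrDl; apply: lerD.
  by rewrite expr2 -mulrA [eps / 2 * _]mulrC mulrCA; apply: ler_wpM2l; [exact: nX_ge0 | have := v1; lra].
apply: le_trans (ler_norm _) _; rewrite normrN; apply: (le_trans If).
have [h _] := Hc v Sv; apply: le_trans (ler_wpM2l (ltW e10) h) _.
rewrite mulrA; apply: ler_wpM2r; first exact: nX_ge0.
by rewrite /e1 le_eqVlt; apply/orP; left; apply/eqP; field; rewrite gt_eqF.
Qed.

(** * Mountain pass geometry of the energy *)

Lemma energy_rim : exists2 rho, 0 < rho & forall x, SX x -> rho <= nX x -> nX x <= 2 * rho ->
  rho ^+ 2 / 4 <= energy x.
Proof.
have [c c0 Hc] := X_bounds.
(* With e = 1 / (4 c^2) the potential is at most |x|^2 / 4, half of the quadratic part; with rho = d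
   / (4 c) the values of x stay within d / 2 for |x| <= 2 rho. *)
pose e := (4 * c ^+ 2)^-1.
have e0 : 0 < e by rewrite invr_gt0 mulr_gt0// exprn_gt0.
have [d d0 Hd] := W_small HW n0 e0.
pose rho := d / (4 * c).
have rho0 : 0 < rho by rewrite divr_gt0// mulr_gt0.
exists rho => // x Sx x1 x2; have [h1 h2] := Hc x Sx.
have b : PW x <= nX x ^+ 2 / 4.
  apply: le_trans (_ : e * nL2 x.1 ^+ 2 <= _).
    have [_ ix] := Lu Sx.
    rewrite (nL2_sqr (Lu Sx)) -(IgZ e ix).
    apply: Ig_le; [exact: (integ_W Sx) | exact: integZ | move=> t].
    have [|_ h] := Hd t (x.1 t); last exact: h.
    apply: le_lt_trans (h2 t) _; apply: le_lt_trans (_ : c * (2 * rho) < _); first by rewrite ler_pM2l.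
    have -> : c * (2 * rho) = d / 2 by rewrite /rho; field; rewrite gt_eqF.
    by rewrite ltr_pdivrMr// ltr_pMr// ltr1n.
  apply: le_trans (_ : e * (c * nX x) ^+ 2 <= _).
    apply: ler_wpM2l; first exact: ltW.
    by rewrite ler_sqr ?nnegrE ?nL2_ge0 ?mulr_ge0 ?nX_ge0 ?(ltW c0).
  by rewrite /e le_eqVlt; apply/orP; left; apply/eqP; field; rewrite gt_eqF.
have q : rho ^+ 2 <= nX x ^+ 2 by rewrite ler_sqr ?nnegrE ?nX_ge0 ?(ltW rho0).
rewrite /energy; move: (nX x ^+ 2) (rho ^+ 2) (PW x) b q => u v w b q; lra.
Qed.

Lemma AR_le t x : th * W t x <= dotv x (gradW W t x).
Proof.
have [->|x0] := eqVneq x 0; last by have [] := nlAR HW t x0.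
have [d d0 Hd] := W_small HW n0 ltr01.
have [|h1 h2] := Hd t 0; first by rewrite enorm0.
rewrite dotv0l; have w0 : W t 0 = 0.
  by apply: le_anti; rewrite h1 andbT; apply: (le_trans h2); rewrite /sqnorm dotv0l mulr0.
by rewrite w0 mulr0.
Qed.

Lemma energy_out (Mx r0 : R) : exists2 Rr, r0 <= Rr & forall x, SX x -> Rr <= nX x -> energy x <= Mx -> denergy x x <= - 1.
Proof.
have th2 := nlmu HW.
(* Gives (th / 2 - 1) |x|^2 >= |th Mx| + 1 as soon as |x|^2 >= K, which |x| >= 1 + K ensures. *)
pose K := (`|th * Mx| + 1) / (th / 2 - 1).
have d0 : 0 < th / 2 - 1 by lra.
have K0 : 0 <= K by rewrite divr_ge0 ?(ltW d0)// addr_ge0.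
exists (`|r0| + K + 1).
  by apply: le_trans (ler_norm r0) _; rewrite -addrA lerDl addr_ge0.
move=> x Sx xR Ix.
have b : th * PW x <= ipL2 (GW x) x.1.
  have iW := integ_W Sx.
  rewrite /PW -(IgZ th iW); apply: Ig_le; [exact: integZ | exact: (L2_integ (LG Sx) (Lu Sx)) | move=> t].
  by rewrite dotvC; exact: AR_le.
have E : ipX x x = nX x ^+ 2 by rewrite /nX (nrm_sqr P Sx).
have y1 : 1 + K <= nX x.
  by apply: le_trans xR; have := normr_ge0 r0; lra.
have sq : K <= nX x ^+ 2 by rewrite expr2; nra.
have m1 : `|th * Mx| + 1 <= nX x ^+ 2 * (th / 2 - 1) by rewrite -ler_pdivrMr.
have m2 := ler_norm (th * Mx).
have m3 : th * energy x <= th * Mx by rewrite ler_wpM2l//; lra.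
rewrite /denergy E; rewrite /energy in m3.
move: (nX x ^+ 2) (PW x) (ipL2 _ _) (`|th * Mx|) b m1 m2 m3 => u v w z b m1 m2 m3; lra.
Qed.

(** A bump in one coordinate: L is bounded on its compact support, so the weighted integral is
    finite. *)
Lemma test_element : exists2 e, SX e & forall t, `|t| < 1 -> e.1 t != 0.
Proof.
pose i0 := Ordinal n0.
pose phi : vfun := fun t => bumpfun t *: delta_mx ord0 i0.
have phiE i : (fun t => phi t ord0 i) = fun t => (delta_mx ord0 i0 : 'rV[R]_n) ord0 i * bumpfun t.
  by apply/funext => t; rewrite /phi mxE mulrC.
have s : smooth_compact phi.
  split.
    move=> i; rewrite phiE; apply: smooth1Z => k x; exact: (@bump_smooth R k x).
  by exists 1 => x x1; rewrite /phi bump_out// scale0r.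
have nz t : `|t| < 1 -> phi t != 0.
  move=> t1; apply/eqP => /rowP /(_ i0); rewrite /phi !mxE !eqxx mulr1 => /eqP.
  by rewrite gt_eqF// bump_in.
exists (phi, LWderv a phi) => //; split; first exact: (HS_smooth a0 a1 s).
have [[mp _] _] := smooth_L2 a0 a1 s.
have qE t : qform (L t) (phi t) (phi t) = bumpfun t ^+ 2 * L t i0 i0.
  rewrite /phi qformZl (qformZr _ _ _ (cvS H t)) mulrA -expr2; congr (_ * _).
  rewrite /qform (bigD1 i0)//= (bigD1 i0)//= !mxE !eqxx !mulr1.
  rewrite !big1 ?addr0// => i ii0.
    by rewrite big1// => j _; rewrite !mxE (negbTE ii0) mulr0.
  by rewrite !mxE (negbTE ii0) mulr0 mul0r.
have cq : continuous (fun t => bumpfun t ^+ 2 * L t i0 i0).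
  move=> t; apply: cvgM.
    have cb : {for t, continuous (@bumpfun R)}.
      by apply: differentiable_continuous; apply/derivable1_diffP; exact: (@bump_smooth R 0 t).
    exact: (cvgM cb cb).
  by apply: (@continuous_comp _ _ _ L (fun M : 'M[R]_n => M i0 i0)); [exact: (cvL H) | exact: coord_continuous].
have [K K0 HK] := @continuous_bounded_seg R _ (-1) 1 cq.
have [ib _] := @Ig_box R (-1) 1 K ltac:(lra).
apply: integ_le (measurable_qform mp mp) ib _ => t /=; rewrite qE in_itv/= -ler_norml.
have [t1|t1] := leP `|t| 1; first by move: t1; rewrite ler_norml => /andP[? ?]; exact: HK.
by rewrite bump_out// expr0n mul0r normr0.
Qed.

(** A zero integral would force W(t, e(t)) = 0 almost everywhere, while (W1) makes it positive on
    ]-1, 1[, a set of positive measure. *)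
Lemma PW_gt0 e : SX e -> (forall t, `|t| < 1 -> e.1 t != 0) -> 0 < PW e.
Proof.
move=> Se ez; rewrite ltNge; apply/negP => We.
have [C C0 HC] := X_growth (nX e).
have W0 t : 0 <= W t (e.1 t) by have [] := HC e Se (lexx _) t.
have := Ig0_ae (integ_W Se) W0 We.
move=> [N [mN N0 HN]].
have sub : `]-1, 1[%classic `<=` N.
  move=> t; rewrite /= in_itv/= -ltr_norml => t1; apply: HN => /= Wt.
  have [h _] := nlAR HW t (ez t t1); move: h; rewrite Wt mulr0 ltxx; exact.
pose J : set R := `]-1, 1[%classic.
have le : (mu J <= mu N)%E by apply: le_measure => //; rewrite inE //; exact: measurable_itv.
have N00 : mu N = 0%E := N0.
rewrite N00 /J lebesgue_measure_itv/= lte_fin ifT in le; last lra.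
by move: le; rewrite -EFinD lee_fin; lra.
Qed.

Lemma ray_bound e : SX e -> (forall t, `|t| < 1 -> e.1 t != 0) ->
  exists M, forall t, 0 <= t -> energy (t *: e) <= M.
Proof.
move=> Se ez; have m0 := PW_gt0 Se ez; have th2 := nlmu HW.
(* t0 solves t^(th - 2) m = A / 2; beyond both 1 and t0 the potential outweighs the quadratic part
   and the energy is at most 0. *)
pose m := PW e; pose A := nX e ^+ 2; pose t0 := (A / (2 * m)) `^ (th - 2)^-1.
have A0 : 0 <= A by exact: sqr_ge0.
have t00 : 0 <= t0 by exact: powR_ge0.
exists (A / 2 * (1 + t0 ^+ 2)) => t tp.
have St := phZ P t Se.
have nt : nX (t *: e) ^+ 2 = t ^+ 2 * A.
  by rewrite /nX (nrmZ P t Se) exprMn real_normK ?num_real.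
rewrite /energy nt.
have W0 := PW_ge0 St.
have case1 : t ^+ 2 <= 1 + t0 ^+ 2 -> t ^+ 2 * A / 2 - PW (t *: e) <= A / 2 * (1 + t0 ^+ 2).
  move=> h; have A2 : 0 <= A / 2 by rewrite divr_ge0.
  have := ler_wpM2l A2 h; move: (PW _) W0 => w w0; rewrite -mulrA [t ^+ 2 * _]mulrC.
  move: (A / 2 * t ^+ 2) => z; lra.
have [t1|t1] := leP t 1.
  apply: case1; apply: le_trans (_ : 1 <= _); last by rewrite lerDl sqr_ge0.
  by rewrite -[leRHS](expr1n _ 2) ler_sqr ?nnegrE.
have [tt0|tt0] := leP t t0.
  apply: case1; apply: le_trans (_ : t0 ^+ 2 <= _); last by rewrite lerDr.
  by rewrite ler_sqr ?nnegrE.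
have th20 : 0 < th - 2 by lra.
have t10 : 0 < t by lra.
have b1 : A / 2 <= t `^ (th - 2) * m.
  have : t0 `^ (th - 2) <= t `^ (th - 2) by apply: ge0_ler_powR; rewrite ?nnegrE ?(ltW th20) ?(ltW tt0).
  rewrite /t0 -powRrM mulVf ?gt_eqF// powRr1 ?divr_ge0 ?mulr_ge0 ?nX_ge0 ?(ltW m0)//.
  rewrite ler_pdivrMr ?mulr_gt0// mulrCA => h; rewrite ler_pdivrMr// mulrC; exact: h.
have b2 : t `^ th * m <= PW (t *: e).
  have ie := integ_W Se.
  rewrite /m /PW -(IgZ _ ie); apply: Ig_le; [exact: integZ | exact: (integ_W St) | move=> s].
  have -> : (t *: e).1 s = t *: e.1 s by [].
  have [e0|e0] := eqVneq (e.1 s) 0; last by apply: (W_superquad HW); rewrite ?(ltW t1).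
  have [d d0 Hd] := W_small HW n0 ltr01.
  have [|h1 h2] := Hd s 0; first by rewrite enorm0.
  have w0 : W s 0 = 0.
    by apply: le_anti; rewrite h1 andbT; apply: (le_trans h2); rewrite /sqnorm dotv0l mulr0.
  by rewrite e0 scaler0 w0 mulr0.
have tE : t `^ th = t ^+ 2 * t `^ (th - 2).
  rewrite -powR_mulrn// -powRD; last by rewrite (gt_eqF t10) implybT.
  by congr (_ `^ _); ring.
have b3 : t ^+ 2 * (A / 2) <= t `^ th * m by rewrite tE -(mulrA (t ^+ 2) (t `^ _)); apply: ler_wpM2l; [exact: sqr_ge0 | exact: b1].
have R0 : 0 <= A / 2 * (1 + t0 ^+ 2) by rewrite mulr_ge0 ?divr_ge0// addr_ge0 ?sqr_ge0.
apply: le_trans R0; rewrite -mulrA.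
move: (PW _) (t `^ th * m) (t ^+ 2 * (A / 2)) b2 b3 => x y z b2 b3; lra.
Qed.

(** * Palais-Smale sequence, its limit, and the critical point *)

Lemma PS_sequence : exists B al : R, exists2 x : nat -> vfun * vfun, 0 < al &
  forall k, [/\ SX (x k), nX (x k) <= B, al <= energy (x k) & forall v, SX v -> `|denergy (x k) v| <= harmonic k * nX v].
Proof.
have [e Se ez] := test_element.
have [M HM] := ray_bound Se ez.
have [rho rho0 Hrho] := energy_rim.
have [Rr R0 HR] := energy_out M (2 * rho).
have e0 : 0 < nrm ipX e.
  have [c c0 Hc] := X_bounds; have [_ /(_ 0) h] := Hc e Se.
  have h2 : 0 < enorm (e.1 0).
    by rewrite lt_neqAle enorm_ge0 andbT eq_sym enorm0_eq0; apply: ez; rewrite normr0.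
  by have := lt_le_trans h2 h; rewrite pmulr_rgt0.
have al0 : 0 < rho ^+ 2 / 4 by rewrite divr_gt0// exprn_gt0.
have key (k : nat) : exists x, [/\ SX x, nX x <= Rr + 1, rho ^+ 2 / 4 / 2 <= energy x &
    forall v, SX v -> `|denergy x v| <= harmonic k * nX v].
  apply: (@mountain_pass_PS R _ SX ipX P energy denergy rho (rho ^+ 2 / 4) M Rr 1 e) => //.
  - exact: denergy_D.
  - exact: denergy_Z.
  - exact: denergy_0.
  - exact: denergy_bounded.
  - exact: energy_diff.
  - exact: denergy_cont.
  - by move=> x Sx x1 _; exact: HR.
  - by rewrite /harmonic /= invr_gt0.
have [x Hx] := choice key.
by exists (Rr + 1), (rho ^+ 2 / 4 / 2); exists x => //; rewrite divr_gt0.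
Qed.

Lemma nXB p q : SX p -> SX q -> nX (p - q) <= nX p + nX q.
Proof. exact: (nrmB P). Qed.

Lemma nXD p q : SX p -> SX q -> nX (p + q) <= nX p + nX q.
Proof. exact: (nrmD P). Qed.

(* The tails are uniformly small: sqnorm (u t) <= qform (L t) (u t) (u t) / l t with l large. *)
Lemma X_compact_L2 (p_ : nat -> vfun * vfun) (B : R) : (forall k, SX (p_ k)) ->
  (forall k, nX (p_ k) <= B) ->
  exists2 s : nat -> nat, (forall j, (j <= s j)%N) &
    forall e : R, 0 < e -> exists N, forall j k, (N <= j)%N -> (N <= k)%N ->
      nL2 ((p_ (s j)).1 - (p_ (s k)).1) <= e.
Proof.
move=> Sp pB; have [s sj Hs] := X_compact Sp pB.
(* D bounds |z|^2 for differences z. The tail |t| > T costs at most D / K <= e^2 / 2, and [-T, T]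
   costs 2 T eta^2 = e^2 / 2. *)
exists s => // e e0; pose D : R := 4 * B ^+ 2; pose K := 2 * D / e ^+ 2 + 1.
have D0 : 0 <= D by rewrite mulr_ge0// sqr_ge0.
have e20 : 0 < e ^+ 2 by rewrite exprn_gt0.
have K0 : 0 < K by rewrite ltr_wpDl// divr_ge0 ?(ltW e20)// mulr_ge0.
have [T T0 HT] := l_large K.
pose eta := Num.sqrt (e ^+ 2 / (4 * T)).
have q0 : 0 < e ^+ 2 / (4 * T) by rewrite divr_gt0// mulr_gt0.
have eta0 : 0 < eta by rewrite sqrtr_gt0.
have etaE : eta ^+ 2 = e ^+ 2 / (4 * T) by rewrite sqr_sqrtr// ltW.
have [N HN] := Hs T eta eta0.
exists N => j k Nj Nk.
pose z := p_ (s j) - p_ (s k).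
have Sz : SX z := phB P (Sp _) (Sp _).
have [Lz _] := SX_L2 Sz.
have nz : nX z ^+ 2 <= D.
  have h : nX z <= 2 * B.
    have := nXB (Sp (s j)) (Sp (s k)); have := pB (s j); have := pB (s k); rewrite -/z.
    move: (nX _) (nX _) (nX _) => x1 x2 x3 *; lra.
  have B0 : 0 <= 2 * B by apply: le_trans h; exact: nX_ge0.
  have -> : D = (2 * B) ^+ 2 by rewrite /D; ring.
  by rewrite ler_sqr ?nnegrE ?nX_ge0.
rewrite -ler_sqr ?nnegrE ?nL2_ge0 ?(ltW e0)//.
rewrite (_ : (p_ (s j)).1 - (p_ (s k)).1 = z.1)// (nL2_sqr Lz).
have NT : - T <= T by lra.
have [ib Ib] := Ig_box (eta ^+ 2) NT.
pose b t := if t \in `[- T, T] then eta ^+ 2 else 0 : R.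
have iq := integZ K^-1 Sz.2.
apply: le_trans (_ : Ig (fun t => b t + K^-1 * qform (L t) (z.1 t) (z.1 t)) <= _).
  apply: Ig_le; [by case: Lz | exact: (integD ib iq) | move=> t].
  have Kq : 0 <= K^-1 * qform (L t) (z.1 t) (z.1 t) by rewrite mulr_ge0 ?invr_ge0 ?(ltW K0)// qform_ge0.
  have [tT|Tt] := leP `|t| T.
    rewrite /b in_itv/= -ler_norml tT.
    apply: le_trans (_ : eta ^+ 2 <= _); last by rewrite lerDl.
    by rewrite -enorm_sqr ler_sqr ?nnegrE ?enorm_ge0 ?(ltW eta0)//; exact: HN.
  have b0 : 0 <= b t by rewrite /b; case: ifP => // _; exact: sqr_ge0.
  apply: le_trans (_ : K^-1 * qform (L t) (z.1 t) (z.1 t) <= _); last by rewrite lerDr.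
  rewrite mulrC ler_pdivlMr// mulrC; apply: le_trans (cvb H t _).
  by rewrite ler_wpM2r ?sqnorm_ge0// HT.
rewrite (IgD ib iq) Ib (IgZ _ Sz.2) etaE [leRHS](splitr (e ^+ 2)); apply: lerD.
  by rewrite le_eqVlt; apply/orP; left; apply/eqP; field; rewrite gt_eqF.
apply: le_trans (_ : K^-1 * D <= _).
  apply: ler_wpM2l; first by rewrite invr_ge0 ltW.
  exact: le_trans (QX_le Sz) nz.
have e2n : e != 0 by rewrite gt_eqF.
rewrite mulrC ler_pdivrMr// (_ : e ^+ 2 / 2 * K = D + e ^+ 2 / 2); last by rewrite /K; field.
by rewrite lerDl divr_ge0// ltW.
Qed.

Lemma critical_point : exists p, [/\ SX p, forall v, SX v -> denergy p v = 0 &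
  ~ {ae mu, forall t, p.1 t = 0}].
Proof.
have [B [al [x al0 Hx]]] := PS_sequence.
have Sx k : SX (x k) by have [] := Hx k.
have xB k : nX (x k) <= B by have [] := Hx k.
have B0 : 0 <= B by apply: le_trans (xB 0%N); exact: nX_ge0.
have [s sj Hs] := X_compact_L2 Sx xB.
pose y k := x (s k).
have Sy k : SX (y k) by exact: Sx.
have yB k : nX (y k) <= B by exact: xB.
have harm (e : R) : 0 < e -> exists N, forall k, (N <= k)%N -> harmonic (s k) <= e.
  move=> e0; have /cvgrPdist_le /(_ _ e0) [N _ HN] := @cvg_harmonic R.
  exists N => k Nk; have := HN (s k) (leq_trans Nk (sj k)).
  by rewrite sub0r normrN; apply: le_trans; exact: ler_norm.
have dy k v : SX v -> `|denergy (y k) v| <= harmonic (s k) * nX v by have [_ _ _] := Hx (s k); exact.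
have [K K0 HK] := nL2_GW B.
have LGy k : L2 (GW (y k)) := L2_GW (Sy k).
have [p Sp yp] : exists2 p, SX p & forall e : R, 0 < e -> exists N, forall k, (N <= k)%N -> nX (y k - p) <= e.
  apply: (X_complete Sy) => e e0.
  (* e1 bounds the two derivative terms, tested on z with |z| <= 2 B; e2 bounds the L^2 norm paired
     with a gradient difference of norm at most 2 K. *)
  pose e1 := e ^+ 2 / (2 * (4 * B + 1)); pose e2 := e ^+ 2 / (2 * (2 * K + 1)).
  have c1 : 0 < 4 * B + 1 by rewrite ltr_wpDl// mulr_ge0.
  have c2 : 0 < 2 * K + 1 by rewrite ltr_wpDl// mulr_ge0.
  have e20 : 0 < e ^+ 2 by rewrite exprn_gt0.
  have e10 : 0 < e1 by rewrite divr_gt0// mulr_gt0.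
  have e2p : 0 < e2 by rewrite divr_gt0// mulr_gt0.
  have f1 : e1 * (2 * B) + e1 * (2 * B) <= e ^+ 2 / 2.
    have -> : e ^+ 2 / 2 = e1 * (4 * B) + e1 by rewrite /e1; field; rewrite gt_eqF.
    by have := ltW e10; lra.
  have f2 : (2 * K) * e2 <= e ^+ 2 / 2.
    have -> : e ^+ 2 / 2 = (2 * K) * e2 + e2 by rewrite /e2; field; rewrite gt_eqF.
    by rewrite lerDl ltW.
  have [N1 HN1] := harm _ e10; have [N2 HN2] := Hs _ e2p.
  exists (maxn N1 N2) => j k; rewrite !geq_max => /andP[j1 j2] /andP[k1 k2].
  pose z := y j - y k; have Sz : SX z := phB P (Sy j) (Sy k).
  have zB : nX z <= 2 * B.
    have := nXB (Sy j) (Sy k); have := yB j; have := yB k; rewrite -/z.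
    move: (nX _) (nX _) (nX _) => x1 x2 x3 *; lra.
  (* The quadratic part of I' reproduces |z|^2, so the difference of derivatives leaves only the
     nonlinear term, which L^2 compactness makes small. *)
  have E : nX z ^+ 2 = denergy (y j) z - denergy (y k) z + ipL2 (GW (y j) - GW (y k)) z.1.
    rewrite /nX (nrm_sqr P Sz) {1}/z (ipBl P (Sy j) (Sy k) Sz).
    have Lz := (SX_L2 Sz).1.
    rewrite (ipBl (L2_ph R n) (LGy j) (LGy k) Lz) /denergy.
    move: (ipX _ _) (ipX _ _) (ipL2 _ _) (ipL2 _ _) => x1 x2 x3 x4; ring.
  rewrite -ler_sqr ?nnegrE ?nX_ge0 ?(ltW e0)// -/z E {E}.
  have d1 : denergy (y j) z <= e1 * (2 * B).
    apply: le_trans (ler_norm _) _; apply: (le_trans (dy j z Sz)).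
    by apply: ler_pM; [rewrite /harmonic /= invr_ge0 | exact: nX_ge0 | exact: HN1 | exact: zB].
  have d2 : - denergy (y k) z <= e1 * (2 * B).
    apply: le_trans (ler_norm _) _; rewrite normrN; apply: (le_trans (dy k z Sz)).
    by apply: ler_pM; [rewrite /harmonic /= invr_ge0 | exact: nX_ge0 | exact: HN1 | exact: zB].
  have d3 : ipL2 (GW (y j) - GW (y k)) z.1 <= (2 * K) * e2.
    apply: le_trans (ler_norm _) _.
    apply: le_trans (ipL2_le (L2B (LGy j) (LGy k)) (SX_L2 Sz).1) _.
    apply: ler_pM; [exact: nL2_ge0 | exact: nL2_ge0 | | exact: HN2].
    apply: le_trans (nrmB (L2_ph R n) (LGy j) (LGy k)) _.
    by rewrite mulr_natl mulr2n; apply: lerD; apply: HK.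
  move: (denergy _ _) (denergy _ _) (ipL2 _ _) d1 d2 d3 => x1 x2 x3 d1 d2 d3; lra.
have dp v : SX v -> denergy p v = 0.
  move=> Sv; apply/eqP; rewrite -normr_le0; apply/ler_addgt0Pr => e e0; rewrite add0r.
  pose e1 := e / (2 * (nX v + 1)).
  have v0 : 0 <= nX v by exact: nX_ge0.
  have v1 : 0 < nX v + 1 by rewrite ltr_wpDl.
  have e10 : 0 < e1 by rewrite divr_gt0// mulr_gt0.
  have [d d0 Hd] := denergy_cont (B + nX p) e10.
  have [N1 HN1] := harm _ e10; have [N2 HN2] := yp d d0.
  pose k := maxn N1 N2.
  have g1 : `|denergy (y k) v| <= e1 * nX v.
    by apply: (le_trans (dy k v Sv)); rewrite ler_wpM2r// HN1// leq_maxl.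
  have g2 : `|denergy (y k) v - denergy p v| <= e1 * nX v.
    apply: Hd => //; last by apply: HN2; exact: leq_maxr.
      by apply: (le_trans (yB k)); rewrite lerDl nX_ge0.
    by rewrite lerDr.
  have f1 : e1 * nX v + e1 * nX v <= e.
    have -> : e = 2 * (e1 * nX v) + 2 * e1 by rewrite /e1; field; rewrite gt_eqF.
    by have := ltW e10; lra.
  have -> : denergy p v = denergy (y k) v - (denergy (y k) v - denergy p v) by rewrite opprB addrC subrK.
  by apply: le_trans (ler_normB _ _) _; apply: le_trans f1; exact: lerD.
exists p; split => // ae0.
(* If p vanishes almost everywhere, testing with p itself gives |p|^2 = 0. The almost critical
   points then tend to 0 in norm, and I(y) <= |y|^2 / 2 <= al / 2 contradicts I(y) >= al. *)
have z0 : nX p = 0.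
  apply/eqP; rewrite -sqrf_eq0 /nX (nrm_sqr P Sp).
  have := dp p Sp; rewrite /denergy => /eqP; rewrite subr_eq0 => /eqP ->.
  have LGp := L2_GW Sp; have Lp := (SX_L2 Sp).1.
  have m := integ_msr (L2_integ LGp Lp).
  have aez : {ae mu, forall t, dotv (GW p t) (p.1 t) = 0}.
    by apply: (@filterS _ _ (ae_filter_ringOfSetsType mu) _ _ _ ae0) => t ->; rewrite dotvC dotv0l.
  have [_ z] := Ig_ae m (@integrable0 _ _ R mu setT) aez.
  by rewrite /ipL2 z /Rintegral integral0.
have [N HN] := yp (Num.sqrt al) (ltac:(rewrite sqrtr_gt0//)).
have h1 : nX (y N) <= Num.sqrt al.
  have := nXD (phB P (Sy N) Sp) Sp; rewrite subrK z0 addr0 => h.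
  by apply: (le_trans h); exact: HN.
have h2 : nX (y N) ^+ 2 <= al.
  by rewrite -[leRHS]sqr_sqrtr ?(ltW al0)// ler_sqr ?nnegrE ?nX_ge0 ?sqrtr_ge0.
have [_ _ h3 _] := Hx (s N).
have h4 := PW_ge0 (Sy N).
move: h3; rewrite -/(y N) /energy; move: (PW _) h4 => w h4; lra.
Qed.

End XSpace.

Theorem theorem1p1 (R : realType) (n : nat) (alpha : R)
  (L : R -> 'M[R]_n) (W : R -> 'rV[R]_n -> R) :
  (1 <= n)%N ->
  1 / 2 < alpha -> alpha < 1 ->
  (* (L) *)
  continuous L ->
  (forall t, (L t)^T = L t) ->
  (forall t (x : 'rV[R]_n), x != 0 -> 0 < qform (L t) x x) ->
  (exists l : R -> R,
     continuous l /\ (forall t, 0 < l t) /\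
     (l t @[t --> +oo%R] --> +oo%R) /\ (l t @[t --> -oo%R] --> +oo%R) /\
     (forall t x, l t * sqnorm x <= qform (L t) x x)) ->
  (* (W1) *)
  C1W W ->
  (exists mu : R, 2 < mu /\
     forall t (x : 'rV[R]_n), x != 0 ->
       0 < mu * W t x /\ mu * W t x <= dotv x (gradW W t x)) ->
  (* (W2) *)
  (forall eps : R, 0 < eps -> exists delta : R, 0 < delta /\
     forall t (x : 'rV[R]_n), enorm x < delta ->
       enorm (gradW W t x) <= eps * enorm x) ->
  (* (W3) *)
  (exists Wbar : 'rV[R]_n -> R, continuous Wbar /\
     forall t x, `|W t x| + enorm (gradW W t x) <= `|Wbar x|) ->
  (* conclusion: a nontrivial weak solution u in X^alpha *)
  exists u g : R -> 'rV[R]_n,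
    Xalpha_der alpha L u g /\
    lebesgue_measure [set t | u t != 0] != 0%E /\
    forall v h : R -> 'rV[R]_n, Xalpha_der alpha L v h ->
      (\int[lebesgue_measure]_t
          ((dotv (g t) (h t) + qform (L t) (u t) (v t))%:E) =
       \int[lebesgue_measure]_t ((dotv (gradW W t (u t)) (v t))%:E))%E.
Proof.
move=> n0 a0 a1 cL sL _ [l [cl [l0 [ly [lNy lb]]]]] C1 [th [th2 AR]] W2 W3.
have H : coercive L l by split.
have HW : nonlin W th by split.
have [p [Sp dp pn0]] := critical_point n0 a0 a1 H HW.
have [Lu Lg] := SX_L2 Sp.
exists p.1, p.2; split; [|split].
- split.
    split; first exact/L2funP.
    split; first exact/L2funP.
    have [[_ _ [phi [s cu cg _]]] _] := Sp.
    exists phi; split => //.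
    have Lp k : L2 (phi k) by have [] := smooth_L2 a0 a1 (s k).
    have Ld k : L2 (LWderv alpha (phi k)) by have [] := smooth_L2 a0 a1 (s k).
    by split; [apply/(nL2_cvgP Lp Lu) | apply/(nL2_cvgP Ld Lg)].
  have := integ_fin (SX_integ H Sp Sp) => E.
  by apply: (@le_lt_trans _ _ (Ig (fun t => dotv (p.2 t) (p.2 t) + qform (L t) (p.1 t) (p.1 t)))%:E); [rewrite -E | rewrite ltry].
(* The set where p.1 is nonzero is Borel, being the preimage of the nonzero reals under a measurable
   function, so it is itself the exceptional null set. *)
- apply/negP => /eqP z; apply: pn0.
  exists [set t | p.1 t != 0]; split => //.
    rewrite (_ : [set t | p.1 t != 0] = setT `&` (fun t => sqnorm (p.1 t)) @^-1` (~` [set 0])).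
      by apply: (integ_msr Lu.2) => //; apply: measurableC; exact: measurable_set1.
    by apply/seteqP; split => [t /=|t /= [_]]; rewrite -sqnorm_eq0 => /eqP.
  by move=> t /= h; apply/eqP.
move=> v h [Hv Fv].
(* The test function v is arbitrary up to null sets; its representative w in [HS] agrees with it
   almost everywhere, which changes none of the integrals. *)
have [w Hw vw] := Halpha_repr a0 a1 Hv.
have [/L2funP Lv _] := Hv; have [_ Lh _] := Hw.
have Lw : L2 w by have [] := Hw.
have mq := measurable_qform H Lv.1 Lv.1.
have q0 t x : 0 <= qform (L t) x x by exact: (qform_ge0 H).
have iF : integ (fun t => sqnorm (h t) + qform (L t) (v t) (v t)).
  apply: integ_lty Fv; last by move=> t; rewrite addr_ge0// sqnorm_ge0.
  by apply: measurable_funD => //; exact: (integ_msr Lh.2).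
(* The hypothesis bounds the sum of two terms; both are nonnegative, so each is integrable. *)
have iq : integ (fun t => qform (L t) (v t) (v t)).
  apply: integ_le mq iF _ => t; rewrite ger0_norm//.
  by rewrite lerDr sqnorm_ge0.
have aeF := ae_filter_ringOfSetsType (@lebesgue_measure R).
have Sw : SX alpha L (w, h).
  split; first exact: Hw.
  have mw := measurable_qform H Lw.1 Lw.1.
  have ae_q : {ae lebesgue_measure, forall t, qform (L t) (w t) (w t) = qform (L t) (v t) (v t)}.
    by apply: (@filterS _ _ aeF _ _ _ vw) => t ->.
  by have [] := Ig_ae mw iq ae_q.
have E := dp _ Sw.
have LG := L2_GW n0 a0 a1 H HW Sp.
have [i1 e1] : integ (fun t => dotv (p.2 t) (h t) + qform (L t) (p.1 t) (v t)) /\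
    Ig (fun t => dotv (p.2 t) (h t) + qform (L t) (p.1 t) (v t)) = ipX L p (w, h).
  apply: Ig_ae.
  - apply: measurable_funD; last exact: (measurable_qform H Lu.1 Lv.1).
    exact: (measurable_dotv Lg.1 Lh.1).
  - exact: (SX_integ H Sp Sw).
  - by apply: (@filterS _ _ aeF _ _ _ vw) => t ->.
have [i2 e2] : integ (fun t => dotv (gradW W t (p.1 t)) (v t)) /\
    Ig (fun t => dotv (gradW W t (p.1 t)) (v t)) = ipL2 (GW W p) w.
  apply: Ig_ae.
  - exact: (measurable_dotv LG.1 Lv.1).
  - exact: (L2_integ LG Lw).
  - by apply: (@filterS _ _ aeF _ _ _ vw) => t ->.
rewrite (integ_fin i1) (integ_fin i2); congr (_%:E).
by rewrite e1 e2; apply/eqP; rewrite -subr_eq0; apply/eqP.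
Qed.
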